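(* Let $(X_j,Y_j,S_j)$, $j\in\mathbb{Z}$, be a FAIM process, and let $Z_n$ be its Bhattacharyya process. Then $Z_n$ polarizes fast to $1$, and for every $\beta<1/2$, \[\lim_{N\to\infty}\frac{1}{N}\left|\left\{i\in\{1,\dots,N\}: Z(U_i\mid Q_i)>1-2^{-N^{\beta}}\right\}\right| = \bar H(X\mid Y),\] where $N=2^n$ and $n\to\infty$.
   Context: Parameters: for a binary random variable $U$ and a random variable $Q$ taking values in a finite alphabet, with joint law $P_{U,Q}$, the Bhattacharyya parameter is $Z(U|Q)=2\sum_q\sqrt{P_{U,Q}(0,q)P_{U,Q}(1,q)}$, the total variation distance is $K(U|Q)=\sum_q|P_{U,Q}(0,q)-P_{U,Q}(1,q)|$, and $H(U|Q)$ is the conditional entropy (base 2). Conditioning on several variables means treating their tuple as the observation. FAIM process: $(X_j,Y_j,S_j)$, $j\in\mathbb{Z}$, is strictly stationary, $X_j\in\{0,1\}$, $Y_j$ takes values in a finite alphabet $\mathcal{Y}$, $S_j$ takes values in a finite set $\mathcal{S}$; the conditional law $P_{X_j,Y_j,S_j|S_{j-1}}$ does not depend on $j$; and (Markov property) conditioned on $S_{j-1}$, the variables $\{X_k,Y_k,S_k\}_{k\ge j}$ are independent of $\{X_l,Y_l,S_{l-1}\}_{l<j}$. The state sequence $(S_j)$ is a homogeneous, finite-state, stationary, aperiodic and irreducible Markov chain. Polarization setup: for $n\ge1$, $N=2^n$, $G_N=B_NG_2^{\otimes n}$ with $G_2=\begin{bmatrix}1&0\\1&1\end{bmatrix}$,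 $G_2^{\otimes n}$ its $n$-fold Kronecker power and $B_N$ the $N\times N$ bit-reversal permutation matrix (arithmetic modulo 2). Set $U_1^N=X_1^NG_N$ and $Q_i=(U_1^{i-1},Y_1^N)$. Let $B_1,B_2,\dots$ be i.i.d. Bernoulli$(1/2)$ and let $i$ be defined by $i-1=\sum_{j=1}^nB_j2^{n-j}$. The Bhattacharyya process is $Z_n=Z(U_i|Q_i)$ (a random variable through $B_1,\dots,B_n$). Also $\bar H(X|Y)=\lim_{N\to\infty}\frac1N H(X_1^N|Y_1^N)$. A $[0,1]$-valued sequence $A_n$ polarizes if it converges almost surely to a $\{0,1\}$-valued random variable $A_\infty$; it polarizes fast to $1$ (with $\beta>0$) if it polarizes and $\lim_{n\to\infty}\Pr(A_n>1-2^{-2^{n\beta}})=\Pr(A_\infty=1)$. ''Polarizes fast to 1'' without $\beta$ means for some $\beta>0$. *)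

(* Defs.v *)
From HB Require Import structures.
From mathcomp Require Import all_boot all_order all_algebra.
From mathcomp Require Import all_classical all_reals all_analysis.
From mathcomp Require Import zify.
Import Order.TTheory GRing.Theory Num.Theory.
Import numFieldNormedType.Exports.

Set Implicit Arguments.
Unset Strict Implicit.
Unset Printing Implicit Defensive.

Local Open Scope ring_scope.
Local Open Scope classical_set_scope.

Definition Pr {d} {T : measurableType d} {R : realType}
  (P : probability T R) (A : set T) : R := fine (P A).

Definition log2 {R : realType} (x : R) : R := ln x / ln 2.

Definition Bhat {R : realType} (Q : finType) (p : 'F_2 -> Q -> R) : R :=
  2 * \sum_(q : Q) Num.sqrt (p 0 q * p 1 q).

Definition condEnt {R : realType} (A B : finType) (p : A -> B -> R) : R :=
  - \sum_(a : A) \sum_(b : B)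
      (if p a b == 0 then 0 else p a b * log2 (p a b / \sum_(a' : A) p a' b)).

Definition G2 : 'M['F_2]_2 :=
  \matrix_(i < 2, j < 2) (if (j <= i)%N then 1 else 0).

(* entries of the n-fold Kronecker power A^{(x) n}, with              *)
(* A^{(x) (n+1)} = A (x) A^{(x) n}:  ((a,b),(c,d)) |-> A a c * A^n b d,  *)
(* where the row index of (a,b) is a * 2^n + b.                        *)
Fixpoint kronpow_entry (A : 'M['F_2]_2) (n : nat) (i j : nat) : 'F_2 :=
  match n with
  | 0 => 1
  | n'.+1 => A (inord (i %/ 2 ^ n')) (inord (j %/ 2 ^ n'))
             * kronpow_entry A n' (i %% 2 ^ n') (j %% 2 ^ n')
  end.

Definition kronpow (A : 'M['F_2]_2) (n : nat) : 'M['F_2]_(2 ^ n) :=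
  \matrix_(i, j) kronpow_entry A n i j.

Definition bitrev (n i : nat) : nat :=
  \sum_(k < n) (odd (i %/ 2 ^ k)) * 2 ^ (n - k.+1).

Definition bitrev_mx (n : nat) : 'M['F_2]_(2 ^ n) :=
  \matrix_(i, j) (if (j : nat) == bitrev n i then 1 else 0).

Definition GN (n : nat) : 'M['F_2]_(2 ^ n) := bitrev_mx n *m kronpow G2 n.

Section FAIM.
Context {R : realType} {d : measure_display} {T : measurableType d}
  (P : probability T R) {Yt St : finType}
  (X : int -> T -> 'F_2) (Y : int -> T -> Yt) (S : int -> T -> St).

Definition process_measurable : Prop :=
  (forall j x, measurable [set t | X j t = x]) /\
  (forall j y, measurable [set t | Y j t = y]) /\
  (forall j s, measurable [set t | S j t = s]).

Definition strictly_stationary : Prop :=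
  forall (m : nat) (idx : 'I_m -> int) (k : int) (v : 'I_m -> 'F_2 * Yt * St),
    P [set t | forall l, (X (idx l) t, Y (idx l) t, S (idx l) t) = v l] =
    P [set t | forall l, (X (idx l + k) t, Y (idx l + k) t, S (idx l + k) t) = v l].

(* P_{X_j,Y_j,S_j | S_{j-1}} does not depend on j (cross-multiplied form) *)
Definition time_invariant_kernel : Prop :=
  forall (j j' : int) x y s s',
    Pr P [set t | X j t = x /\ Y j t = y /\ S j t = s /\ S (j - 1) t = s']
      * Pr P [set t | S (j' - 1) t = s'] =
    Pr P [set t | X j' t = x /\ Y j' t = y /\ S j' t = s /\ S (j' - 1) t = s']
      * Pr P [set t | S (j - 1) t = s'].

(* Markov property: given S_{j-1}, {X_k,Y_k,S_k}_{k>=j} is independent of *)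
(* {X_l,Y_l,S_{l-1}}_{l<j}; stated on all finite cylinder events (which   *)
(* form pi-systems generating the two sigma-algebras), as the product     *)
(* rule P(F,Pa,C) P(C) = P(F,C) P(Pa,C) for C = {S_{j-1} = s}.           *)
Definition markov_property : Prop :=
  forall (j : int) (m m' : nat) (fut : 'I_m -> 'F_2 * Yt * St)
         (past : 'I_m' -> 'F_2 * Yt * St) (s : St),
    let F := [set t | forall l : 'I_m,
                (X (j + l%:Z) t, Y (j + l%:Z) t, S (j + l%:Z) t) = fut l] in
    let Pa := [set t | forall l : 'I_m',
                (X (j - l.+1%:Z) t, Y (j - l.+1%:Z) t, S (j - l.+2%:Z) t) = past l] in
    let C := [set t | S (j - 1) t = s] in
    Pr P (F `&` Pa `&` C) * Pr P C = Pr P (F `&` C) * Pr P (Pa `&` C).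

Definition state_markov_chain : Prop :=
  (forall (j : int) (m : nat) (s : 'I_m.+2 -> St),
    Pr P [set t | forall l : 'I_m.+2, S (j + l%:Z) t = s l]
      * Pr P [set t | S (j + m%:Z) t = s (inord m)] =
    Pr P [set t | forall l : 'I_m.+1, S (j + l%:Z) t = s (widen_ord (leqnSn _) l)]
      * Pr P [set t | S (j + m%:Z) t = s (inord m) /\ S (j + m.+1%:Z) t = s ord_max])
  /\
  (forall (j j' : int) s s',
    Pr P [set t | S (j - 1) t = s' /\ S j t = s] * Pr P [set t | S (j' - 1) t = s'] =
    Pr P [set t | S (j' - 1) t = s' /\ S j' t = s] * Pr P [set t | S (j - 1) t = s']).

Definition state_irreducible : Prop :=
  forall s s' : St, exists k : nat,
    (0 < k)%N /\ 0 < Pr P [set t | S 0 t = s' /\ S k%:Z t = s].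

Definition state_aperiodic : Prop :=
  forall (s : St) (dd : nat), (1 < dd)%N -> exists k : nat,
    [/\ (0 < k)%N, ~~ (dd %| k)%N & 0 < Pr P [set t | S 0 t = s /\ S k%:Z t = s]].

Definition FAIM : Prop :=
  [/\ process_measurable, strictly_stationary, time_invariant_kernel,
      markov_property &
      [/\ state_markov_chain, state_irreducible & state_aperiodic]].

Definition pXY (N : nat) (x : 'rV['F_2]_N) (y : 'rV[Yt]_N) : R :=
  Pr P [set t | forall k : 'I_N, X k.+1%:Z t = x 0 k /\ Y k.+1%:Z t = y 0 k].

Definition Hbar : R :=
  lim ((fun N : nat => condEnt (@pXY N) / N%:R) @ \oo).

(* joint law of (U_i, Q_i), Q_i = (U_1^{i-1}, Y_1^N), U_1^N = X_1^N G_N; *)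
(* i : 'I_(2^n) is the 0-based index (i.e. the paper's index is i+1).   *)
Definition pUQ (n : nat) (i : 'I_(2 ^ n)) (a : 'F_2)
    (q : 'rV['F_2]_i * 'rV[Yt]_(2 ^ n)) : R :=
  \sum_(x : 'rV['F_2]_(2 ^ n))
    (if ((x *m GN n) 0 i == a) &&
        [forall k : 'I_i, (x *m GN n) 0 (widen_ord (ltnW (ltn_ord i)) k) == q.1 0 k]
     then pXY x q.2 else 0).

Definition Zi (n : nat) (i : 'I_(2 ^ n)) : R := Bhat (@pUQ n i).

End FAIM.

(* The random index i, with i - 1 = sum_{j=1}^n B_j 2^(n-j).           *)
Lemma bidx_lt (n : nat) (b : nat -> bool) :
  (\sum_(j < n) b j.+1 * 2 ^ (n - j.+1) < 2 ^ n)%N.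
Proof.
elim: n b => [|n IH] b; first by rewrite big_ord0.
rewrite big_ord_recl /=.
have := IH (fun k => b k.+1).
under eq_bigr => j _ do rewrite /bump /= add1n subSS.
rewrite subn1 /= expnS.
case: (b 1%N) => /=; lia.
Qed.

Definition rand_index {d'} {T' : measurableType d'} (B : nat -> T' -> bool)
    (n : nat) (w : T') : 'I_(2 ^ n) :=
  Ordinal (bidx_lt n (fun k => B k w)).

Definition iid_bernoulli_half {R : realType} {d'} {T' : measurableType d'}
    (P' : probability T' R) (B : nat -> T' -> bool) : Prop :=
  (forall k b, measurable [set w | B k w = b]) /\
  (forall (n : nat) (b : 'I_n -> bool),
      Pr P' [set w | forall k : 'I_n, B k.+1 w = b k] = (1 / 2) ^+ n).

Definition Zproc {R : realType} {d} {T : measurableType d} (P : probability T R)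
    {Yt St : finType} (X : int -> T -> 'F_2) (Y : int -> T -> Yt)
    (S : int -> T -> St) {d'} {T' : measurableType d'} (B : nat -> T' -> bool)
    (n : nat) (w : T') : R :=
  Zi P X Y (rand_index B n w).

Definition polarizes_to {R : realType} {d'} {T' : measurableType d'}
    (P' : probability T' R) (A : nat -> T' -> R) (Ainf : T' -> R) : Prop :=
  [/\ measurable_fun setT Ainf, (forall w, Ainf w = 0 \/ Ainf w = 1) &
      {ae P', forall w, (fun n => A n w) @ \oo --> Ainf w}].

Definition polarizes_fast_to_1 {R : realType} {d'} {T' : measurableType d'}
    (P' : probability T' R) (A : nat -> T' -> R) : Prop :=
  exists Ainf : T' -> R, polarizes_to P' A Ainf /\
    exists2 beta : R, 0 < beta &
      (fun n : nat => Pr P' [set w | 1 - 2 `^ (- 2 `^ (n%:R * beta)) < A n w])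
        @ \oo --> Pr P' [set w | Ainf w = 1].

(* Main.v *)
Require Import Defs.
From HB Require Import structures.
From mathcomp Require Import all_boot all_order all_algebra.
From mathcomp Require Import all_classical all_reals all_analysis.
From mathcomp Require Import measurable_realfun.
From mathcomp Require Import zify ring lra.
Import Order.TTheory GRing.Theory Num.Theory.
Import numFieldNormedType.Exports.
Set Implicit Arguments.
Unset Strict Implicit.
Unset Printing Implicit Defensive.
Local Open Scope ring_scope.
Local Open Scope classical_set_scope.

(* Condition all observations on the states at both ends of a block.  Given the
   state in the middle, the two half blocks are then independent, and the total
   variation distance K satisfies, with psi the inverse of the least stationary
   mass, K(-) <= Kmid <= psi K^2 and K(+) <= 2 K - Kmid, where Kmid also reveals
   the middle state in the minus transform.  Since all pairs of boundary states of
   long blocks have probability bounded below, K - Kmid is bounded below whenever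
   K is away from 0 and 1; the concave potential 4 K - K^2 then makes the
   probabilities of K_n being in (e, 1 - e) summable, and as K at most doubles,
   Borel-Cantelli shows that K_n converges almost surely to 0 or 1.  By the chain
   rule, dropping the boundary states changes the average entropy by O(1/N), so
   that Z_n goes to 1 where K_n goes to 0 and to 0 elsewhere.  The squaring of K at
   minus transforms (resp. of Z at plus transforms) turns convergence to 0 into
   convergence at rate 2^-2^(n beta) for every beta < 1/2.  The rate for Z is needed
   because beta may be negative.  The limiting fraction is the limit of
   the averages of the entropies H(U_i | Q_i), hence the entropy rate. *)

(** * Two-valued observations *)

(** The obstacle is the factor psi: comparing adjacent blocks with independent ones costs it at
    every step, so [Z(-) <= 2 psi Z] and [Z(+) <= psi Z^2] say nothing until Z is known to be small.
    With the boundary states observed, the upper bounds [Kmid] and [2 K - Kmid] for the two children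
    of K average to K exactly, without any factor, and this is what makes a potential argument
    possible. The price is that K belongs to another observation than Z. Observing the states can
    only raise K, so [1 - K <= Z] settles the side where K goes to 0; but K near 1 might be due to
    the states alone. Entropy bridges that side, since over a whole block the total loss is at most
    the entropy of two states. The rate needs both parameters for the same reason: a doubly
    exponentially small K forces Z up to 1, a small Z excludes it, and the two probabilities add up
    to 1. The factor psi is harmless in this last stage, because a sequence that stays below a small
    enough constant gains more at each squaring than psi takes away. *)

Section BinaryLaws.
Context {R : realType}.
Implicit Types x y s t : R.

Lemma ln_ge1BV x : 0 < x -> 1 - x^-1 <= ln x.
Proof.
move=> x0; have h : 0 < x^-1 by rewrite invr_gt0.
have := @le_ln1Dx R (x^-1 - 1).
have -> : 1 + (x^-1 - 1) = x^-1 by ring.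
by rewrite lnV// => /(_ ltac:(lra)); lra.
Qed.

Lemma ln_leB1 x : 0 < x -> ln x <= x - 1.
Proof. 
move=> x0; have := @le_ln1Dx R (x - 1).
have -> : 1 + (x - 1) = x by ring.
by move=> /(_ ltac:(lra)).
 Qed.

(** Contribution in nats of one bit value to a conditional entropy: [x] is the joint mass of bit
    value and observation, [s] the mass of the observation. *)
Definition entropy_term (x s : R) : R := if x == 0 then 0 else x * ln (s / x).

(** With [r = sqrt (y / x)], [ln (1 + r ^ 2) <= 2 * ln (1 + r) <= 2 * r]. *)
Lemma entropy_term_le_sqrt x y : 0 <= x -> 0 <= y -> entropy_term x (x + y) <= 2 * Num.sqrt (x * y).
Proof.
move=> x0 y0; rewrite /entropy_term; case: eqVneq => [->|xn0].
  by rewrite mul0r sqrtr0 mulr0.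
have xp : 0 < x by rewrite lt_def xn0.
have r0 : 0 <= Num.sqrt (y / x) by [].
have sq : Num.sqrt (y / x) ^+ 2 = y / x by rewrite sqr_sqrtr// divr_ge0.
have -> : Num.sqrt (x * y) = x * Num.sqrt (y / x).
  have -> : x * y = x ^+ 2 * (y / x) by field.
  by rewrite sqrtrM ?sqr_ge0// sqrtr_sqr ger0_norm.
rewrite mulrCA ler_pM2l//.
have h : (x + y) / x <= (1 + Num.sqrt (y / x)) ^+ 2.
  rewrite mulrDl divff// sqrrD sq expr1n mul1r.
  by rewrite -addrA lerD2l lerDr mulrn_wge0.
have /le_trans -> // : ln ((x + y) / x) <= ln ((1 + Num.sqrt (y / x)) ^+ 2).
  by rewrite ler_ln// posrE ?divr_gt0 ?exprn_gt0//; lra.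
rewrite lnXn; last lra.
by have : ln (1 + Num.sqrt (y / x)) <= Num.sqrt (y / x); [apply: le_ln1Dx; lra | lra].
Qed.

Lemma entropy_term_ge x y : 0 <= x -> 0 <= y -> x * y / (x + y) <= entropy_term x (x + y).
Proof.
move=> x0 y0; rewrite /entropy_term; case: eqVneq => [->|xn0]; first by rewrite !mul0r.
have xp : 0 < x by rewrite lt_def xn0.
rewrite -mulrA ler_pM2l//.
have xy0 : 0 < (x + y) / x by rewrite divr_gt0//; lra.
apply: le_trans (ln_ge1BV xy0); rewrite le_eqVlt; apply/orP; left; apply/eqP.
by field; apply/andP; split => //; lra.
Qed.

(** The logarithm is linearized around the fair bit [s = 2 * x]. Summed over the two bit values [x]
    and [y], the error is [(x - y) ^ 2 / s], at most [|x - y|]; in [entropy_term_le_half] the two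
    errors cancel. *)
Lemma entropy_term_ge_half x s : 0 <= x -> 0 < s -> x * ln 2 - x * (2 * x / s - 1) <= entropy_term x s.
Proof.
move=> x0 s0; rewrite /entropy_term; case: eqVneq => [->|xn0]; first by rewrite !mul0r subr0.
have xp : 0 < x by rewrite lt_def xn0.
rewrite -mulrBr ler_pM2l//.
have -> : s / x = 2 * (2 * x / s)^-1 by field; rewrite xn0 lt0r_neq0.
have h : 0 < 2 * x / s by rewrite divr_gt0 ?mulr_gt0.
rewrite lnM ?posrE ?invr_gt0// lnV ?posrE//.
by have := ln_leB1 h; lra.
Qed.

Lemma entropy_term_le_half x s : 0 <= x -> 0 <= s -> x <= s -> entropy_term x s <= x * ln 2 + (s / 2 - x).
Proof.
move=> x0 s0 xs; rewrite /entropy_term; case: eqVneq => [->|xn0]; first by rewrite mul0r; lra.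
have xp : 0 < x by rewrite lt_def xn0.
have -> : s / x = 2 * (s / (2 * x)) by field.
have h : 0 < s / (2 * x) by rewrite divr_gt0 ?mulr_gt0//; lra.
rewrite lnM ?posrE//; have := ln_leB1 h; rewrite -(ler_pM2l xp).
have -> : x * (s / (2 * x) - 1) = s / 2 - x by field.
lra.
Qed.

Lemma ln2_gt0 : 0 < ln 2 :> R.
Proof. by apply: ln_gt0; lra. Qed.

Context {Q : finType}.
Context (p : 'F_2 -> Q -> R) (p_ge0 : forall u q, 0 <= p u q)
  (p_mass : \sum_q (p 0 q + p 1 q) = 1).

Lemma sum_F2 (V : nmodType) (f : 'F_2 -> V) : \sum_u f u = f 0 + f 1.
Proof.
rewrite (bigD1 0)//= (bigD1 1)//= big1 ?addr0// => i /andP[i0 i1].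
by case: i i0 i1 => [[|[|k]]].
Qed.

Definition tv : R := \sum_q `|p 0 q - p 1 q|.

Lemma tv_ge0 : 0 <= tv. Proof. exact: sumr_ge0. Qed.

Lemma tv_le1 : tv <= 1.
Proof.
rewrite -[leRHS]p_mass; apply: ler_sum => q _.
have := p_ge0 0 q; have := p_ge0 1 q; rewrite ler_norml; lra.
Qed.

Lemma condEnt_entropy_term : condEnt p * ln 2 = \sum_q (entropy_term (p 0 q) (p 0 q + p 1 q) + entropy_term (p 1 q) (p 0 q + p 1 q)).
Proof.
rewrite /condEnt sum_F2 -big_split/= -sumrN big_distrl/=; apply: eq_bigr => q _.
rewrite sum_F2.
have E x y : 0 <= x -> 0 <= y -> - (if x == 0 then 0 else x * log2 (x / (x + y))) * ln 2 = entropy_term x (x + y).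
  move=> x0 y0; rewrite /entropy_term; case: eqVneq => [_|xn0]; first by rewrite oppr0 mul0r.
  have xp : 0 < x by rewrite lt_def xn0.
  rewrite -mulrN -mulrA; congr *%R; rewrite mulNr /log2 divfK ?gt_eqF ?ln2_gt0//.
  by rewrite -lnV ?posrE ?divr_gt0 ?invf_div//; lra.
rewrite opprD mulrDl; congr +%R; first exact: E.
by rewrite [p 0 q + p 1 q]addrC E.
Qed.

(** The geometric mean of two masses is at least the smaller one, and twice the smaller one is their
    sum minus their distance. *)
Lemma Bhat_ge_tv : 1 - tv <= Bhat p.
Proof.
rewrite /Bhat -[X in X - _]p_mass -sumrB mulr_sumr; apply: ler_sum => q _.
wlog h : / p 0 q <= p 1 q => [W|].
  case: (leP (p 0 q) (p 1 q)) => h; first exact: W.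
  have -> : `|p 0 q - p 1 q| = p 0 q - p 1 q by apply: ger0_norm; lra.
  have : p 1 q <= Num.sqrt (p 0 q * p 1 q); last lra.
  have {1}-> : p 1 q = Num.sqrt (p 1 q ^+ 2) by rewrite sqrtr_sqr ger0_norm.
  by rewrite ler_wsqrtr// expr2 ler_wpM2r// ltW.
have -> : `|p 0 q - p 1 q| = p 1 q - p 0 q by rewrite ler0_norm; lra.
have : p 0 q <= Num.sqrt (p 0 q * p 1 q); last lra.
have {1}-> : p 0 q = Num.sqrt (p 0 q ^+ 2) by rewrite sqrtr_sqr ger0_norm.
by rewrite ler_wsqrtr// expr2 ler_wpM2l.
Qed.

(** Weighted AM-GM. The free weight [t] stands in for Cauchy-Schwarz: bounds below stay linear in
    the sums, and [t] is chosen at the point of use. *)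
Lemma sqrtM_le x y t : 0 <= x -> 0 <= y -> 0 < t -> 2 * Num.sqrt (x * y) <= x / t + t * y.
Proof.
move=> x0 y0 t0.
have -> : x * y = (x / t) * (t * y) by field; rewrite gt_eqF.
have a0 : 0 <= x / t by rewrite divr_ge0// ltW.
have b0 : 0 <= t * y by rewrite mulr_ge0// ltW.
rewrite sqrtrM//.
have := sqr_ge0 (Num.sqrt (x / t) - Num.sqrt (t * y)).
rewrite sqrrB !sqr_sqrtr//; lra.
Qed.

(** With [s] the sum and [d] the distance of the two masses, [4 * p0 * p1 = (s - d) * (s + d)];
    apply [sqrtM_le] to these factors and use [s + d <= 2 * s]. *)
Lemma Bhat_le_tv t : 0 < t -> Bhat p <= (1 - tv) / (2 * t) + t.
Proof.
move=> t0; rewrite /Bhat /tv.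
have -> : (1 - \sum_q `|p 0 q - p 1 q|) / (2 * t) + t =
  \sum_q ((p 0 q + p 1 q - `|p 0 q - p 1 q|) / (2 * t) + t * (p 0 q + p 1 q)).
  by rewrite big_split/= -mulr_sumr p_mass mulr1 -mulr_suml sumrB p_mass.
rewrite mulr_sumr; apply: ler_sum => q _.
have p0 := p_ge0 0 q; have p1 := p_ge0 1 q.
have nn : `|p 0 q - p 1 q| <= p 0 q + p 1 q by rewrite ler_norml; lra.
have d0 : 0 <= `|p 0 q - p 1 q| by [].
have -> : 2 * Num.sqrt (p 0 q * p 1 q) = Num.sqrt ((p 0 q + p 1 q - `|p 0 q - p 1 q|) * (p 0 q + p 1 q + `|p 0 q - p 1 q|)).
  rewrite -subr_sqr real_normK ?num_real//.
  have -> : (p 0 q + p 1 q) ^+ 2 - (p 0 q - p 1 q) ^+ 2 = 2 ^+ 2 * (p 0 q * p 1 q) by ring.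
  by rewrite [RHS]sqrtrM ?sqr_ge0// sqrtr_sqr ger0_norm.
have := @sqrtM_le (p 0 q + p 1 q - `|p 0 q - p 1 q|) (p 0 q + p 1 q + `|p 0 q - p 1 q|) t.
move=> /(_ ltac:(lra) ltac:(lra) t0).
have -> : (p 0 q + p 1 q - `|p 0 q - p 1 q|) / (2 * t) = (p 0 q + p 1 q - `|p 0 q - p 1 q|) / t / 2.
  by field; rewrite gt_eqF.
have : t * (p 0 q + p 1 q + `|p 0 q - p 1 q|) <= t * (2 * (p 0 q + p 1 q)) by rewrite ler_pM2l//; lra.
set e := _ / t; lra.
Qed.

Lemma condEnt_le_Bhat : condEnt p * ln 2 <= 2 * Bhat p.
Proof.
rewrite condEnt_entropy_term /Bhat !mulr_sumr; apply: ler_sum => q _.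
have := entropy_term_le_sqrt (p_ge0 0 q) (p_ge0 1 q); have := entropy_term_le_sqrt (p_ge0 1 q) (p_ge0 0 q).
rewrite [p 1 q * p 0 q]mulrC [p 1 q + p 0 q]addrC; lra.
Qed.

(** Both entropy terms of an observation of mass [s] are at least [p0 * p1 / s]; [sqrtM_le] is
    applied to the product of this quantity and [s]. *)
Lemma Bhat_le_condEnt t : 0 < t -> Bhat p <= t + condEnt p * ln 2 / (2 * t).
Proof.
move=> t0; rewrite condEnt_entropy_term /Bhat.
have tE : \sum_q t * (p 0 q + p 1 q) = t by rewrite -mulr_sumr p_mass mulr1.
rewrite -[X in X + _]tE mulr_suml mulr_sumr -big_split/=.
apply: ler_sum => q _.
have p0 := p_ge0 0 q; have p1 := p_ge0 1 q.
have := entropy_term_ge p0 p1; have := entropy_term_ge p1 p0.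
rewrite [p 1 q * p 0 q]mulrC [p 1 q + p 0 q]addrC => h1 h2.
have h3 : (p 0 q * p 1 q / (p 0 q + p 1 q)) / t <=
   (entropy_term (p 0 q) (p 0 q + p 1 q) + entropy_term (p 1 q) (p 0 q + p 1 q)) / (2 * t).
  by rewrite ler_pdivlMr ?mulr_gt0// mulrCA mulfVK ?gt_eqF//; lra.
apply: le_trans (lerD (lexx _) h3).
have [s0|sn0] := eqVneq (p 0 q + p 1 q) 0.
  have -> : p 0 q = 0 by lra.
  by rewrite !mul0r sqrtr0 mulr0 addr0; apply: mulr_ge0; lra.
have sp : 0 < p 0 q + p 1 q by rewrite lt_def sn0 addr_ge0.
have := @sqrtM_le (p 0 q * p 1 q / (p 0 q + p 1 q)) (p 0 q + p 1 q) t.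
rewrite divfK// => /(_ _ _ t0) -/(_ _ _)/le_trans; apply.
- by rewrite divr_ge0 ?mulr_ge0// ltW.
- exact: ltW.
- by rewrite addrC.
Qed.

Lemma sum_mass_ln2 : \sum_q (p 0 q + p 1 q) * ln 2 = ln 2.
Proof. by rewrite -mulr_suml p_mass mul1r. Qed.

Lemma condEnt_ge_tv : 1 - tv / ln 2 <= condEnt p.
Proof.
rewrite -(ler_pM2r ln2_gt0) mulrBl divfK ?gt_eqF ?ln2_gt0// mul1r condEnt_entropy_term.
rewrite -[X in X - _]sum_mass_ln2 /tv -sumrB; apply: ler_sum => q _.
have p0 := p_ge0 0 q; have p1 := p_ge0 1 q.
have [s0|sn0] := eqVneq (p 0 q + p 1 q) 0.
  have -> : p 0 q = 0 by lra.
  have -> : p 1 q = 0 by lra.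
  by rewrite /entropy_term eqxx addr0 mul0r subrr normr0 subr0.
have sp : 0 < p 0 q + p 1 q by rewrite lt_def sn0 addr_ge0.
have := entropy_term_ge_half p0 sp; have := entropy_term_ge_half p1 sp.
suff : p 0 q * (2 * p 0 q / (p 0 q + p 1 q) - 1) + p 1 q * (2 * p 1 q / (p 0 q + p 1 q) - 1)
   <= `|p 0 q - p 1 q| by lra.
have -> : p 0 q * (2 * p 0 q / (p 0 q + p 1 q) - 1) + p 1 q * (2 * p 1 q / (p 0 q + p 1 q) - 1)
  = (p 0 q - p 1 q) ^+ 2 / (p 0 q + p 1 q) by field.
rewrite ler_pdivrMr// -real_normK ?num_real// expr2 ler_wpM2l// ler_norml; lra.
Qed.

Lemma condEnt_le1 : condEnt p <= 1.
Proof.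
rewrite -(ler_pM2r ln2_gt0) condEnt_entropy_term mul1r -[leRHS]sum_mass_ln2; apply: ler_sum => q _.
have p0 := p_ge0 0 q; have p1 := p_ge0 1 q.
have := @entropy_term_le_half (p 0 q) (p 0 q + p 1 q); have := @entropy_term_le_half (p 1 q) (p 0 q + p 1 q).
by move=> /(_ p1 ltac:(lra) ltac:(lra)) h1 /(_ p0 ltac:(lra) ltac:(lra)) h2; lra.
Qed.

Lemma condEnt_ge0 : 0 <= condEnt p.
Proof.
rewrite -(ler_pM2r ln2_gt0) mul0r condEnt_entropy_term; apply: sumr_ge0 => q _.
have p0 := p_ge0 0 q; have p1 := p_ge0 1 q.
apply: addr_ge0; first by apply: le_trans (entropy_term_ge p0 p1); rewrite divr_ge0 ?mulr_ge0 ?addr_ge0.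
by rewrite addrC; apply: le_trans (entropy_term_ge p1 p0); rewrite divr_ge0 ?mulr_ge0 ?addr_ge0.
Qed.

Lemma Bhat_ge0 : 0 <= Bhat p.
Proof. by rewrite mulr_ge0// sumr_ge0. Qed.

Lemma Bhat_le1 : Bhat p <= 1.
Proof.
rewrite /Bhat -[leRHS]p_mass mulr_sumr; apply: ler_sum => q _.
by have := sqrtM_le (p_ge0 0 q) (p_ge0 1 q) ltr01; rewrite divr1 mul1r.
Qed.

End BinaryLaws.

(** * Entropy of finite weights *)

Section Entropy.
Context {R : realType} {W : finType} (m : W -> R).

Definition law {A : eqType} (f : W -> A) (a : A) : R := \sum_(w | f w == a) m w.

(* In nats, whereas [condEnt] is in bits. *)
Definition ent {A : eqType} (f : W -> A) : R := - \sum_w m w * ln (law f (f w)).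

(** [ent] sums over the sample space and sees [f] only through its level sets, so an observation may
    be re-encoded in any other type. Every change of encoding of an entropy below rests on this. *)
Lemma ent_kernel (A B : eqType) (f : W -> A) (g : W -> B) :
  (forall w w', (f w == f w') = (g w == g w')) -> ent f = ent g.
Proof.
move=> fg; rewrite /ent; congr (- _); apply: eq_bigr => w _; congr (_ * ln _).
by apply: eq_bigl => w'; exact: fg.
Qed.

Context (m_ge0 : forall w, 0 <= m w) (m_mass : \sum_w m w = 1).

Lemma law_ge0 (A : eqType) (f : W -> A) a : 0 <= law f a.
Proof. exact: sumr_ge0. Qed.

Lemma le_law (A : eqType) (f : W -> A) w : m w <= law f (f w).
Proof. by rewrite /law (bigD1 w)//= lerDl sumr_ge0. Qed.

Lemma law_gt0 (A : eqType) (f : W -> A) w : m w != 0 -> 0 < law f (f w).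
Proof. by move=> mw; apply: lt_le_trans (le_law f w); rewrite lt_def mw m_ge0. Qed.

Lemma law_sub (A B : eqType) (f : W -> A) (g : W -> B) a b :
  (forall w, f w == a -> g w == b) -> law f a <= law g b.
Proof.
move=> fg; rewrite /law [leLHS]big_mkcond [leRHS]big_mkcond/=.
apply: ler_sum => w _; case: ifP => [/fg ->//|_]; case: ifP => // _; exact: m_ge0.
Qed.

Lemma class_le1 (A : eqType) (f : W -> A) a : \sum_(w | f w == a) m w / law f a <= 1.
Proof.
rewrite -mulr_suml -/(law f a); have [->|n0] := eqVneq (law f a) 0.
  by rewrite mul0r.
by rewrite divff.
Qed.

(** [ln r <= r - 1], averaged. The entropy inequalities below apply it to a ratio [r] of two
    candidate laws. *)
Lemma gibbs (r : W -> R) : (forall w, m w != 0 -> 0 < r w) ->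
  \sum_w m w * r w <= 1 -> \sum_w m w * ln (r w) <= 0.
Proof.
move=> r0 h; apply: (@le_trans _ _ (\sum_w (m w * r w - m w))); last first.
  by rewrite sumrB m_mass; lra.
apply: ler_sum => w _; have [->|n0] := eqVneq (m w) 0.
  by rewrite !mul0r subrr.
by rewrite -[X in _ - X]mulr1 -mulrBr ler_wpM2l// ln_leB1// r0.
Qed.

(** Conditioning on [g] in addition to [h] does not raise the entropy of [f]. The ratio compares the
    true law with the one that makes [f] and [g] conditionally independent given [h]. *)
Lemma ent_submod (A B C : eqType) (f : W -> A) (g : W -> B) (h : W -> C) :
  ent (fun w => (f w, g w, h w)) + ent h <=
  ent (fun w => (f w, h w)) + ent (fun w => (g w, h w)).
Proof.
set fgh := fun w => (f w, g w, h w); set fh := fun w => (f w, h w).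
set gh := fun w => (g w, h w).
pose r w := law fh (fh w) * law gh (gh w) / (law fgh (fgh w) * law h (h w)).
have rp w : m w != 0 -> 0 < r w.
  by move=> mw; rewrite divr_gt0 ?mulr_gt0 ?law_gt0.
suff /(gibbs rp) : \sum_w m w * r w <= 1.
  rewrite (eq_bigr (fun w => m w * ln (law fh (fh w)) + m w * ln (law gh (gh w))
     - (m w * ln (law fgh (fgh w)) + m w * ln (law h (h w))))) => [|w _]; last first.
    have [->|mw] := eqVneq (m w) 0; first by rewrite !mul0r !addr0 subrr.
    have [[[a1 a2] a3] a4] := (law_gt0 fh mw, law_gt0 gh mw, law_gt0 fgh mw, law_gt0 h mw).
    by rewrite ln_div ?posrE ?mulr_gt0// !lnM ?posrE// mulrBr !mulrDr.
  by rewrite sumrB !big_split/= /ent; lra.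
(* The two laws in the numerator of [r] are expanded into sums over [w'] and [w'']. Summing over [w]
   first then cancels [law fgh], and [h w' = h w''] is forced since both equal [h w]. *)
pose F w w' w'' := if (fh w' == fh w) && (gh w'' == gh w) then
   m w * (m w' * m w'') / (law fgh (fgh w) * law h (h w)) else 0.
have -> : \sum_w m w * r w = \sum_w' \sum_w'' \sum_w F w w' w''.
  transitivity (\sum_w \sum_w' \sum_w'' F w w' w''); last first.
    by rewrite exchange_big/=; apply: eq_bigr => w' _; rewrite exchange_big.
  apply: eq_bigr => w _; rewrite /r {1}/law big_distrl/= mulr_suml mulr_sumr big_mkcond/=.
  apply: eq_bigr => w' _; rewrite /F; case: ifP => e1 /=; last by rewrite big1.
  rewrite /law mulr_sumr mulr_suml mulr_sumr big_mkcond/=; apply: eq_bigr => w'' _.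
  by case: ifP => e2 //; rewrite !mulrA.
apply: (@le_trans _ _ (\sum_w' \sum_w'' if h w'' == h w' then m w' * m w'' / law h (h w') else 0)).
  apply: ler_sum => w' _; apply: ler_sum => w'' _.
  case: ifP => [/eqP hw|hw]; last first.
    rewrite big1// => w _; rewrite /F; case: ifP => // /andP[/eqP[_ e1] /eqP[_ e2]].
    by rewrite e2 -e1 eqxx in hw.
  rewrite -big_mkcond/=.
  rewrite (eq_bigr (fun w => (m w / law fgh (f w', g w'', h w')) * (m w' * m w'' / law h (h w')))); last first.
    by move=> w /andP[/eqP[e1 e2] /eqP[e3 _]]; rewrite /fgh e1 e2 e3 invfM; ring.
  rewrite -mulr_suml -[leRHS]mul1r ler_wpM2r ?divr_ge0 ?mulr_ge0 ?law_ge0//.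
  rewrite (eq_bigl (fun w => fgh w == (f w', g w'', h w'))); first exact: class_le1.
  move=> w; rewrite /fh /gh /fgh !xpair_eqE hw ![_ == f w]eq_sym ![_ == g w]eq_sym ![h w' == _]eq_sym.
  by case: (f w == f w'); case: (g w == g w''); case: (h w == h w').
rewrite -m_mass; apply: ler_sum => w' _; rewrite -big_mkcond/=.
rewrite -mulr_suml -mulr_sumr -mulrA -[leRHS]mulr1 ler_wpM2l// -/(law h (h w')).
have [->|n0] := eqVneq (law h (h w')) 0; first by rewrite mul0r.
by rewrite divff.
Qed.

Lemma ent_le_pair (A B : eqType) (f : W -> A) (g : W -> B) :
  ent g <= ent (fun w => (f w, g w)).
Proof.
rewrite /ent lerN2; apply: ler_sum => w _.
have [->|mw] := eqVneq (m w) 0; first by rewrite !mul0r.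
rewrite ler_wpM2l// ler_ln ?posrE ?(law_gt0 _ mw) ?(law_gt0 (fun w => (f w, g w)) mw)//.
by apply: law_sub => w' /eqP[_ ->].
Qed.

(** Here the ratio compares the conditional law of [f] given [g] with the uniform law on [A]. *)
Lemma ent_pair_le (A : finType) (B : eqType) (f : W -> A) (g : W -> B) :
  (0 < #|A|)%N -> ent (fun w => (f w, g w)) <= ent g + ln #|A|%:R.
Proof.
move=> A0; have A0' : 0 < #|A|%:R :> R by rewrite ltr0n.
set fg := fun w => (f w, g w).
pose r w := law g (g w) / (law fg (fg w) * #|A|%:R).
have rp w : m w != 0 -> 0 < r w.
  by move=> mw; rewrite divr_gt0 ?mulr_gt0 ?law_gt0.
suff /(gibbs rp) : \sum_w m w * r w <= 1.
  rewrite (eq_bigr (fun w => m w * ln (law g (g w)) - m w * ln (law fg (fg w))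
     - m w * ln #|A|%:R)) => [|w _]; last first.
    have [->|mw] := eqVneq (m w) 0; first by rewrite !mul0r !subr0.
    have [a1 a2] := (law_gt0 fg mw, law_gt0 g mw).
    by rewrite ln_div ?posrE ?mulr_gt0// !lnM ?posrE// mulrBr !mulrDr opprD addrA.
  by rewrite !sumrB -mulr_suml m_mass mul1r /ent; lra.
pose F w w' := if g w' == g w then m w * m w' / (law fg (fg w) * #|A|%:R) else 0.
have -> : \sum_w m w * r w = \sum_w' \sum_w F w w'.
  rewrite exchange_big/=; apply: eq_bigr => w _.
  rewrite /r {1}/law mulr_suml mulr_sumr big_mkcond/=.
  by apply: eq_bigr => w' _; rewrite /F; case: ifP => // _; rewrite mulrA.
rewrite -m_mass; apply: ler_sum => w' _; rewrite /F -big_mkcond/=.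
rewrite (partition_big f predT)//=.
apply: (@le_trans _ _ (\sum_(a : A) m w' / #|A|%:R)); last first.
  by rewrite sumr_const -[leLHS]mulr_natr divfK// gt_eqF.
apply: ler_sum => a _.
rewrite (eq_bigr (fun w => (m w / law fg (a, g w')) * (m w' / #|A|%:R))); last first.
  move=> w /andP[/eqP gw /eqP fw]; by rewrite /fg fw gw invfM; ring.
rewrite -mulr_suml -[leRHS]mul1r ler_wpM2r ?divr_ge0// ?ler0n//.
rewrite (eq_bigl (fun w => fg w == (a, g w'))); first exact: class_le1.
by move=> w; rewrite /fg xpair_eqE andbC [g w' == _]eq_sym.
Qed.

Lemma ent_fin (A : finType) (f : W -> A) : ent f = - \sum_a law f a * ln (law f a).
Proof.
rewrite /ent (partition_big f predT)//=; congr (- _); apply: eq_bigr => a _.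
by rewrite /law mulr_suml; apply: eq_bigr => w /eqP ->.
Qed.

Lemma condEnt_ent (A B : finType) (f : W -> A) (g : W -> B) (p : A -> B -> R) :
  (forall a b, p a b = law (fun w => (f w, g w)) (a, b)) ->
  condEnt p * ln 2 = ent (fun w => (f w, g w)) - ent g.
Proof.
move=> pE; set fg := fun w => (f w, g w).
have gE b : law g b = \sum_a p a b.
  rewrite /law (partition_big f predT)//=; apply: eq_bigr => a _; rewrite pE.
  by apply: eq_bigl => w; rewrite xpair_eqE andbC.
rewrite !ent_fin opprK -(pair_bigA _ (fun a b => law fg (a, b) * ln (law fg (a, b))))/=.
rewrite (eq_bigr (fun b => \sum_a p a b * ln (law g b))) => [|b _]; last by rewrite gE mulr_suml.
rewrite [X in _ + X]exchange_big/= addrC -sumrB /condEnt mulNr mulr_suml -sumrN; apply: eq_bigr => a _.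
rewrite -sumrB mulr_suml -sumrN; apply: eq_bigr => b _; rewrite -pE.
case: eqVneq => [->|n0]; first by rewrite !mul0r subrr oppr0.
have p0 : 0 < p a b by rewrite lt_def n0 pE law_ge0.
have g0 : 0 < law g b.
  apply: lt_le_trans p0 _; rewrite pE; apply: law_sub => w /eqP[_ ->]//.
rewrite -gE /log2 ln_div ?posrE// -mulrA divfK ?gt_eqF ?ln2_gt0//; ring.
Qed.

End Entropy.

(** * Polar transforms of joint laws with boundary states *)

Section JointLaws.
Context {R : realType} {St : finType} (st : St -> R) (st_gt0 : forall b, 0 < st b).

Lemma sum_pairM (A B : finType) (f : A -> R) (g : B -> R) :
  \sum_(x : A * B) f x.1 * g x.2 = (\sum_a f a) * (\sum_b g b).
Proof. by rewrite -(pair_bigA _ (fun a b => f a * g b))/= big_distrlr. Qed.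

Lemma sum_triple (A B C : finType) (F : A -> B -> C -> R) :
  \sum_(x : A * B * C) F x.1.1 x.1.2 x.2 = \sum_b \sum_c \sum_a F a b c.
Proof.
rewrite -(pair_bigA _ (fun x c => F x.1 x.2 c))/=.
rewrite -(pair_bigA _ (fun a b => \sum_c F a b c))/= exchange_big/=.
by apply: eq_bigr => b _; rewrite exchange_big.
Qed.

(** Arguments in order: bit, observation, state before the block, state after it. *)
Definition jlaw (Q : finType) := 'F_2 -> Q -> St -> St -> R.

Definition with_states (Q : finType) (p : jlaw Q) : 'F_2 -> Q * St * St -> R :=
  fun u x => p u x.1.1 x.1.2 x.2.

Definition no_states (Q : finType) (p : jlaw Q) : 'F_2 -> Q -> R :=
  fun u q => \sum_a \sum_b p u q a b.

Definition state_mass (Q : finType) (p : jlaw Q) (a b : St) : R :=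
  \sum_q (p 0 q a b + p 1 q a b).

Definition state_tv (Q : finType) (p : jlaw Q) (a b : St) : R :=
  \sum_q `|p 0 q a b - p 1 q a b|.

Record jlaw_ok (Q : finType) (p : jlaw Q) : Prop := JlawOk {
  jlaw_ge0 : forall u q a b, 0 <= p u q a b;
  jlaw_left : forall a, \sum_b state_mass p a b = st a;
  jlaw_right : forall b, \sum_a state_mass p a b = st b }.

(** Two adjacent blocks share the middle state [b], and dividing by [st b] glues laws that are
    independent given [b]. As subtraction is addition in characteristic 2, the first bit is [t + v]
    when the bits sum to [t] and the second is [v]; [plus_law] observes that sum and decides on
    [v]. *)
Definition minus_law (Q : finType) (p : jlaw Q) : jlaw (Q * Q)%type :=
  fun t x a c => \sum_b \sum_v p (t + v) x.1 a b * p v x.2 b c / st b.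

Definition plus_law (Q : finType) (p : jlaw Q) : jlaw ('F_2 * Q * Q)%type :=
  fun v x a c => \sum_b p (x.1.1 + v) x.1.2 a b * p v x.2 b c / st b.

Definition tv_mid (Q : finType) (p : jlaw Q) : R :=
  \sum_a \sum_b \sum_c state_tv p a b * state_tv p b c / st b.

Lemma F2_11 : 1 + 1 = 0 :> 'F_2. Proof. exact/val_inj. Qed.

Lemma st_neq0 b : st b != 0. Proof. by rewrite gt_eqF. Qed.

Section Transforms.
Context {Q : finType} (p : jlaw Q) (p_ok : jlaw_ok p).
Let p_ge0 := jlaw_ge0 p_ok.

Lemma tv_with_states : tv (with_states p) = \sum_a \sum_b state_tv p a b.
Proof. exact: (sum_triple (fun q a b => `|p 0 q a b - p 1 q a b|)). Qed.

Lemma state_tv_ge0 a b : 0 <= state_tv p a b.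
Proof. exact: sumr_ge0. Qed.

Lemma state_tv_le a b : state_tv p a b <= state_mass p a b.
Proof.
apply: ler_sum => q _; have := p_ge0 0 q a b; have := p_ge0 1 q a b.
by rewrite ler_norml; lra.
Qed.

Lemma with_states_mass : \sum_x (with_states p 0 x + with_states p 1 x) = \sum_a st a.
Proof.
rewrite (sum_triple (fun q a b => p 0 q a b + p 1 q a b)).
by apply: eq_bigr => a _; rewrite -(jlaw_left p_ok).
Qed.

Lemma no_states_mass : \sum_q (no_states p 0 q + no_states p 1 q) = \sum_a st a.
Proof.
rewrite /no_states; under eq_bigr do rewrite -big_split/=.
rewrite exchange_big/=; apply: eq_bigr => a _.
under eq_bigr do rewrite -big_split/=.
by rewrite exchange_big/= -(jlaw_left p_ok).
Qed.

Lemma state_mass_minus a c :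
  state_mass (minus_law p) a c = \sum_b state_mass p a b * state_mass p b c / st b.
Proof.
rewrite /state_mass /minus_law.
transitivity (\sum_x \sum_b (p 0 x.1 a b + p 1 x.1 a b) * (p 0 x.2 b c + p 1 x.2 b c) / st b).
  apply: eq_bigr => x _; rewrite -big_split/=; apply: eq_bigr => b _.
  rewrite !sum_F2 !add0r !addr0 F2_11; ring.
rewrite exchange_big/=; apply: eq_bigr => b _; rewrite -mulr_suml; congr (_ / _).
exact: (sum_pairM (fun q => p 0 q a b + p 1 q a b) (fun q => p 0 q b c + p 1 q b c)).
Qed.

Lemma state_mass_plus a c :
  state_mass (plus_law p) a c = \sum_b state_mass p a b * state_mass p b c / st b.
Proof.
rewrite /state_mass /plus_law.
transitivity (\sum_b \sum_(x : 'F_2 * Q * Q)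
  (p (x.1.1 + 0) x.1.2 a b * p 0 x.2 b c + p (x.1.1 + 1) x.1.2 a b * p 1 x.2 b c) / st b).
  rewrite exchange_big/=; apply: eq_bigr => x _; rewrite -big_split/=; apply: eq_bigr => b _.
  by rewrite mulrDl.
apply: eq_bigr => b _; rewrite -mulr_suml; congr (_ / _).
rewrite (sum_triple (fun t q r => p (t + 0) q a b * p 0 r b c + p (t + 1) q a b * p 1 r b c)).
rewrite big_distrlr/=; apply: eq_bigr => q _; apply: eq_bigr => r _.
rewrite !sum_F2 !add0r !addr0 F2_11; ring.
Qed.

Lemma state_mass_glue_left a : \sum_c \sum_b state_mass p a b * state_mass p b c / st b = st a.
Proof.
rewrite exchange_big/= -(jlaw_left p_ok); apply: eq_bigr => b _.
by rewrite -mulr_suml -mulr_sumr (jlaw_left p_ok) mulfK// st_neq0.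
Qed.

Lemma state_mass_glue_right c : \sum_a \sum_b state_mass p a b * state_mass p b c / st b = st c.
Proof.
rewrite exchange_big/= -(jlaw_right p_ok c); apply: eq_bigr => b _.
by rewrite -mulr_suml -mulr_suml (jlaw_right p_ok) mulrC mulrA mulVf ?mul1r ?st_neq0.
Qed.

Lemma minus_ok : jlaw_ok (minus_law p).
Proof.
split.
- move=> u q a b; apply: sumr_ge0 => s _; apply: sumr_ge0 => v _.
  by rewrite divr_ge0 ?mulr_ge0// ltW.
- by move=> a; under eq_bigr do rewrite state_mass_minus; exact: state_mass_glue_left.
- by move=> c; under eq_bigr do rewrite state_mass_minus; exact: state_mass_glue_right.
Qed.

Lemma plus_ok : jlaw_ok (plus_law p).
Proof.
split.
- move=> u q a b; apply: sumr_ge0 => s _.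
  by rewrite divr_ge0 ?mulr_ge0// ltW.
- by move=> a; under eq_bigr do rewrite state_mass_plus; exact: state_mass_glue_left.
- by move=> c; under eq_bigr do rewrite state_mass_plus; exact: state_mass_glue_right.
Qed.

(** For fixed states the difference between the masses of sum 0 and sum 1 factors into the
    differences of the two halves. Forgetting [b] is the triangle inequality. *)
Lemma tv_minus_le_mid : tv (with_states (minus_law p)) <= tv_mid p.
Proof.
rewrite /tv (sum_triple (fun x a c => `|minus_law p 0 x a c - minus_law p 1 x a c|)) /tv_mid.
apply: ler_sum => a _; rewrite [leRHS]exchange_big/=; apply: ler_sum => c _.
apply: (@le_trans _ _ (\sum_(x : Q * Q) \sum_b
   `|p 0 x.1 a b - p 1 x.1 a b| * `|p 0 x.2 b c - p 1 x.2 b c| / st b)).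
  apply: ler_sum => x _; rewrite /minus_law -sumrB; apply: le_trans (ler_norm_sum _ _ _) _.
  apply: ler_sum => b _; rewrite !sum_F2 !add0r !addr0 F2_11.
  have E : p 0 x.1 a b * p 0 x.2 b c / st b + p 1 x.1 a b * p 1 x.2 b c / st b -
    (p 1 x.1 a b * p 0 x.2 b c / st b + p 0 x.1 a b * p 1 x.2 b c / st b) =
    (p 0 x.1 a b - p 1 x.1 a b) * (p 0 x.2 b c - p 1 x.2 b c) / st b by ring.
  by rewrite E !normrM [`|(st b)^-1|]ger0_norm// invr_ge0 ltW.
rewrite exchange_big/=; apply: ler_sum => b _; rewrite -mulr_suml.
by rewrite (sum_pairM (fun q => `|p 0 q a b - p 1 q a b|) (fun q => `|p 0 q b c - p 1 q b c|)).
Qed.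

(** Replace [1 / st b] by [psi] and drop the condition that the two halves agree on the middle
    state. *)
Lemma tv_mid_le_sqr psi : (forall b, (st b)^-1 <= psi) ->
  tv_mid p <= psi * tv (with_states p) ^+ 2.
Proof.
move=> hpsi; rewrite tv_with_states /tv_mid expr2 big_distrl/= mulr_sumr.
apply: ler_sum => a _; rewrite big_distrl/= mulr_sumr; apply: ler_sum => b _.
rewrite -mulr_suml -mulr_sumr mulrC ler_pM ?invr_ge0 ?mulr_ge0 ?sumr_ge0//.
- by rewrite ltW.
- by move=> c _; exact: state_tv_ge0.
rewrite ler_wpM2l ?state_tv_ge0// [leRHS](bigD1 b)//= lerDl.
by apply: sumr_ge0 => b' _; apply: sumr_ge0 => c _; exact: state_tv_ge0.
Qed.

Lemma sum_glue_left (f g : St -> St -> R) :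
  (forall b, \sum_a f a b = st b) ->
  \sum_a \sum_b \sum_c f a b * g b c / st b = \sum_b \sum_c g b c.
Proof.
move=> fst; rewrite exchange_big/=; apply: eq_bigr => b _; rewrite exchange_big/=.
by apply: eq_bigr => c _; rewrite -!mulr_suml fst mulrAC divff ?mul1r// st_neq0.
Qed.

Lemma sum_glue_right (f g : St -> St -> R) :
  (forall b, \sum_c g b c = st b) ->
  \sum_a \sum_b \sum_c f a b * g b c / st b = \sum_a \sum_b f a b.
Proof.
move=> gst; apply: eq_bigr => a _; apply: eq_bigr => b _.
by rewrite -mulr_suml -mulr_sumr gst mulfK// st_neq0.
Qed.

(** For halves of total mass 1 with biases [alpha] and [beta] this reads [max(|alpha|, |beta|) <=
    |alpha| + |beta| - |alpha| * |beta|]. Symmetry reduces it to nonnegative biases. *)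
Lemma plus_term (x0 x1 y0 y1 : R) : 0 <= x0 -> 0 <= x1 -> 0 <= y0 -> 0 <= y1 ->
  `|x0 * y0 - x1 * y1| + `|x1 * y0 - x0 * y1| <=
  (x0 + x1) * `|y0 - y1| + `|x0 - x1| * (y0 + y1) - `|x0 - x1| * `|y0 - y1|.
Proof.
move=> hx0 hx1 hy0 hy1.
wlog h : x0 x1 hx0 hx1 / x1 <= x0 => [W|].
  have [h|h] := leP x1 x0; first exact: W.
  have := W x1 x0 hx1 hx0 (ltW h).
  by rewrite [`|x1 - x0|]distrC [x1 + x0]addrC [X in X <= _ -> _]addrC.
wlog h' : y0 y1 hy0 hy1 / y1 <= y0 => [W|].
  have [h'|h'] := leP y1 y0; first exact: W.
  have := W y1 y0 hy1 hy0 (ltW h').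
  rewrite [`|y1 - y0|]distrC [y1 + y0]addrC [`|x0 * y1 - _|]distrC [`|x1 * y1 - _|]distrC.
  by rewrite [X in X <= _ -> _]addrC.
rewrite [`|x0 - x1|]ger0_norm ?subr_ge0// [`|y0 - y1|]ger0_norm ?subr_ge0//.
have h1 : x1 * y1 <= x0 * y0 by rewrite ler_pM.
rewrite [`|x0 * y0 - _|]ger0_norm ?subr_ge0//.
have := mulr_ge0 hx1 hy1.
have : 0 <= x1 * (y0 - y1) by rewrite mulr_ge0 ?subr_ge0.
have : 0 <= y1 * (x0 - x1) by rewrite mulr_ge0 ?subr_ge0.
by case: (ger0P (x1 * y0 - x0 * y1)) => _; lra.
Qed.

Lemma tv_plus_le : tv (with_states (plus_law p)) <= 2 * tv (with_states p) - tv_mid p.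
Proof.
rewrite /tv (sum_triple (fun x a c => `|plus_law p 0 x a c - plus_law p 1 x a c|)) -/(tv (with_states p)) tv_with_states.
have E1 := sum_glue_left (state_tv p) (jlaw_right p_ok).
have E2 := sum_glue_right (state_tv p) (jlaw_left p_ok).
have -> : 2 * (\sum_a \sum_b state_tv p a b) - tv_mid p =
  \sum_a \sum_b \sum_c (state_mass p a b * state_tv p b c + state_tv p a b * state_mass p b c -
     state_tv p a b * state_tv p b c) / st b.
  rewrite mulr_natl mulr2n -{1}E1 -{1}E2 -big_split/= -sumrB; apply: eq_bigr => a _.
  rewrite -big_split/= -sumrB; apply: eq_bigr => b _.
  by rewrite -big_split/= -sumrB; apply: eq_bigr => c _; ring.
apply: ler_sum => a _; rewrite [leRHS]exchange_big/=; apply: ler_sum => c _.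
apply: (@le_trans _ _ (\sum_(x : 'F_2 * Q * Q) \sum_b
   `|p (x.1.1 + 0) x.1.2 a b * p 0 x.2 b c - p (x.1.1 + 1) x.1.2 a b * p 1 x.2 b c| / st b)).
  apply: ler_sum => x _; rewrite /plus_law -sumrB; apply: le_trans (ler_norm_sum _ _ _) _.
  apply: ler_sum => b _; rewrite -mulrBl normrM [X in _ * X]ger0_norm// invr_ge0 ltW//.
rewrite exchange_big/=; apply: ler_sum => b _; rewrite -mulr_suml ler_pM2r ?invr_gt0//.
rewrite (sum_triple (fun t q r => `|p (t + 0) q a b * p 0 r b c - p (t + 1) q a b * p 1 r b c|)).
rewrite /state_mass /state_tv !big_distrlr/= -big_split/= -sumrB; apply: ler_sum => q _.
rewrite -big_split/= -sumrB; apply: ler_sum => r _.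
by rewrite sum_F2 !add0r !addr0 F2_11; apply: plus_term.
Qed.

(** The gap is a sum of nonnegative terms, each pairing distinguishability in the left half with its
    defect in the right half. *)
Lemma tv_gap_eq : tv (with_states p) - tv_mid p =
  \sum_a \sum_b \sum_c state_tv p a b * (state_mass p b c - state_tv p b c) / st b.
Proof.
rewrite tv_with_states -(sum_glue_right (state_tv p) (jlaw_left p_ok)) -sumrB.
apply: eq_bigr => a _; rewrite -sumrB; apply: eq_bigr => b _.
by rewrite -sumrB; apply: eq_bigr => c _; ring.
Qed.

Lemma tv_mid_le : tv_mid p <= tv (with_states p).
Proof.
rewrite -subr_ge0 tv_gap_eq; do 3!apply: sumr_ge0 => ? _.
by rewrite divr_ge0 ?mulr_ge0 ?state_tv_ge0 ?subr_ge0 ?state_tv_le// ltW.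
Qed.

(* If some [k(a,b)] and some [mass(b',c') - k(b',c')] are bounded below, then so
   is one of them for the intermediate pair [(b,b')], which closes a triple. *)
Lemma tv_gap_ge (c0 e : R) : 0 < c0 -> 0 < e -> \sum_b st b = 1 ->
  (forall a b, c0 <= state_mass p a b) ->
  e <= tv (with_states p) -> tv (with_states p) <= 1 - e ->
  e / (#|St| ^ 2)%:R * (c0 / 2) <= tv (with_states p) - tv_mid p.
Proof.
move=> c00 e0 st1 hc; rewrite tv_with_states => hl hu.
have st_le1 b : st b <= 1.
  by rewrite -st1 (bigD1 b)//= lerDl sumr_ge0// => *; rewrite ltW.
have St0 : (0 < #|St| ^ 2)%N.
  rewrite expn_gt0 lt0n; apply/orP; left; apply/negP => /eqP S0.
  move: st1; rewrite big1 => [/eqP|b _]; first by rewrite eq_sym oner_eq0.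
  by case: (fintype0 b S0).
have St0' : 0 < (#|St| ^ 2)%:R :> R by rewrite ltr0n.
have pig (f : St -> St -> R) : e <= \sum_a \sum_b f a b ->
    exists a b, e / (#|St| ^ 2)%:R <= f a b.
  move=> hf; apply: contrapT => /forallNP hn; move: hf; apply/negP; rewrite -ltNge.
  have [a0 _] : {a0 : St | true}.
    by apply: sigW; move: St0; rewrite expn_gt0 orbF => /card_gt0P[x _]; exists x.
  have lt a b : f a b < e / (#|St| ^ 2)%:R.
    by rewrite ltNge; apply/negP => h; apply: (hn a); exists b.
  rewrite pair_big/=; apply: (@lt_le_trans _ _ (\sum_(x : St * St) e / (#|St| ^ 2)%:R)).
    by rewrite ltr_sum//; apply/hasP; exists (a0, a0); rewrite ?mem_index_enum.
  by rewrite sumr_const card_prod mulnn -[leLHS]mulr_natr divfK// gt_eqF.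
have [a [b hab]] := pig _ hl.
have [b' [c' hbc]] : exists b c, e / (#|St| ^ 2)%:R <= state_mass p b c - state_tv p b c.
  apply: pig; under eq_bigr do rewrite sumrB (jlaw_left p_ok).
  by rewrite sumrB st1; lra.
have X0 : 0 <= e / (#|St| ^ 2)%:R by rewrite divr_ge0// ltW.
have nn x y z : 0 <= state_tv p x y * (state_mass p y z - state_tv p y z) / st y.
  by rewrite divr_ge0 ?mulr_ge0 ?state_tv_ge0 ?subr_ge0 ?state_tv_le// ltW.
have pick x y z : state_tv p x y * (state_mass p y z - state_tv p y z) <=
    tv (with_states p) - tv_mid p.
  rewrite tv_gap_eq (bigD1 x)//= (bigD1 y)//= (bigD1 z)//= -!addrA.
  apply: le_trans (_ : _ <= state_tv p x y * (state_mass p y z - state_tv p y z) / st y) _.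
    rewrite ler_peMr ?mulr_ge0 ?state_tv_ge0 ?subr_ge0 ?state_tv_le//.
    by rewrite invf_ge1.
  rewrite lerDl !addr_ge0 ?sumr_ge0// => *; rewrite ?sumr_ge0// => *; rewrite ?sumr_ge0//.
have m1 := hc b b'.
rewrite -tv_with_states.
have [h|h] := leP (c0 / 2) (state_tv p b b').
  apply: le_trans (pick b b' c'); rewrite mulrC ler_pM//; lra.
by apply: le_trans (pick a b b'); rewrite ler_pM//; lra.
Qed.

Lemma Bhat_scale (Q' : finType) (r r' : 'F_2 -> Q' -> R) psi : 0 <= psi ->
  (forall u q, 0 <= r u q) -> (forall u q, 0 <= r' u q) ->
  (forall u q, r u q <= psi * r' u q) -> Bhat r <= psi * Bhat r'.
Proof.
move=> psi0 r0 r0' h; rewrite /Bhat mulrCA ler_pM2l// mulr_sumr; apply: ler_sum => q _.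
have -> : psi = Num.sqrt (psi ^+ 2) by rewrite sqrtr_sqr ger0_norm.
rewrite -sqrtrM ?sqr_ge0// ler_wsqrtr//.
have -> : psi ^+ 2 * (r' 0 q * r' 1 q) = (psi * r' 0 q) * (psi * r' 1 q) by ring.
by rewrite ler_pM.
Qed.

Lemma no_states_ge0 u q : 0 <= no_states p u q.
Proof. by do 2!apply: sumr_ge0 => ? _. Qed.

(** Once boundary states are summed out, two adjacent blocks have at most [psi] times the law of two
    independent blocks: the right side merely admits unequal middle states. *)
Lemma glue_le psi (f g : St -> St -> R) : 
  (forall b, (st b)^-1 <= psi) -> (forall a b, 0 <= f a b) -> (forall a b, 0 <= g a b) ->
  \sum_a \sum_c \sum_b f a b * g b c / st b <= psi * ((\sum_a \sum_b f a b) * (\sum_b \sum_c g b c)).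
Proof.
move=> hpsi f0 g0; rewrite big_distrl/= mulr_sumr; apply: ler_sum => a _.
rewrite exchange_big/= big_distrl/= mulr_sumr; apply: ler_sum => b _.
rewrite -mulr_suml -mulr_sumr mulrC ler_pM ?invr_ge0 ?mulr_ge0 ?sumr_ge0//.
  by rewrite ltW.
by rewrite ler_wpM2l// [leRHS](bigD1 b)//= lerDl; do 2!apply: sumr_ge0 => ? _.
Qed.

Lemma no_states_minus_le psi t x : (forall b, (st b)^-1 <= psi) ->
  no_states (minus_law p) t x <= psi *
    \sum_v no_states p (t + v) x.1 * no_states p v x.2.
Proof.
move=> hpsi; rewrite /no_states /minus_law mulr_sumr.
under eq_bigr do under eq_bigr do rewrite exchange_big/=.
under eq_bigr do rewrite exchange_big/=.
by rewrite exchange_big/=; apply: ler_sum => v _; exact: glue_le.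
Qed.

Lemma no_states_plus_le psi v x : (forall b, (st b)^-1 <= psi) ->
  no_states (plus_law p) v x <= psi * (no_states p (x.1.1 + v) x.1.2 * no_states p v x.2).
Proof. by move=> hpsi; exact: glue_le. Qed.

(** For independent halves, with law [r], the plus transform squares the Bhattacharyya parameter
    exactly; [glue_le] costs one factor [psi]. *)
Lemma Bhat_plus_le psi : 0 <= psi -> (forall b, (st b)^-1 <= psi) ->
  Bhat (no_states (plus_law p)) <= psi * Bhat (no_states p) ^+ 2.
Proof.
move=> psi0 hpsi; have n0 := no_states_ge0.
pose r v (x : 'F_2 * Q * Q) := no_states p (x.1.1 + v) x.1.2 * no_states p v x.2.
have -> : Bhat (no_states p) ^+ 2 = Bhat r.
  rewrite /Bhat (sum_triple (fun t q q' => Num.sqrt (no_states p (t + 0) q * no_states p 0 q' *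
     (no_states p (t + 1) q * no_states p 1 q')))) expr2 mulrACA big_distrlr/= -mulrA; congr (_ * _).
  rewrite mulr_sumr; apply: eq_bigr => q _; rewrite mulr_sumr; apply: eq_bigr => q' _.
  rewrite sum_F2 !add0r !addr0 F2_11 mulr_natl mulr2n -sqrtrM ?mulr_ge0//.
  by congr (Num.sqrt _ + Num.sqrt _); ring.
apply: Bhat_scale => //.
- move=> u q; do 2!apply: sumr_ge0 => ? _; exact: (jlaw_ge0 plus_ok).
- by move=> u q; rewrite /r mulr_ge0.
- by move=> u q; apply: no_states_plus_le.
Qed.

(** After squaring, the two sides differ by the cross term [X] plus [4 * x0 * x1 * y0 * y1], both
    nonnegative. *)
Lemma sqrt_minus_term (x0 x1 y0 y1 : R) : 0 <= x0 -> 0 <= x1 -> 0 <= y0 -> 0 <= y1 ->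
  Num.sqrt ((x0 * y0 + x1 * y1) * (x1 * y0 + x0 * y1)) <=
  Num.sqrt (x0 * x1) * (y0 + y1) + (x0 + x1) * Num.sqrt (y0 * y1).
Proof.
move=> hx0 hx1 hy0 hy1.
have P0 : 0 <= Num.sqrt (x0 * x1) * (y0 + y1) + (x0 + x1) * Num.sqrt (y0 * y1).
  by rewrite addr_ge0 ?mulr_ge0 ?addr_ge0.
rewrite -(ger0_norm P0) -sqrtr_sqr ler_wsqrtr// sqrrD !exprMn !sqr_sqrtr ?mulr_ge0//.
have : 0 <= (Num.sqrt (x0 * x1) * (y0 + y1) * ((x0 + x1) * Num.sqrt (y0 * y1))) *+ 2.
  by rewrite mulrn_wge0// !mulr_ge0 ?addr_ge0.
set X := _ *+ 2 => X0.
have h1 : 0 <= x0 * x1 * (y0 * y1) by rewrite !mulr_ge0.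
rewrite -subr_ge0.
have -> : x0 * x1 * (y0 + y1) ^+ 2 + X + (x0 + x1) ^+ 2 * (y0 * y1) -
   (x0 * y0 + x1 * y1) * (x1 * y0 + x0 * y1) = X + 4 * (x0 * x1 * (y0 * y1)) by ring.
by rewrite addr_ge0// mulr_ge0.
Qed.

(** For independent halves the minus transform at most doubles the parameter, by [sqrt_minus_term]
    summed over both observations. *)
Lemma Bhat_minus_le psi : 0 <= psi -> (forall b, (st b)^-1 <= psi) -> \sum_b st b = 1 ->
  Bhat (no_states (minus_law p)) <= 2 * psi * Bhat (no_states p).
Proof.
move=> psi0 hpsi st1; have n0 := no_states_ge0.
pose r t (x : Q * Q) := \sum_v no_states p (t + v) x.1 * no_states p v x.2.
apply: (@le_trans _ _ (psi * Bhat r)).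
  apply: Bhat_scale => //.
  - move=> u q; do 2!apply: sumr_ge0 => ? _; exact: (jlaw_ge0 minus_ok).
  - by move=> u q; apply: sumr_ge0 => v _; rewrite mulr_ge0.
  - by move=> u q; apply: no_states_minus_le.
rewrite [2 * psi]mulrC -mulrA ler_wpM2l// /Bhat ler_pM2l//.
have M := no_states_mass; rewrite st1 in M.
apply: (@le_trans _ _ (\sum_x (Num.sqrt (no_states p 0 x.1 * no_states p 1 x.1) * (no_states p 0 x.2 + no_states p 1 x.2)
   + (no_states p 0 x.1 + no_states p 1 x.1) * Num.sqrt (no_states p 0 x.2 * no_states p 1 x.2)))).
  apply: ler_sum => x _; rewrite /r !sum_F2 !add0r !addr0 F2_11.
  exact: sqrt_minus_term.
rewrite big_split/=.
rewrite (sum_pairM (fun q => Num.sqrt (no_states p 0 q * no_states p 1 q)) (fun q => no_states p 0 q + no_states p 1 q)).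
rewrite (sum_pairM (fun q => no_states p 0 q + no_states p 1 q) (fun q => Num.sqrt (no_states p 0 q * no_states p 1 q))).
by rewrite M mulr1 mul1r; lra.
Qed.

End Transforms.
End JointLaws.

(** * Recursive blocks *)

Section Views.
Context {R : realType} {Yt St : finType} (st : St -> R) (st_gt0 : forall b, 0 < st b).

(** A bit and an observation as functions on one sample space. The observation type is a field
    because each transform changes it. *)
Record view (W : finType) := View {
  vobs : finType; vU : W -> 'F_2; vQ : W -> vobs }.

Definition minus_view (W : finType) (v : view W) : view (W * W)%type :=
  View (fun w => vU v w.1 + vU v w.2) (fun w => (vQ v w.1, vQ v w.2)).

Definition plus_view (W : finType) (v : view W) : view (W * W)%type :=
  View (fun w => vU v w.2) (fun w => (vU v w.1 + vU v w.2, vQ v w.1, vQ v w.2)).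

Definition vlaw (W : finType) (v : view W) (mu : W -> St -> St -> R) : @jlaw R St (vobs v) :=
  fun u q a b => law (fun w => mu w a b) (fun w => (vU v w, vQ v w)) (u, q).

Arguments vlaw {W} v mu u q a b.

Definition glue (W : finType) (mu : W -> St -> St -> R) : W * W -> St -> St -> R :=
  fun w a c => \sum_b mu w.1 a b * mu w.2 b c / st b.

Lemma F2_addr_eq (x y t : 'F_2) : (x + y == t) = (x == t + y).
Proof. by case: x => [[|[|//]] ?]; case: y => [[|[|//]] ?]; case: t => [[|[|//]] ?]. Qed.

Lemma vlaw_minus (W : finType) (v : view W) mu :
  vlaw (minus_view v) (glue mu) = minus_law st (vlaw v mu).
Proof.
apply/funext => t; apply/funext => -[q r]; apply/funext => a; apply/funext => c.
rewrite /vlaw /law /glue /minus_law /= exchange_big/=; apply: eq_bigr => b _.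
rewrite -!mulr_suml; congr (_ / _).
rewrite (partition_big (fun w => vU v w.2) predT)//=; apply: eq_bigr => u _.
rewrite big_distrlr/= pair_big; apply: eq_bigl => -[w1 w2] /=.
rewrite !xpair_eqE -F2_addr_eq; case: (eqVneq (vU v w2) u) => [->|_]; last by rewrite !andbF.
by rewrite andbT /= andbA.
Qed.

Lemma vlaw_plus (W : finType) (v : view W) mu :
  vlaw (plus_view v) (glue mu) = plus_law st (vlaw v mu).
Proof.
apply/funext => u; apply/funext => -[[t q] r]; apply/funext => a; apply/funext => c.
rewrite /vlaw /law /glue /plus_law /= exchange_big/=; apply: eq_bigr => b _.
rewrite -!mulr_suml; congr (_ / _).
rewrite big_distrlr/= pair_big; apply: eq_bigl => -[w1 w2] /=.
rewrite !xpair_eqE -F2_addr_eq; case: (eqVneq (vU v w2) u) => [->|_]; last by rewrite !andbF.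
by case: (_ == t); case: (_ == q).
Qed.

(** Blocks are binary trees of letters, so that one transform step is structural recursion on two
    halves; [rows_bij] returns to row vectors. *)
Fixpoint blk (n : nat) : finType :=
  if n is n'.+1 then (blk n' * blk n')%type else ('F_2 * Yt)%type.

(* The observation of [U_i] is kept in the type produced by the recursion of the
   transform; [vQ_eq] shows that it carries the same information as the outputs
   together with the prefix [U_0, .., U_(i-1)]. *)
Fixpoint vw (n i : nat) : view (blk n) :=
  if n is n'.+1 return view (blk n)
  then if odd i then plus_view (vw n' i./2) else minus_view (vw n' i./2)
  else View fst snd.

(** The polar transform unrolled at its last step: coordinates [2k] and [2k + 1] come from
    coordinate [k] of both halves. [xrow_GN] identifies it with multiplication by [GN]. *)
Fixpoint inputs (n : nat) : blk n -> nat -> 'F_2 :=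
  if n is n'.+1 return blk n -> nat -> 'F_2
  then fun w k => if odd k then inputs w.2 k./2 else inputs w.1 k./2 + inputs w.2 k./2
  else fun w _ => w.1.

Fixpoint outT (n : nat) : finType :=
  if n is n'.+1 then (outT n' * outT n')%type else Yt.

Fixpoint outputs (n : nat) : blk n -> outT n :=
  if n is n'.+1 return blk n -> outT n
  then fun w => (outputs w.1, outputs w.2)
  else fun w => w.2.

Lemma vU_inputs n i w : vU (vw n i) w = inputs w i.
Proof.
elim: n i w => [//|n IH] i w /=.
by case: ifP => _ /=; rewrite !IH.
Qed.

(** Since [(u, v) -> (u + v, v)] is invertible, agreeing on the first [2j] inputs of a block is
    agreeing on the first [j] inputs of each half ([key] and [yek]). For odd [i] the remaining input
    [i - 1] is the sum that [plus_view] observes. *)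
Lemma vQ_eq n i w w' : (i < 2 ^ n)%N ->
  vQ (vw n i) w = vQ (vw n i) w' <->
  outputs w = outputs w' /\ (forall k, (k < i)%N -> inputs w k = inputs w' k).
Proof.
elim: n i w w' => [|n IH] i w w' /=.
  by rewrite expn0 ltnS leqn0 => /eqP ->; split => [->//|[]].
rewrite expnS mul2n => iN.
have i2 : (i./2 < 2 ^ n)%N by rewrite ltn_half_double.
have iE := odd_double_half i.
have key (j : nat) : (forall k, (k < j)%N -> inputs w.1 k = inputs w'.1 k) ->
   (forall k, (k < j)%N -> inputs w.2 k = inputs w'.2 k) ->
   forall k, (k < j.*2)%N -> (if odd k then inputs w.2 k./2 else inputs w.1 k./2 + inputs w.2 k./2) =
     (if odd k then inputs w'.2 k./2 else inputs w'.1 k./2 + inputs w'.2 k./2).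
  by move=> h1 h2 k kj; rewrite -ltn_half_double in kj; case: ifP => _; rewrite ?h1 ?h2.
have yek (j : nat) : (forall k, (k < j.*2)%N -> (if odd k then inputs w.2 k./2 else inputs w.1 k./2 + inputs w.2 k./2) =
     (if odd k then inputs w'.2 k./2 else inputs w'.1 k./2 + inputs w'.2 k./2)) ->
   (forall k, (k < j)%N -> inputs w.1 k = inputs w'.1 k) /\
   (forall k, (k < j)%N -> inputs w.2 k = inputs w'.2 k).
  move=> h; have h2 k : (k < j)%N -> inputs w.2 k = inputs w'.2 k.
    move=> kj; have /= := h k.*2.+1; rewrite odd_double/= uphalf_double; apply.
    by rewrite -doubleS leq_double.
  split => // k kj; have := h k.*2; rewrite odd_double doubleK (h2 k kj) ltn_double => /(_ kj).
  exact: addIr.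
case: ifP => oi /=; rewrite oi ?add0n ?add1n in iE.
  split.
    move=> /pair_equal_spec[/pair_equal_spec[e /(IH _ _ _ i2)[y1 h1]] /(IH _ _ _ i2)[y2 h2]].
    split; first by rewrite y1 y2.
    move=> k; rewrite -iE ltnS leq_eqVlt => /orP[/eqP ->|]; last exact: key.
    by rewrite odd_double doubleK -!vU_inputs e.
  move=> [[y1 y2] h]; have [h1 h2] : (forall k, (k < i./2)%N -> inputs w.1 k = inputs w'.1 k) /\
   (forall k, (k < i./2)%N -> inputs w.2 k = inputs w'.2 k).
    by apply: yek => k kj; apply: h; rewrite -iE ltnW.
  have -> : vQ (vw n i./2) w.1 = vQ (vw n i./2) w'.1 by apply/IH.
  have -> : vQ (vw n i./2) w.2 = vQ (vw n i./2) w'.2 by apply/IH.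
  have := h i./2.*2; rewrite odd_double doubleK -{2}iE ltnSn !vU_inputs => /(_ isT) ->.
  by [].
split.
  move=> [/(IH _ _ _ i2)[y1 h1] /(IH _ _ _ i2)[y2 h2]]; split; first by rewrite y1 y2.
  by move=> k; rewrite -iE; exact: key.
move=> [[y1 y2] h]; have [h1 h2] : (forall k, (k < i./2)%N -> inputs w.1 k = inputs w'.1 k) /\
 (forall k, (k < i./2)%N -> inputs w.2 k = inputs w'.2 k).
  by apply: yek => k kj; apply: h; rewrite -iE.
have -> : vQ (vw n i./2) w.1 = vQ (vw n i./2) w'.1 by apply/IH.
by have -> : vQ (vw n i./2) w.2 = vQ (vw n i./2) w'.2 by apply/IH.
Qed.

Lemma inputs_outputs_inj n (w w' : blk n) : outputs w = outputs w' ->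
  (forall k, (k < 2 ^ n)%N -> inputs w k = inputs w' k) -> w = w'.
Proof.
elim: n w w' => [|n IH] [w1 w2] [w1' w2'] /=.
  by move=> -> /(_ 0 isT) ->.
move=> [y1 y2] h.
have h2 k : (k < 2 ^ n)%N -> inputs w2 k = inputs w2' k.
  move=> kj; have /= := h k.*2.+1; rewrite odd_double/= uphalf_double; apply.
  by rewrite expnS mul2n -doubleS leq_double.
congr (_, _); apply: IH => // k kj.
have := h k.*2; rewrite odd_double doubleK (h2 k kj) expnS mul2n ltn_double => /(_ kj).
exact: addIr.
Qed.

Context (mu0 : 'F_2 * Yt -> St -> St -> R).

Fixpoint mu (n : nat) : blk n -> St -> St -> R :=
  if n is n'.+1 return blk n -> St -> St -> R then glue (@mu n') else mu0.

Definition jl (n i : nat) : @jlaw R St (vobs (vw n i)) := vlaw (vw n i) (@mu n).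

Arguments jl n i : clear implicits.

(** The suffix [hat] marks parameters whose observation includes the boundary states, [par] those
    without them. *)
Definition Khat n i : R := tv (with_states (jl n i)).
Definition Hhat n i : R := condEnt (with_states (jl n i)).
Definition Zpar n i : R := Bhat (no_states (jl n i)).
Definition Hpar n i : R := condEnt (no_states (jl n i)).

Context (mu0_ok : jlaw_ok st (fun u y => mu0 (u, y))).

Lemma vw_double n i : vw n.+1 i.*2 = minus_view (vw n i).
Proof. by rewrite /= odd_double doubleK. Qed.

Lemma vw_doubleS n i : vw n.+1 i.*2.+1 = plus_view (vw n i).
Proof. by rewrite /= odd_double/= uphalf_double. Qed.

Lemma jl_ok n i : jlaw_ok st (jl n i).
Proof.
rewrite /jl; elim: n i => [|n IH] i.
  suff -> : vlaw (vw 0 i) (@mu 0) = fun u y => mu0 (u, y) by [].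
  apply/funext => u; apply/funext => y; apply/funext => a; apply/funext => b.
  by rewrite /vlaw /law /=; rewrite (big_pred1 (u, y))// => -[u' y'].
rewrite -[i]odd_double_half; case: (odd i); rewrite ?add1n ?add0n.
  by rewrite vw_doubleS vlaw_plus; exact: plus_ok.
by rewrite vw_double vlaw_minus; exact: minus_ok.
Qed.

Definition state_pair n a b : R := \sum_(w : blk n) mu w a b.

Lemma state_mass_jl n i a b : state_mass (jl n i) a b = state_pair n a b.
Proof.
transitivity (\sum_x law (fun w => mu w a b) (fun w => (vU (vw n i) w, vQ (vw n i) w)) x).
  rewrite /state_mass; under eq_bigr do rewrite -(sum_F2 (fun u => jl n i u _ a b)).
  by rewrite exchange_big/= pair_bigA/=; apply: eq_bigr => -[u q].
by rewrite /state_pair (partition_big (fun w => (vU (vw n i) w, vQ (vw n i) w)) predT).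
Qed.

Lemma state_pairS n a c :
  state_pair n.+1 a c = \sum_b state_pair n a b * state_pair n b c / st b.
Proof.
rewrite -(state_mass_jl n.+1 0.*2) /jl vw_double vlaw_minus state_mass_minus -/(jl n 0).
by under eq_bigr do rewrite !state_mass_jl.
Qed.

Lemma mu_ge0 n (w : blk n) a b : 0 <= mu w a b.
Proof.
elim: n w a b => [|n IH] w a b; first by case: w => u y; exact: (jlaw_ge0 mu0_ok).
by apply: sumr_ge0 => s _; rewrite divr_ge0 ?mulr_ge0// ltW.
Qed.

Context (st1 : \sum_b st b = 1).

Lemma with_states_ge0 n i u x : 0 <= with_states (jl n i) u x.
Proof. exact: (jlaw_ge0 (jl_ok n i)). Qed.

Lemma with_states_jl_mass n i :
  \sum_x (with_states (jl n i) 0 x + with_states (jl n i) 1 x) = 1.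
Proof. by rewrite (with_states_mass (jl_ok n i)). Qed.

Lemma no_states_jl_mass n i :
  \sum_q (no_states (jl n i) 0 q + no_states (jl n i) 1 q) = 1.
Proof. by rewrite (no_states_mass (jl_ok n i)). Qed.

(** One weight on blocks together with both boundary states, so that entropies with and without
    states live on the same sample space. *)
Definition block_mass n (o : blk n * (St * St)) : R := mu o.1 o.2.1 o.2.2.

Lemma block_mass_ge0 n (o : blk n * (St * St)) : 0 <= block_mass o.
Proof. exact: mu_ge0. Qed.

Lemma block_mass_mass n : \sum_(o : blk n * (St * St)) block_mass o = 1.
Proof.
rewrite -(pair_bigA _ (fun w s => block_mass (w, s)))/= exchange_big/=.
rewrite -(pair_bigA _ (fun a b => \sum_w @block_mass n (w, (a, b))))/= -st1.
apply: eq_bigr => a _; rewrite -(jlaw_left (jl_ok n 0)); apply: eq_bigr => b _.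
by rewrite state_mass_jl.
Qed.

Lemma with_states_law n i u x : with_states (jl n i) u x =
  law (@block_mass n) (fun o => (vU (vw n i) o.1, (vQ (vw n i) o.1, o.2.1, o.2.2))) (u, x).
Proof.
case: x => [[q a] b]; rewrite /with_states /jl /vlaw /law /= [LHS]big_mkcond [RHS]big_mkcond/=.
rewrite -(pair_bigA _ (fun w s => if (vU (vw n i) w, (vQ (vw n i) w, s.1, s.2)) == (u, (q, a, b))
   then @block_mass n (w, s) else 0))/=; apply: eq_bigr => w _.
rewrite (bigD1 (a, b))//= big1 ?addr0 => [|[a' b'] /negbTE].
  by rewrite !xpair_eqE !eqxx !andbT.
by rewrite !xpair_eqE -!andbA => ->; rewrite !andbF.
Qed.

Lemma no_states_law n i u q : no_states (jl n i) u q =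
  law (@block_mass n) (fun o => (vU (vw n i) o.1, vQ (vw n i) o.1)) (u, q).
Proof.
rewrite /no_states /jl /vlaw /law [RHS]big_mkcond/=.
rewrite -(pair_bigA _ (fun w s => if (vU (vw n i) w, vQ (vw n i) w) == (u, q)
   then @block_mass n (w, s) else 0))/= pair_bigA/= exchange_big/= [LHS]big_mkcond/=.
by apply: eq_bigr => w _; case: ifP => // _; rewrite big1.
Qed.

Definition prefix_ent n i : R :=
  ent (@block_mass n) (fun o => (outputs o.1, mkseq (inputs o.1) i)).

Definition prefix_state_ent n i : R :=
  ent (@block_mass n) (fun o => (o.2, (outputs o.1, mkseq (inputs o.1) i))).

Lemma mkseq_eq (T : eqType) (f g : nat -> T) i :
  (mkseq f i == mkseq g i) = all (fun k => f k == g k) (iota 0 i).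
Proof.
apply/eqP/allP => [h k|h].
  by rewrite mem_iota add0n => /andP[_ ki]; have := congr1 (nth (f 0) ^~ k) h; rewrite !nth_mkseq// => ->.
by apply/eq_in_map => k /h/eqP.
Qed.

Lemma vQ_kernel n i w w' : (i < 2 ^ n)%N -> (vQ (vw n i) w == vQ (vw n i) w') =
  ((outputs w, mkseq (inputs w) i) == (outputs w', mkseq (inputs w') i)).
Proof.
move=> iN; rewrite xpair_eqE mkseq_eq; apply/eqP/andP.
  move/(vQ_eq _ _ iN) => [-> h]; split=> //; apply/allP => k; rewrite mem_iota add0n => /andP[_ ki].
  by rewrite h.
move=> [/eqP y /allP h]; apply/(vQ_eq _ _ iN); split=> // k ki; apply/eqP/h.
by rewrite mem_iota.
Qed.

Lemma vUQ_kernel n i w w' : (i < 2 ^ n)%N ->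
  ((vU (vw n i) w, vQ (vw n i) w) == (vU (vw n i) w', vQ (vw n i) w')) =
  ((outputs w, mkseq (inputs w) i.+1) == (outputs w', mkseq (inputs w') i.+1)).
Proof.
move=> iN; rewrite xpair_eqE vQ_kernel// !xpair_eqE !mkseq_eq.
have -> : iota 0 i.+1 = iota 0 i ++ [:: i] by rewrite -addn1 iotaD.
rewrite all_cat/=.
by rewrite andbT !vU_inputs andbC -andbA.
Qed.

Lemma Hpar_ent n i : (i < 2 ^ n)%N -> Hpar n i * ln 2 = prefix_ent n i.+1 - prefix_ent n i.
Proof.
move=> iN; rewrite /Hpar.
rewrite (condEnt_ent (@block_mass_ge0 n) (fun u q => no_states_law u q)).
congr (_ - _); apply: ent_kernel => o o'; first exact: vUQ_kernel.
exact: vQ_kernel.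
Qed.

Lemma Hhat_ent n i : (i < 2 ^ n)%N ->
  Hhat n i * ln 2 = prefix_state_ent n i.+1 - prefix_state_ent n i.
Proof.
move=> iN; rewrite /Hhat.
rewrite (condEnt_ent (@block_mass_ge0 n) (fun u q => with_states_law u q)).
congr (_ - _); apply: ent_kernel => -[w [a b]] [w' [a' b']] /=.
  have /= := @vUQ_kernel n i w w' iN; rewrite !xpair_eqE.
  by do 2!case: eqP; do 4!case: eqP.
have /= := @vQ_kernel n i w w' iN; rewrite !xpair_eqE.
by case: eqP; do 4!case: eqP.
Qed.

(** [ent_submod] with [f] the input, [g] the pair of states and [h] the observation; the rest
    re-encodes tuples. *)
Lemma Hhat_le n i : (i < 2 ^ n)%N -> Hhat n i <= Hpar n i.
Proof.
move=> iN; rewrite -(ler_pM2r (@ln2_gt0 R)) /Hpar /Hhat.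
rewrite (condEnt_ent (@block_mass_ge0 n) (fun u q => with_states_law u q)).
rewrite (condEnt_ent (@block_mass_ge0 n) (fun u q => no_states_law u q)).
have := @ent_submod _ _ (@block_mass n) (@block_mass_ge0 n) (block_mass_mass n) _ _ _
  (fun o => vU (vw n i) o.1) (fun o => o.2) (fun o => vQ (vw n i) o.1).
set e1 := ent _ _; set e2 := ent _ _; set e3 := ent _ _; set e4 := ent _ _.
suff [-> ->] :
  e1 = ent (@block_mass n) (fun o => (vU (vw n i) o.1, (vQ (vw n i) o.1, o.2.1, o.2.2))) /\
  e4 = ent (@block_mass n) (fun o => (vQ (vw n i) o.1, o.2.1, o.2.2)) by lra.
split; apply: ent_kernel => -[w [a b]] [w' [a' b']] /=; rewrite !xpair_eqE.
  by do 4!case: eqP.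
by do 3!case: eqP.
Qed.

Lemma sum_Hpar n : \sum_(0 <= i < 2 ^ n) Hpar n i * ln 2 =
  ent (@block_mass n) fst - ent (@block_mass n) (fun o => outputs o.1).
Proof.
rewrite (eq_big_nat _ _ (F2 := fun i => prefix_ent n i.+1 - prefix_ent n i)); last first.
  by move=> i /andP[_ iN]; exact: Hpar_ent.
rewrite telescope_sumr//; congr (_ - _); apply: ent_kernel => o o'; last first.
  by rewrite xpair_eqE eqxx andbT.
apply/eqP/eqP => [[y /eqP]|->//]; rewrite mkseq_eq => /allP h.
apply: inputs_outputs_inj => // k ki; apply/eqP/h; by rewrite mem_iota.
Qed.

Lemma card_St_gt0 : (0 < #|St|)%N.
Proof.
rewrite lt0n; apply/negP => /eqP S0; move: st1; rewrite big1 => [/eqP|b _].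
  by rewrite eq_sym oner_eq0.
by case: (fintype0 b S0).
Qed.

(** By the chain rule the sum telescopes to the entropy that the states add to the outputs alone,
    minus what they add to outputs and all inputs. The first is at most the logarithm of the number
    of state pairs, the second is nonnegative. *)
Lemma sum_Hpar_Hhat n :
  \sum_(0 <= i < 2 ^ n) (Hpar n i - Hhat n i) * ln 2 <= ln #|{: St * St}|%:R.
Proof.
rewrite (eq_big_nat _ _ (F2 := fun i => (prefix_ent n i.+1 - prefix_state_ent n i.+1) -
   (prefix_ent n i - prefix_state_ent n i))); last first.
  by move=> i /andP[_ iN]; rewrite mulrBl Hpar_ent// Hhat_ent//; ring.
rewrite (telescope_sumr (fun i => prefix_ent n i - prefix_state_ent n i))//.
have S0 : (0 < #|{: St * St}|)%N by rewrite card_prod muln_gt0 card_St_gt0.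
have := @ent_pair_le _ _ (@block_mass n) (@block_mass_ge0 n) (block_mass_mass n) _ _ snd
  (fun o => (outputs o.1, mkseq (inputs o.1) 0)) S0.
have := @ent_le_pair _ _ (@block_mass n) (@block_mass_ge0 n) _ _ snd
  (fun o => (outputs o.1, mkseq (inputs o.1) (2 ^ n))).
rewrite /prefix_ent /prefix_state_ent; lra.
Qed.

Lemma Khat_doubleS n i : Khat n.+1 i.*2.+1 <= 2 * Khat n i - tv_mid st (jl n i).
Proof.
rewrite /Khat {1}/jl vw_doubleS vlaw_plus; exact: (tv_plus_le st_gt0 (jl_ok n i)).
Qed.

Lemma Khat_double n i : Khat n.+1 i.*2 <= tv_mid st (jl n i).
Proof.
by rewrite /Khat {1}/jl vw_double vlaw_minus; exact: (tv_minus_le_mid st_gt0 (jl n i)).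
Qed.

Lemma Zpar_doubleS psi n i : 0 <= psi -> (forall b, (st b)^-1 <= psi) ->
  Zpar n.+1 i.*2.+1 <= psi * Zpar n i ^+ 2.
Proof.
by move=> p0 hp; rewrite /Zpar {1}/jl vw_doubleS vlaw_plus; exact: (Bhat_plus_le st_gt0 (jl_ok n i)).
Qed.

Lemma Zpar_double psi n i : 0 <= psi -> (forall b, (st b)^-1 <= psi) ->
  Zpar n.+1 i.*2 <= 2 * psi * Zpar n i.
Proof.
by move=> p0 hp; rewrite /Zpar {1}/jl vw_double vlaw_minus; exact: (Bhat_minus_le st_gt0 (jl_ok n i)).
Qed.

(** Forgetting the states lowers the total variation distance, by the triangle inequality; so a
    bound on the hatted parameter controls the Bhattacharyya parameter without states. *)
Lemma Zpar_ge n i : 1 - Khat n i <= Zpar n i.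
Proof.
apply: le_trans (Bhat_ge_tv (no_states_ge0 (jl_ok n i)) (no_states_jl_mass n i)).
rewrite lerB// /Khat tv_with_states /tv /no_states.
apply: (@le_trans _ _ (\sum_q \sum_a \sum_b `|jl n i 0 q a b - jl n i 1 q a b|)).
  apply: ler_sum => q _; rewrite -sumrB; apply: le_trans (ler_norm_sum _ _ _) _.
  by apply: ler_sum => a _; rewrite -sumrB; exact: ler_norm_sum.
rewrite exchange_big/=; apply: ler_sum => a _; rewrite exchange_big/=.
by apply: ler_sum => b _.
Qed.

End Views.

Arguments jl {R Yt St} st mu0 n i u q a b.
Arguments vlaw {R St W} v mu u q a b.

(** * The matrix [GN] *)

Section BlockRows.
Context {Yt : finType}.

Local Notation blk := (@blk Yt).

Fixpoint letters (n : nat) : blk n -> nat -> 'F_2 * Yt :=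
  if n is n'.+1 return blk n -> nat -> 'F_2 * Yt
  then fun w k => if (k < 2 ^ n')%N then letters w.1 k else letters w.2 (k - 2 ^ n')
  else fun w _ => w.

Lemma letters_lo n (w : blk n.+1) k : (k < 2 ^ n)%N -> letters w k = letters w.1 k.
Proof. by move=> /= ->. Qed.

Lemma letters_hi n (w : blk n.+1) k : letters w (2 ^ n + k) = letters w.2 k.
Proof. by rewrite /= ifF ?addKn//; lia. Qed.

Definition xrow n (w : blk n) : 'rV['F_2]_(2 ^ n) := \row_k (letters w k).1.
Definition yrow n (w : blk n) : 'rV[Yt]_(2 ^ n) := \row_k (letters w k).2.

Lemma letters_inj n (w w' : blk n) :
  (forall k, (k < 2 ^ n)%N -> letters w k = letters w' k) -> w = w'.
Proof.
elim: n w w' => [|n IH] w w' h; first exact: (h 0).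
rewrite [w]surjective_pairing [w']surjective_pairing; congr (_, _); apply: IH => k kn.
  by have := h k; rewrite !letters_lo//; apply; rewrite expnS; lia.
by have := h (2 ^ n + k)%N; rewrite !letters_hi; apply; rewrite expnS; lia.
Qed.

Lemma outputs_eq n (w w' : blk n) : outputs w = outputs w' <->
  (forall k, (k < 2 ^ n)%N -> (letters w k).2 = (letters w' k).2).
Proof.
elim: n w w' => [|n IH] w w'.
  by split=> [/= -> //|/(_ 0)]; apply.
split.
  move=> [/IH h1 /IH h2] k kn /=; case: ifP => kl; first exact: h1.
  by apply: h2; move: kn; rewrite expnS; lia.
move=> h; congr (_, _); apply/IH => k kn.
  by have := h k; rewrite !letters_lo//; apply; rewrite expnS; lia.
by have := h (2 ^ n + k)%N; rewrite !letters_hi; apply; rewrite expnS; lia.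
Qed.

Lemma yrow_outputs n (w w' : blk n) : (yrow w == yrow w') = (outputs w == outputs w').
Proof.
apply/eqP/eqP => [h|/outputs_eq h]; last by apply/rowP => k; rewrite !mxE h.
by apply/outputs_eq => k kn; have := congr1 (fun r : 'rV_(2 ^ n) => r 0 (Ordinal kn)) h; rewrite !mxE.
Qed.

Lemma rows_inj n : injective (fun w : blk n => (xrow w, yrow w)).
Proof.
move=> w w' [hx hy]; apply: letters_inj => k kn.
rewrite [letters w k]surjective_pairing [RHS]surjective_pairing; congr (_, _).
  by have := congr1 (fun r : 'rV_(2 ^ n) => r 0 (Ordinal kn)) hx; rewrite !mxE.
by have := congr1 (fun r : 'rV_(2 ^ n) => r 0 (Ordinal kn)) hy; rewrite !mxE.
Qed.

Lemma card_blk n : #|blk n| = ((2 * #|Yt|) ^ (2 ^ n))%N.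
Proof.
elim: n => [|n IH] /=; first by rewrite expn0 expn1 card_prod card_ord.
by rewrite card_prod IH -expnD addnn -mul2n -expnS.
Qed.

Lemma rows_bij n : bijective (fun w : blk n => (xrow w, yrow w)).
Proof.
apply: inj_card_bij; first exact: rows_inj.
by rewrite card_blk card_prod !card_mx card_ord !mul1n expnMn.
Qed.

(** The top bit of the index, which selects the half block, becomes the lowest bit after
    reversal. *)
Lemma bitrevS n a i : (a < 2)%N -> (i < 2 ^ n)%N ->
  bitrev n.+1 (a * 2 ^ n + i) = ((bitrev n i).*2 + a)%N.
Proof.
move=> a2 iN; rewrite /bitrev big_ord_recr/=.
rewrite divnMDl ?expn_gt0// divn_small// addn0 subnn muln1.
have -> : nat_of_bool (odd a) = a by case: a a2 => [|[|]].
congr (_ + _)%N; rewrite -mul2n big_distrr/=; apply: eq_bigr => k _.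
have kn := ltn_ord k.
rewrite mulnCA -expnS subnSK// subSS; congr (_ * _)%N.
have -> : (2 ^ n = 2 ^ (n - k) * 2 ^ k)%N by rewrite -expnD subnK// ltnW.
rewrite mulnA divnMDl ?expn_gt0// oddD oddM oddX.
by rewrite subn_eq0 leqNgt kn /= andbF.
Qed.

Lemma split_index n i : (i < 2 ^ n.+1)%N ->
  exists a k, [/\ (a < 2)%N, (k < 2 ^ n)%N & i = (a * 2 ^ n + k)%N].
Proof.
move=> iN; exists (i %/ 2 ^ n)%N, (i %% 2 ^ n)%N; split.
- by rewrite ltn_divLR ?expn_gt0// -expnS.
- by rewrite ltn_mod expn_gt0.
- exact: divn_eq.
Qed.

Lemma bitrev_lt n i : (i < 2 ^ n)%N -> (bitrev n i < 2 ^ n)%N.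
Proof.
elim: n i => [|n IH] i; first by rewrite /bitrev big_ord0.
move=> /split_index[a [k [a2 kN ->]]]; rewrite bitrevS// expnS.
by have := IH k kN; lia.
Qed.

(** [kronpow_entry] peels off the highest bit, whereas [bitrevS] puts the new bit lowest;
    associativity of the Kronecker product lets the lowest bit be peeled instead. *)
Lemma kron_low A n i j a b : (i < 2 ^ n)%N -> (j < 2 ^ n)%N -> (a < 2)%N -> (b < 2)%N ->
  kronpow_entry A n.+1 (i.*2 + a) (j.*2 + b) =
  kronpow_entry A n i j * A (inord a) (inord b).
Proof.
elim: n i j => [|n IH] i j iN jN a2 b2.
  have -> : i = 0%N by lia.
  have -> : j = 0%N by lia.
  by rewrite /= !divn1 mulr1 mul1r.
have dm k c : (c < 2)%N -> ((k.*2 + c) %/ 2 ^ n.+1 = k %/ 2 ^ n)%N /\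
    ((k.*2 + c) %% 2 ^ n.+1 = (k %% 2 ^ n).*2 + c)%N.
  move=> c2; have e : (k.*2 + c = (k %/ 2 ^ n) * 2 ^ n.+1 + ((k %% 2 ^ n).*2 + c))%N.
    by rewrite {1}(divn_eq k (2 ^ n)) expnS; nia.
  have l : ((k %% 2 ^ n).*2 + c < 2 ^ n.+1)%N.
    by have := ltn_pmod k (expn_gt0 2 n); rewrite expnS; lia.
  by rewrite e divnMDl ?expn_gt0// (divn_small l) addn0 modnMDl modn_small.
rewrite [LHS]/= -/(kronpow_entry A n.+1 _ _).
have [-> ->] := dm i a a2; have [-> ->] := dm j b b2.
by rewrite IH ?ltn_mod ?expn_gt0// mulrA.
Qed.

Lemma sum_halves (V : nmodType) (F : nat -> V) n :
  \sum_(0 <= k < 2 ^ n.+1) F k =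
  \sum_(0 <= k < 2 ^ n) F k + \sum_(0 <= k < 2 ^ n) F (2 ^ n + k)%N.
Proof. by rewrite expnS mul2n -addnn big_mkord big_split_ord/= !big_mkord. Qed.

Definition polar_entry n i j : 'F_2 := kronpow_entry G2 n (bitrev n i) j.

(** The last factor is the [G2] entry: the first half ([a = 0]) enters even columns only, the second
    half enters all. This is the recursion of [inputs]. *)
Lemma polar_entryS n a k j : (a < 2)%N -> (k < 2 ^ n)%N -> (j < 2 ^ n.+1)%N ->
  polar_entry n.+1 (a * 2 ^ n + k) j =
  polar_entry n k j./2 * (if (odd j <= a)%N then 1 else 0).
Proof.
move=> a2 kN jN; rewrite /polar_entry bitrevS// -{1}(odd_double_half j) [(odd j + _)%N]addnC.
have o2 : (odd j < 2)%N by case: odd.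
rewrite kron_low ?bitrev_lt//; last by rewrite ltn_half_double -mul2n -expnS.
by rewrite /G2 mxE !inordK.
Qed.

Lemma GN_entry n (i j : 'I_(2 ^ n)) : GN n i j = polar_entry n i j.
Proof.
rewrite /GN mxE (bigD1 (Ordinal (bitrev_lt (ltn_ord i))))//= big1 => [|k kn].
  by rewrite !mxE /= eqxx mul1r addr0.
by rewrite !mxE ifF ?mul0r//; apply/negbTE; apply: contra kn => /eqP e; apply/eqP/val_inj.
Qed.

Lemma polar_inputs n (w : blk n) j : (j < 2 ^ n)%N ->
  \sum_(0 <= k < 2 ^ n) (letters w k).1 * polar_entry n k j = inputs w j.
Proof.
elim: n w j => [|n IH] w j jN.
  by rewrite expn0 big_nat1 /polar_entry /= mulr1.
have j2 : (j./2 < 2 ^ n)%N by rewrite ltn_half_double -mul2n -expnS.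
rewrite sum_halves.
rewrite (eq_big_nat _ _ (F2 := fun k => (letters w.1 k).1 * polar_entry n k j./2 *
  (if (odd j <= 0)%N then 1 else 0))); last first.
  by move=> k /andP[_ kN]; rewrite letters_lo// -mulrA; congr (_ * _); have := @polar_entryS n 0 k j isT kN jN; rewrite mul0n add0n.
rewrite [X in _ + X](eq_big_nat _ _ (F2 := fun k => (letters w.2 k).1 * polar_entry n k j./2 *
  (if (odd j <= 1)%N then 1 else 0))); last first.
  move=> k /andP[_ kN]; rewrite letters_hi -mulrA; congr (_ * _).
  by have := @polar_entryS n 1 k j isT kN jN; rewrite mul1n.
rewrite -!mulr_suml !IH//; rewrite [inputs w j]/=; case: (odd j) => /=; first by rewrite mulr0 mulr1 add0r.
by rewrite !mulr1.
Qed.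

Lemma xrow_GN n (w : blk n) (j : 'I_(2 ^ n)) : (xrow w *m GN n) 0 j = inputs w j.
Proof.
rewrite mxE -polar_inputs// big_mkord; apply: eq_bigr => k _.
by rewrite GN_entry mxE.
Qed.

End BlockRows.

(** * Independence of the Bhattacharyya parameter from the encoding of observations *)

Section Relabel.
Context {R : realType} {W : finType} (m : W -> R).

(** Each attained value is spread evenly over its preimage. The sum then runs over the sample space
    and depends on [Q] only through its level sets, as needed for [Bhat_relabel]. *)
Lemma sum_image (A : finType) (Q : W -> A) (f : A -> R) :
  (forall q, (forall w, Q w != q) -> f q = 0) ->
  \sum_q f q = \sum_w f (Q w) / #|[pred w' | Q w' == Q w]|%:R.
Proof.
move=> f0; rewrite [RHS](partition_big Q predT)//=; apply: eq_bigr => q _.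
rewrite (eq_bigr (fun=> f q / #|[pred w' | Q w' == q]|%:R)) => [|w /eqP -> //].
rewrite sumr_const.
have [h|n0] := eqVneq #|[pred w' | Q w' == q]| 0%N.
  rewrite h mulr0n; apply: f0 => w; apply/negP => hw.
  by move/card0_eq: h => /(_ w); rewrite !inE hw.
by rewrite -[RHS]mulr_natr divfK// pnatr_eq0.
Qed.

Lemma Bhat_relabel (A B : finType) (U : W -> 'F_2) (Q : W -> A) (Q' : W -> B) :
  (forall w w', (Q w == Q w') = (Q' w == Q' w')) ->
  Bhat (fun u q => law m (fun w => (U w, Q w)) (u, q)) =
  Bhat (fun u q => law m (fun w => (U w, Q' w)) (u, q)).
Proof.
move=> QQ; rewrite /Bhat; congr (_ * _).
have z (C : finType) (O : W -> C) q : (forall w, O w != q) ->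
  Num.sqrt (law m (fun w => (U w, O w)) (0, q) * law m (fun w => (U w, O w)) (1, q)) = 0.
  move=> h; rewrite {1}/law big1 ?mul0r ?sqrtr0// => w; rewrite xpair_eqE => /andP[_].
  by rewrite (negbTE (h w)).
rewrite (sum_image (z A Q)) (sum_image (z B Q')); apply: eq_bigr => w _.
have L u : law m (fun w => (U w, Q w)) (u, Q w) = law m (fun w => (U w, Q' w)) (u, Q' w).
  by apply: eq_bigl => w'; rewrite !xpair_eqE QQ.
rewrite !L; congr (_ / _%:R); apply: eq_card => w'; by rewrite !inE QQ.
Qed.

End Relabel.

(** * From the parameters of the process to the recursive ones *)

Section LinkProcess.
Context {R : realType} {d : measure_display} {T : measurableType d}
  (P : probability T R) {Yt St : finType} (X : int -> T -> 'F_2) (Y : int -> T -> Yt).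
Context (st : St -> R) (st_gt0 : forall b, 0 < st b) (mu0 : 'F_2 * Yt -> St -> St -> R)
  (mu0_ok : jlaw_ok st (fun u y => mu0 (u, y))).
Local Notation blk := (@blk Yt).
Context (n : nat) (pXY_mu : forall w : blk n, pXY P X Y (xrow w) (yrow w) =
  \sum_a \sum_b mu st mu0 w a b).

(** Both sides concern input [i] under the same weight on blocks. One observation is a pair of
    vectors and the other has the recursive type, but by [vQ_kernel] they have the same level
    sets. *)
Lemma Zi_Zpar (i : 'I_(2 ^ n)) : Zi P X Y i = Zpar st mu0 n i.
Proof.
rewrite /Zi /Zpar.
pose mW (w : blk n) := \sum_a \sum_b mu st mu0 w a b.
pose Q (w : blk n) := (\row_(k < i) inputs w k, yrow w).
have -> : pUQ P X Y (i := i) = fun u q => law mW (fun w => (inputs w i, Q w)) (u, q).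
  apply/funext => u; apply/funext => -[q1 q2]; rewrite /pUQ /law.
  transitivity (\sum_(xy : 'rV['F_2]_(2 ^ n) * 'rV[Yt]_(2 ^ n) |
     [&& (xy.1 *m GN n) 0 i == u, [forall k : 'I_i,
        (xy.1 *m GN n) 0 (widen_ord (ltnW (ltn_ord i)) k) == q1 0 k] & xy.2 == q2]) pXY P X Y xy.1 xy.2).
    rewrite [RHS]big_mkcond -(pair_bigA _ (fun x y => if [&& (x *m GN n) 0 i == u, [forall k : 'I_i,
        (x *m GN n) 0 (widen_ord (ltnW (ltn_ord i)) k) == q1 0 k] & y == q2] then pXY P X Y x y else 0))/=.
    apply: eq_bigr => x _; case: ifP => [/andP[-> ->]|h] /=.
      by rewrite -big_mkcond big_pred1_eq.
    by rewrite big1// => y _; rewrite andbA h.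
  have [g gK Kg] := @rows_bij Yt n.
  rewrite (reindex (fun w : blk n => (xrow w, yrow w)))/=; last by exists g => ? _.
  apply: eq_big => [w|w _]; last exact: pXY_mu.
  rewrite /Q !xpair_eqE xrow_GN; congr (_ && (_ && _)).
  apply/forallP/eqP => [h|<- k].
    by apply/rowP => k; rewrite mxE; have /eqP := h k; rewrite xrow_GN.
  by rewrite xrow_GN mxE.
have -> : no_states (jl st mu0 n i) = fun u q => law mW (fun w => (inputs w i, vQ (vw n i) w)) (u, q).
  apply/funext => u; apply/funext => q; rewrite /no_states /jl /vlaw /law pair_bigA/= exchange_big/=.
  apply: eq_big => [w|w _]; first by rewrite vU_inputs.
  by rewrite /mW pair_bigA.
apply: Bhat_relabel => w w'.
rewrite vQ_kernel// !xpair_eqE yrow_outputs andbC; congr (_ && _).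
rewrite mkseq_eq; apply/eqP/allP => [h k|h].
  rewrite mem_iota => /andP[_ ki]; have := congr1 (fun r : 'rV_i => r 0 (Ordinal ki)) h.
  by rewrite !mxE => ->.
by apply/rowP => k; rewrite !mxE; apply/eqP/h; rewrite mem_iota add0n ltn_ord.
Qed.

(** Both sides are the entropy of the block minus that of its outputs, the right one through the
    telescoping [sum_Hpar]. *)
Lemma condEnt_pXY : condEnt (pXY P X Y (N := 2 ^ n)) = \sum_(0 <= i < 2 ^ n) Hpar st mu0 n i.
Proof.
apply: (mulIf (lt0r_neq0 (@ln2_gt0 R))); rewrite mulr_suml (sum_Hpar st_gt0 mu0_ok).
rewrite (@condEnt_ent _ _ (block_mass st mu0 (n := n)) (block_mass_ge0 st_gt0 mu0_ok (n := n)) _ _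
  (fun o => xrow o.1) (fun o => yrow o.1)) => [|x y].
  congr (_ - _); apply: ent_kernel => o o'; last exact: yrow_outputs.
  by apply/eqP/eqP => [/rows_inj|-> //].
have [g gK Kg] := @rows_bij Yt n.
have := Kg (x, y); set w0 := g (x, y) => -[<- <-]; rewrite pXY_mu /law [RHS]big_mkcond/=.
rewrite -(pair_bigA _ (fun w s => if (xrow w, yrow w) == (xrow w0, yrow w0)
  then block_mass st mu0 (w, s) else 0))/=.
rewrite [RHS](bigD1 w0)//= eqxx [X in _ = _ + X]big1 ?addr0 => [|w wn]; first by rewrite pair_bigA.
rewrite big1// => s _; rewrite ifF//; apply/negbTE; apply: contra wn => /eqP e.
by apply/eqP/rows_inj.
Qed.

End LinkProcess.

(** * Finite-valued random variables *)

Section FinitePr.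
Context {R : realType} {d : measure_display} {T : measurableType d} (P : probability T R).

Lemma Pr_ge0 A : 0 <= Pr P A.
Proof. by rewrite /Pr fine_ge0. Qed.

Lemma PrT : Pr P [set: T] = 1.
Proof. by rewrite /Pr probability_setT. Qed.

Lemma Pr0 : Pr P set0 = 0.
Proof. by rewrite /Pr measure0. Qed.

Lemma PrE A : measurable A -> P A = (Pr P A)%:E.
Proof. by move=> mA; rewrite /Pr fineK// fin_num_measure. Qed.

Lemma PrU A B : measurable A -> measurable B -> [disjoint A & B] ->
  Pr P (A `|` B) = Pr P A + Pr P B.
Proof.
move=> mA mB AB; rewrite {1}/Pr measureU//; last exact/disj_set2P.
by rewrite fineD// fin_num_measure.
Qed.

Lemma le_Pr A B : measurable A -> measurable B -> A `<=` B -> Pr P A <= Pr P B.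
Proof.
move=> mA mB AB; rewrite -lee_fin -!PrE//.
by apply: le_measure => //; rewrite inE.
Qed.

Lemma PrU_le A B : measurable A -> measurable B -> Pr P (A `|` B) <= Pr P A + Pr P B.
Proof.
move=> mA mB; rewrite -lee_fin EFinD -!PrE//; last exact: measurableU.
exact: measureU2.
Qed.

Lemma Pr_le1 A : measurable A -> Pr P A <= 1.
Proof. by move=> mA; rewrite -PrT; apply: le_Pr. Qed.

Lemma PrC A : measurable A -> Pr P (~` A) = 1 - Pr P A.
Proof.
move=> mA; rewrite {1}/Pr probability_setC// fineB ?fin_num_measure//.
Qed.

Definition fin_meas {F : finType} (f : T -> F) := forall v, measurable [set t | f t = v].

Lemma fin_meas_pred (F : finType) (f : T -> F) (Phi : F -> Prop) :
  fin_meas f -> measurable [set t | Phi (f t)].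
Proof.
move=> mf; suff H s : measurable [set t | f t \in (s : seq F) /\ Phi (f t)].
  rewrite (_ : [set t | Phi (f t)] = [set t | f t \in enum F /\ Phi (f t)])//.
  by apply/seteqP; split => t /=; [move=> h; rewrite mem_enum|case].
elim: s => [|v s IH].
  by rewrite (_ : mkset _ = set0)//; apply/seteqP; split => t //= -[].
have [h|h] := pselect (Phi v).
  rewrite (_ : mkset _ = [set t | f t = v] `|` [set t | f t \in s /\ Phi (f t)]).
    exact: measurableU.
  apply/seteqP; split => t /=.
    by rewrite inE => -[/orP[/eqP|] ? ?]; [left|right].
  by case=> [->|[hs ?]]; rewrite inE ?eqxx// hs orbT.
rewrite (_ : mkset _ = [set t | f t \in s /\ Phi (f t)])//.
apply/seteqP; split => t /=; last by case=> hs ?; rewrite inE hs orbT.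
by rewrite inE => -[/orP[/eqP ->|] ? //].
Qed.

Lemma fin_meas_pair (F G : finType) (f : T -> F) (g : T -> G) :
  fin_meas f -> fin_meas g -> fin_meas (fun t => (f t, g t)).
Proof.
move=> mf mg [v w]; rewrite (_ : mkset _ = [set t | f t = v] `&` [set t | g t = w]).
  exact: measurableI.
by apply/seteqP; split => t /= [-> ->].
Qed.

Lemma fin_meas_ffun (I F : finType) (f : I -> T -> F) :
  (forall i, fin_meas (f i)) -> fin_meas (fun t => [ffun i => f i t]).
Proof.
move=> mf v; suff H s : measurable [set t | forall i, i \in (s : seq I) -> f i t = v i].
  rewrite (_ : mkset _ = [set t | forall i, i \in enum I -> f i t = v i])//.
  apply/seteqP; split => t /=; first by move=> <- i _; rewrite ffunE.
  by move=> h; apply/ffunP => i; rewrite ffunE h// mem_enum.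
elim: s => [|i s IH].
  by rewrite (_ : mkset _ = setT)//; apply/seteqP; split.
rewrite (_ : mkset _ = [set t | f i t = v i] `&` [set t | forall i, i \in s -> f i t = v i]).
  by apply: measurableI => //; exact: mf.
apply/seteqP; split => t /= h.
  by split=> [|j js]; apply: h; rewrite inE ?eqxx// js orbT.
by move=> j; rewrite inE => /orP[/eqP ->|]; [exact: h.1|exact: h.2].
Qed.

Lemma Pr_split_on (F : finType) (f : T -> F) (Phi : F -> Prop) A :
  fin_meas f -> measurable A ->
  Pr P [set t | Phi (f t) /\ A t] = \sum_(v | `[< Phi v >]) Pr P [set t | f t = v /\ A t].
Proof.
move=> mf mA; suff H (s : seq F) : uniq s -> Pr P [set t | f t \in s /\ Phi (f t) /\ A t] =
    \sum_(v <- s | `[< Phi v >]) Pr P [set t | f t = v /\ A t].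
  rewrite -H ?index_enum_uniq//; congr Pr; apply/seteqP; split => t /=; last by case.
  by rewrite mem_index_enum.
have mI B : measurable B -> measurable (B `&` A) by move=> mB; exact: measurableI.
elim: s => [_|v s IH /= /andP[vs us]].
  rewrite big_nil (_ : mkset _ = set0) ?Pr0//.
  by apply/seteqP; split => t //= -[].
rewrite big_cons; case: ifPn => [/asboolP h|/asboolP h].
  rewrite -IH// -PrU; last first.
  - apply/disj_set2P; apply/seteqP; split => t //= [[-> _] [vs' _]].
    by rewrite vs' in vs.
  - have := mI _ (fin_meas_pred (fun x => x \in s /\ Phi x) mf).
    by congr measurable; apply/seteqP; split => t /=; [case=> -[]|case=> ? []].
  - exact: (mI _ (mf v)).
  congr Pr; apply/seteqP; split => t /=.
    by rewrite inE => -[/orP[/eqP|] ? [? ?]]; [left|right].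
  by case=> [[-> ?]|[hs [? ?]]]; rewrite inE ?eqxx// hs orbT.
rewrite -IH//; congr Pr; apply/seteqP; split => t /=; last by case=> hs ?; rewrite inE hs orbT.
by rewrite inE => -[/orP[/eqP ->|hs] [hP hA]].
Qed.

Lemma Pr_split (F : finType) (f : T -> F) A : fin_meas f -> measurable A ->
  Pr P A = \sum_v Pr P [set t | f t = v /\ A t].
Proof.
move=> mf mA; have := Pr_split_on (fun=> True) mf mA.
rewrite (_ : [set t | True /\ A t] = A); last by apply/seteqP; split => t //= -[].
by move=> ->; apply: eq_bigl => v; exact/asboolP.
Qed.

Lemma Pr_fun (F : finType) (f : T -> F) (Phi : F -> Prop) : fin_meas f ->
  Pr P [set t | Phi (f t)] = \sum_(v | `[< Phi v >]) Pr P [set t | f t = v].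
Proof.
move=> mf; have := @Pr_split_on _ f Phi setT mf measurableT.
rewrite (_ : [set t | Phi (f t) /\ setT t] = [set t | Phi (f t)]); last first.
  by apply/seteqP; split => t //= -[].
move=> ->; apply: eq_bigr => v _; congr Pr; by apply/seteqP; split => t //= -[].
Qed.

End FinitePr.

(** * Uniform positive bounds and numerical semigroups *)

Section Bounds.
Context {R : realType}.

Lemma fin_lower_bound (I : finType) (f : I -> R) : (forall i, 0 < f i) ->
  exists2 c, 0 < c & forall i, c <= f i.
Proof.
move=> f0; have S0 : 0 <= \sum_i (f i)^-1 by apply: sumr_ge0 => i _; rewrite invr_ge0 ltW.
exists (1 + \sum_i (f i)^-1)^-1; first by rewrite invr_gt0; lra.
move=> i; rewrite invf_ple ?posrE//; last lra.
rewrite (bigD1 i)//= addrCA lerDl addr_ge0// sumr_ge0// => j _.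
by rewrite invr_ge0 ltW.
Qed.

(* Two consecutive elements exist because the least positive difference of
   elements divides all of them; then every [n >= y ^ 2] is a combination of
   [y] and [y + 1]. *)
Lemma numerical_semigroup (A : nat -> Prop) :
  (forall k l, A k -> A l -> A (k + l)%N) ->
  (forall q, (1 < q)%N -> exists k, [/\ (0 < k)%N, ~~ (q %| k)%N & A k]) ->
  exists n0, forall n, (n0 <= n)%N -> A n.
Proof.
move=> AD Aq; pose A0 k := k = 0%N \/ A k.
have A0D k l : A0 k -> A0 l -> A0 (k + l)%N.
  by move=> [->|hk] [->|hl]; rewrite ?add0n ?addn0; [left|right|right|right; exact: AD].
have A0M k l : A0 k -> A0 (l * k)%N.
  move=> hk; elim: l => [|l IH]; first by left.
  by rewrite mulSn; exact: A0D.
have [k0 [k00 _ Ak0]] := Aq 2%N isT.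
pose D g := `[< (0 < g)%N /\ exists2 y, A0 y & A0 (y + g)%N >].
have exD : exists g, D g by exists k0; apply/asboolP; split => //; exists 0%N; [left|right].
have [g /asboolP[g0 [y Ay Ayg]] gmin] := ex_minnP exD.
have gdvd k : A k -> (g %| k)%N.
  move=> Ak; apply/negP => /negP gk; have r0 : (0 < k %% g)%N by rewrite lt0n.
  have := gmin (k %% g)%N; rewrite leqNgt ltn_pmod// => /implyP; rewrite implybF => /negP; apply.
  apply/asboolP; split=> //; exists (k %/ g * (y + g))%N; first exact: A0M.
  have -> : (k %/ g * (y + g) + k %% g = k + k %/ g * y)%N by rewrite {3}(divn_eq k g); lia.
  by apply: A0D; [right|exact: A0M].
have g1 : g = 1%N.
  apply/eqP; rewrite eqn_leq g0 andbT leqNgt; apply/negP => /Aq[k [_ /negP gk Ak]].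
  exact/gk/gdvd.
rewrite g1 addn1 in Ayg.
have A1 n : (0 < n)%N -> A0 n -> A n by move=> n0 [n00|//]; rewrite n00 in n0.
exists (y * y).+1%N => n hn; apply: A1; first exact: leq_ltn_trans hn.
case: (posnP y) => y0; first by rewrite y0 in Ayg; rewrite -[n]muln1; exact: A0M.
have -> : n = ((n %/ y - n %% y) * y + (n %% y) * y.+1)%N.
  have h1 := ltn_pmod n y0; have h2 : (y <= n %/ y)%N by rewrite leq_divRL// ltnW.
  have h3 := divn_eq n y; rewrite mulnBl mulnS addnCA; move: h3 h1 h2.
  set q := (n %/ y)%N; set r := (n %% y)%N => h3 h1 h2.
  have : (r * y <= q * y)%N by rewrite leq_mul2r; lia.
  lia.
by apply: A0D; exact: A0M.
Qed.

End Bounds.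

(** * Block laws of a FAIM process *)

Section BlockLaws.
Context {R : realType} {d : measure_display} {T : measurableType d}
  (P : probability T R) {Yt St : finType}
  (X : int -> T -> 'F_2) (Y : int -> T -> Yt) (S : int -> T -> St).
Context (hFAIM : FAIM P X Y S).

Definition site (j : int) (t : T) : 'F_2 * Yt * St := (X j t, Y j t, S j t).

Lemma fin_meas_X j : fin_meas (X j).
Proof. by case: hFAIM => -[mX _] _ _ _ _; exact: mX. Qed.

Lemma fin_meas_Y j : fin_meas (Y j).
Proof. by case: hFAIM => -[_ [mY _]] _ _ _ _; exact: mY. Qed.

Lemma fin_meas_S j : fin_meas (S j).
Proof. by case: hFAIM => -[_ [_ mS]] _ _ _ _; exact: mS. Qed.

Lemma fin_meas_site j : fin_meas (site j).
Proof.
by apply: fin_meas_pair; [apply: fin_meas_pair; [exact: fin_meas_X|exact: fin_meas_Y]|exact: fin_meas_S].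
Qed.

Definition window (j : int) (m : nat) (t : T) : {ffun 'I_m -> 'F_2 * Yt * St} :=
  [ffun l : 'I_m => site (j + l%:Z) t].

Lemma fin_meas_window j m : fin_meas (window j m).
Proof. by apply: fin_meas_ffun => l; exact: fin_meas_site. Qed.

Arguments fin_meas_window : clear implicits.

(** Time runs backwards, and each letter is paired with the state preceding it, as in
    [markov_property]. *)
Definition past_window (j : int) (m : nat) (t : T) : {ffun 'I_m -> 'F_2 * Yt * St} :=
  [ffun l : 'I_m => (X (j - l.+1%:Z) t, Y (j - l.+1%:Z) t, S (j - l.+2%:Z) t)].

Lemma fin_meas_past_window j m : fin_meas (past_window j m).
Proof.
apply: fin_meas_ffun => l.
by apply: fin_meas_pair; [apply: fin_meas_pair; [exact: fin_meas_X|exact: fin_meas_Y]|exact: fin_meas_S].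
Qed.

Arguments fin_meas_past_window : clear implicits.

Lemma stationary_window m (Phi : {ffun 'I_m -> 'F_2 * Yt * St} -> Prop) j j' :
  Pr P [set t | Phi (window j m t)] = Pr P [set t | Phi (window j' m t)].
Proof.
rewrite !Pr_fun; [|exact: fin_meas_window..]; apply: eq_bigr => v _.
case: hFAIM => _ hst _ _ _; rewrite /Pr.
have -> : [set t | window j m t = v] = [set t | forall l : 'I_m,
    (X (j + l%:Z) t, Y (j + l%:Z) t, S (j + l%:Z) t) = v l].
  apply/seteqP; split => t /=; first by move=> <- l; rewrite ffunE.
  by move=> h; apply/ffunP => l; rewrite ffunE -h.
rewrite (hst _ _ (j' - j)); congr (fine (P _)); apply/seteqP; split => t /=.
  move=> h; apply/ffunP => l; rewrite ffunE -h /site.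
  by rewrite (_ : j + l%:Z + (j' - j) = j' + l%:Z)//; ring.
move=> <- l; rewrite ffunE /site.
by rewrite (_ : j + l%:Z + (j' - j) = j' + l%:Z)//; ring.
Qed.

(** The Markov property is given on atoms; both sides are bilinear in the two events, so summing
    over atoms gives arbitrary ones. *)
Lemma markov_window j m m' (Phi : {ffun 'I_m -> 'F_2 * Yt * St} -> Prop)
    (Psi : {ffun 'I_m' -> 'F_2 * Yt * St} -> Prop) s :
  Pr P [set t | Phi (window j m t) /\ Psi (past_window j m' t) /\ S (j - 1) t = s] *
    Pr P [set t | S (j - 1) t = s] =
  Pr P [set t | Phi (window j m t) /\ S (j - 1) t = s] *
    Pr P [set t | Psi (past_window j m' t) /\ S (j - 1) t = s].
Proof.
have mw := fin_meas_window j m; have mp := fin_meas_past_window j m'.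
have mC := fin_meas_S (j - 1) s.
have mPC : measurable [set t | Psi (past_window j m' t) /\ S (j - 1) t = s].
  exact: (fin_meas_pred (fun x => Psi x.1 /\ x.2 = s) (fin_meas_pair mp (fin_meas_S (j - 1)))).
rewrite (Pr_split_on P Phi mw mPC) (Pr_split_on P Phi mw mC) (Pr_split_on P Psi mp mC).
rewrite !mulr_suml; apply: eq_bigr => v _; rewrite mulr_sumr.
have -> : Pr P [set t | window j m t = v /\ Psi (past_window j m' t) /\ S (j - 1) t = s] =
   \sum_(u | `[< Psi u >]) Pr P [set t | past_window j m' t = u /\ window j m t = v /\ S (j - 1) t = s].
  rewrite -(Pr_split_on P Psi mp); last first.
    exact: (fin_meas_pred (fun x => x.1 = v /\ x.2 = s) (fin_meas_pair mw (fin_meas_S (j - 1)))).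
  by congr Pr; apply/seteqP; split => t /= [? [? ?]].
rewrite mulr_suml; apply: eq_bigr => u _.
case: hFAIM => _ _ _ hm _; have /= := hm j m m' v u s.
have E1 : [set t | forall l : 'I_m, (X (j + l%:Z) t, Y (j + l%:Z) t, S (j + l%:Z) t) = v l] =
    [set t | window j m t = v].
  apply/seteqP; split => t /=; last by move=> <- l; rewrite ffunE.
  by move=> h; apply/ffunP => l; rewrite ffunE -h.
have E2 : [set t | forall l : 'I_m', (X (j - l.+1%:Z) t, Y (j - l.+1%:Z) t, S (j - l.+2%:Z) t) = u l] =
    [set t | past_window j m' t = u].
  apply/seteqP; split => t /=; last by move=> <- l; rewrite ffunE.
  by move=> h; apply/ffunP => l; rewrite ffunE -h.
rewrite E1 E2 => h; rewrite -[RHS]h; congr (Pr _ _ * _).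
by apply/seteqP; split => t /=; [case=> ? [? ?]|case=> -[? ?] ?].
Qed.

Definition stS (b : St) : R := Pr P [set t | S 0 t = b].

Lemma Pr_S j b : Pr P [set t | S j t = b] = stS b.
Proof.
have E i : [set t | S i t = b] = [set t | (fun v : {ffun 'I_1 -> _} => (v ord0).2 = b) (window i 1 t)].
  by apply/seteqP; split => t /=; rewrite ffunE /= addr0.
by rewrite E (stationary_window (fun v : {ffun 'I_1 -> _} => (v ord0).2 = b) j 0) -E.
Qed.

Lemma sum_stS : \sum_b stS b = 1.
Proof.
rewrite -(PrT P) (Pr_split P (fin_meas_S 0) measurableT); apply: eq_bigr => b _.
by congr Pr; apply/seteqP; split => t //= -[].
Qed.

(* [A] constrains the [N] letters following time [j]; the boundary states are
   those at times [j] and [j + N]. *)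
Definition block_event (j : int) (N : nat) (A : nat -> 'F_2 * Yt -> Prop) (a b : St) : set T :=
  [set t | (forall k, (k < N)%N -> A k (X (j + k.+1%:Z) t, Y (j + k.+1%:Z) t)) /\
    S j t = a /\ S (j + N%:Z) t = b].

Definition block_pr j N A a b : R := Pr P (block_event j N A a b).

Let block_cond N (A : nat -> 'F_2 * Yt -> Prop) (a b : St) (v : {ffun 'I_N.+1 -> 'F_2 * Yt * St}) :=
  (forall k, (k < N)%N -> A k (v (inord k.+1)).1) /\ (v ord0).2 = a /\ (v ord_max).2 = b.

Lemma block_event_window j N A a b :
  block_event j N A a b = [set t | block_cond A a b (window j N.+1 t)].
Proof.
apply/seteqP; split => t /= [h [ha hb]].
  rewrite /block_cond !ffunE /= addr0; split=> // k kN.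
  by rewrite ffunE inordK//; exact: h.
move: ha hb; rewrite !ffunE /= addr0 => ha hb; split=> // k kN.
by have := h k kN; rewrite ffunE inordK.
Qed.

Lemma measurable_block_event j N A a b : measurable (block_event j N A a b).
Proof.
rewrite block_event_window.
exact: (fin_meas_pred (block_cond A a b) (fin_meas_window j N.+1)).
Qed.

Lemma block_pr_shift j j' N A a b : block_pr j N A a b = block_pr j' N A a b.
Proof.
rewrite /block_pr !block_event_window; exact: (stationary_window (block_cond A a b)).
Qed.

Lemma block_pr_irreducible a b : exists2 k, (0 < k)%N & 0 < block_pr 0 k (fun _ _ => True) a b.
Proof.
case: hFAIM => _ _ _ _ [_ hi _]; have [k [k0 h]] := hi b a; exists k => //.
apply: lt_le_trans h _; rewrite le_eqVlt; apply/orP; left; apply/eqP; congr Pr.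
by rewrite /block_event add0r; apply/seteqP; split => t /= [].
Qed.

Lemma stS_gt0 b : 0 < stS b.
Proof.
have [k _ h] := block_pr_irreducible b b; apply: lt_le_trans h _.
apply: le_Pr; [exact: measurable_block_event|exact: fin_meas_S|].
by move=> t [_ []].
Qed.

(** The Markov property at time [j + N], multiplied out by the mass of the middle state. Both
    lengths are positive because the outer states are read off the last sites of the two windows. *)
Lemma block_pr_cat j N M A a c : (0 < N)%N -> (0 < M)%N ->
  block_pr j (N + M) A a c =
  \sum_b block_pr j N A a b * block_pr j M (fun k => A (N + k)%N) b c / stS b.
Proof.
case: N => // N _; case: M => // M _.
rewrite {1}/block_pr (Pr_split P (fin_meas_S (j + N.+1%:Z)) (measurable_block_event _ _ _ _ _)).
apply: eq_bigr => b _; apply: (mulIf (lt0r_neq0 (stS_gt0 b))).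
rewrite divfK ?gt_eqF ?stS_gt0// [block_pr j M.+1 _ _ _](block_pr_shift _ (j + N.+1%:Z)).
pose jj := j + N.+1%:Z + 1.
pose Phi (v : {ffun 'I_M.+1 -> 'F_2 * Yt * St}) :=
  (forall k, (k < M.+1)%N -> A (N.+1 + k)%N (v (inord k)).1) /\ (v ord_max).2 = c.
(* The past window is reversed, so its entry [N - k] is letter [k]; its last entry carries the state
   at time [j]. *)
pose Psi (u : {ffun 'I_N.+1 -> 'F_2 * Yt * St}) :=
  (forall k, (k < N.+1)%N -> A k (u (inord (N - k))).1) /\ (u ord_max).2 = a.
have jj1 : jj - 1 = j + N.+1%:Z by rewrite /jj addrK.
have HPhi t : Phi (window jj M.+1 t) <->
    (forall k, (k < M.+1)%N -> A (N.+1 + k)%N (X (j + N.+1%:Z + k.+1%:Z) t, Y (j + N.+1%:Z + k.+1%:Z) t))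
    /\ S (j + N.+1%:Z + M.+1%:Z) t = c.
  have e k : jj + k%:Z = j + N.+1%:Z + k.+1%:Z by rewrite /jj -addn1 PoszD; ring.
  rewrite /Phi ffunE /= e; split=> -[h1 h2]; split=> // k kM; have := h1 k kM;
    by rewrite ffunE /= inordK// e.
have HPsi t : Psi (past_window jj N.+1 t) <->
    (forall k, (k < N.+1)%N -> A k (X (j + k.+1%:Z) t, Y (j + k.+1%:Z) t)) /\ S j t = a.
  have e k : (k < N.+1)%N -> jj - (N - k).+1%:Z = j + k.+1%:Z by rewrite /jj => kN; lia.
  have e' : jj - N.+2%:Z = j by rewrite /jj; lia.
  rewrite /Psi ffunE /= e'; split=> -[h1 h2]; split=> // k kM; have := h1 k kM;
    by rewrite ffunE /= inordK ?e// ltnS leq_subr.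
have := markov_window jj Phi Psi b; rewrite jj1 (Pr_S (j + N.+1%:Z)) mulrC => h.
rewrite mulrC {}[LHS](_ : _ = stS b * Pr P [set t | Phi (window jj M.+1 t) /\
   Psi (past_window jj N.+1 t) /\ S (j + N.+1%:Z) t = b]); last first.
  congr (_ * Pr _ _); apply/seteqP; split => t /=.
    move=> [hb [h1 [ha hc]]]; split; [apply/HPhi|split=> //; apply/HPsi]; split=> //.
    - move=> k kM; have := h1 (N.+1 + k)%N; rewrite ltn_add2l => /(_ kM).
      by rewrite -addnS PoszD addrA.
    - by rewrite -hc PoszD addrA.
    - by move=> k kN; apply: h1; rewrite ltn_addr.
  move=> [/HPhi[h1 hc] [/HPsi[h2 ha] hb]]; split=> //; split; last first.
    by rewrite PoszD addrA.
  move=> k kNM; have [kN|kN] := ltnP k N.+1; first exact: h2.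
  have := h1 (k - N.+1)%N; rewrite subnKC// ltn_subLR// => /(_ kNM).
  by rewrite -addrA -PoszD addnS subnKC.
rewrite h [RHS]mulrC /block_pr /block_event; congr (_ * _); congr (Pr P _); apply/seteqP; split => t /=.
- by move=> [/HPhi[? ?] ?].
- by move=> [? [? ?]]; split=> //; apply/HPhi.
- by move=> [/HPsi[? ?] ?].
- by move=> [? [? ?]]; split=> //; apply/HPsi.
Qed.

Lemma block_pr_sum_right j N a : \sum_b block_pr j N (fun _ _ => True) a b = stS a.
Proof.
rewrite -(Pr_S j a) (Pr_split P (fin_meas_S (j + N%:Z)) (fin_meas_S j a)).
apply: eq_bigr => b _; congr Pr; apply/seteqP; split => t /=; first by case=> _ [].
by case.
Qed.

Lemma block_pr_sum_left j N b : \sum_a block_pr j N (fun _ _ => True) a b = stS b.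
Proof.
rewrite -(Pr_S (j + N%:Z) b) (Pr_split P (fin_meas_S j) (fin_meas_S (j + N%:Z) b)).
apply: eq_bigr => a _; congr Pr; apply/seteqP; split => t /=; first by case=> _ [].
by case.
Qed.

Definition base_law (w : 'F_2 * Yt) (a b : St) : R := block_pr 0 1 (fun _ v => v = w) a b.

Lemma sum_base_law a b : \sum_w base_law w a b = block_pr 0 1 (fun _ _ => True) a b.
Proof.
rewrite {1}/block_pr (Pr_split P (fin_meas_pair (fin_meas_X 1) (fin_meas_Y 1)) (measurable_block_event _ _ _ _ _)).
apply: eq_bigr => w _; congr Pr; apply/seteqP; split => t /=.
  by move=> [h [? ?]]; rewrite -(h 0%N isT).
by move=> [<- [_ [? ?]]]; split=> // k; rewrite ltnS leqn0 => /eqP ->.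
Qed.

Lemma base_law_ok : jlaw_ok stS (fun u y => base_law (u, y)).
Proof.
have E a b : state_mass (fun u y => base_law (u, y)) a b = block_pr 0 1 (fun _ _ => True) a b.
  rewrite -sum_base_law (eq_bigr (fun w => base_law (w.1, w.2) a b)) => [|[u y] _ //].
  rewrite -(pair_bigA _ (fun u y => base_law (u, y) a b))/= sum_F2.
  by rewrite /state_mass big_split.
split; first by move=> *; exact: Pr_ge0.
- by move=> a; under eq_bigr do rewrite E; exact: block_pr_sum_right.
- by move=> b; under eq_bigr do rewrite E; exact: block_pr_sum_left.
Qed.

Lemma block_pr_ext j N A A' a b : (forall k v, (k < N)%N -> A k v <-> A' k v) ->
  block_pr j N A a b = block_pr j N A' a b.
Proof.
move=> h; congr Pr; apply/seteqP; split => t [h1 h2]; split=> // k kN; apply/h => //; exact: h1.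
Qed.

Lemma mu_block_pr n (w : blk n) a b :
  mu stS base_law w a b = block_pr 0 (2 ^ n) (fun k v => v = letters w k) a b.
Proof.
elim: n w a b => [|n IH] w a b.
  by apply: block_pr_ext => k v _.
rewrite expnS mul2n -addnn block_pr_cat ?expn_gt0//; rewrite -[LHS]/(\sum_s mu stS base_law w.1 a s * mu stS base_law w.2 s b / stS s).
apply: eq_bigr => s _; rewrite !IH; congr (_ * _ / _); apply: block_pr_ext => k v kn.
  by rewrite letters_lo.
by rewrite letters_hi.
Qed.

Lemma state_pair_block_pr n a b :
  state_pair stS base_law n a b = block_pr 0 (2 ^ n) (fun _ _ => True) a b.
Proof.
elim: n a b => [|n IH] a b; first by rewrite expn0 -sum_base_law.
rewrite state_pairS expnS mul2n -addnn block_pr_cat ?expn_gt0//.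
by apply: eq_bigr => s _; rewrite !IH.
Qed.

Lemma block_pr_ge0 j N A a b : 0 <= block_pr j N A a b.
Proof. exact: Pr_ge0. Qed.

Lemma block_pr_gt0_cat k l a b c : (0 < k)%N -> (0 < l)%N ->
  0 < block_pr 0 k (fun _ _ => True) a b -> 0 < block_pr 0 l (fun _ _ => True) b c ->
  0 < block_pr 0 (k + l) (fun _ _ => True) a c.
Proof.
move=> k0 l0 h1 h2; rewrite block_pr_cat// (bigD1 b)//=.
rewrite ltr_wpDr//; last by rewrite divr_gt0 ?mulr_gt0 ?stS_gt0.
by apply: sumr_ge0 => s _; rewrite divr_ge0 ?mulr_ge0 ?block_pr_ge0// ltW// stS_gt0.
Qed.

Lemma eventually_fin (I : finType) (Q : I -> nat -> Prop) :
  (forall i, exists n0, forall n, (n0 <= n)%N -> Q i n) ->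
  exists n0, forall n, (n0 <= n)%N -> forall i, Q i n.
Proof.
move=> /choice[f hf]; exists (\max_i f i) => n hn i; apply: hf.
by apply: leq_trans hn; exact: leq_bigmax.
Qed.

(** The return times to [a] are closed under addition and share no divisor above 1, so
    [numerical_semigroup] yields all large times; one fixed passage from [a] to [b] is then
    appended. *)
Lemma block_pr_primitive : exists n0, forall n, (n0 <= n)%N -> forall ab : St * St,
  0 < block_pr 0 n (fun _ _ => True) ab.1 ab.2.
Proof.
apply: eventually_fin => -[a b] /=.
have [na hna] : exists n0, forall n, (n0 <= n)%N -> (0 < n)%N /\ 0 < block_pr 0 n (fun _ _ => True) a a.
  apply: (numerical_semigroup (A := fun n => (0 < n)%N /\ 0 < block_pr 0 n (fun _ _ => True) a a)).
    move=> k l [k0 hk] [l0 hl]; split; first by rewrite addn_gt0 k0.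
    exact: block_pr_gt0_cat hk hl.
  move=> q q1; case: hFAIM => _ _ _ _ [_ _ ha]; have [k [k0 qk h]] := ha a q q1.
  exists k; split=> //; split=> //; apply: lt_le_trans h _.
  rewrite le_eqVlt; apply/orP; left; apply/eqP; congr Pr.
  by rewrite /block_event add0r; apply/seteqP; split => t /= [].
have [k k0 hk] := block_pr_irreducible a b.
exists (na + k)%N => n hn; have [n0 hn'] := hna (n - k)%N ltac:(lia).
by have := block_pr_gt0_cat n0 k0 hn' hk; rewrite subnK//; lia.
Qed.

Lemma stS_le1 b : stS b <= 1.
Proof. by apply: Pr_le1; exact: fin_meas_S. Qed.

Lemma state_pair_lower_bound : exists2 c0, 0 < c0 & exists n0, forall n, (n0 <= n)%N ->
  forall a b, c0 <= state_pair stS base_law n a b.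
Proof.
have [n0 hn0] := block_pr_primitive.
have [c c0 hc] := fin_lower_bound (hn0 n0.+1 (leqnSn _)).
have [e e0 he] := fin_lower_bound stS_gt0.
exists (e * c); first exact: mulr_gt0.
exists n0.+2 => n hn a b; rewrite state_pair_block_pr.
have n2 : (n < 2 ^ n)%N by exact: ltn_expl.
(* Only the last [n0 + 1] steps matter: from any intermediate state they reach [b] with joint mass
   at least [c], and summing over that state leaves the mass of [a], at least [e]. *)
have -> : (2 ^ n = (2 ^ n - n0.+1) + n0.+1)%N by lia.
rewrite block_pr_cat//; last lia.
apply: (@le_trans _ _ (\sum_s block_pr 0 (2 ^ n - n0.+1) (fun _ _ => True) a s * c)).
  by rewrite -mulr_suml block_pr_sum_right ler_wpM2r// ltW.
apply: ler_sum => s _; rewrite -mulrA ler_wpM2l ?block_pr_ge0//.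
apply: le_trans (hc (s, b)) _ => /=.
by rewrite ler_peMr ?block_pr_ge0// invf_ge1 ?stS_le1 ?stS_gt0.
Qed.

Definition rows (j : int) N (t : T) : 'rV['F_2]_N * 'rV[Yt]_N :=
  (\row_k X (j + k.+1%:Z) t, \row_k Y (j + k.+1%:Z) t).

Let window_rows N (v : {ffun 'I_N -> 'F_2 * Yt * St}) : 'rV['F_2]_N * 'rV[Yt]_N :=
  (\row_k (v k).1.1, \row_k (v k).1.2).

Lemma rows_window j N t : rows j N t = window_rows (window (j + 1) N t).
Proof.
rewrite /rows /window_rows; congr (_, _); apply/rowP => k; rewrite !mxE ffunE /=;
  by rewrite -addrA -PoszD add1n.
Qed.

Lemma fin_meas_rows j N : fin_meas (rows j N).
Proof.
move=> v; rewrite (_ : mkset _ = [set t | window_rows (window (j + 1) N t) = v]).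
  exact: (fin_meas_pred (fun w => window_rows w = v) (fin_meas_window (j + 1) N)).
by apply/seteqP; split => t /=; rewrite rows_window.
Qed.

Arguments fin_meas_rows : clear implicits.

Lemma pXY_rows j N x y : pXY P X Y x y = Pr P [set t | rows j N t = (x, y)].
Proof.
have -> : [set t | rows j N t = (x, y)] = [set t | (fun w => window_rows w = (x, y)) (window (j + 1) N t)].
  by apply/seteqP; split => t /=; rewrite rows_window.
rewrite (stationary_window (fun w => window_rows w = (x, y)) _ (0 + 1)) /pXY.
congr Pr; apply/seteqP; split => t /=; rewrite -rows_window /rows.
  by move=> h; congr (_, _); apply/rowP => k; rewrite !mxE add0r; have [] := h k.
by move=> [<- <-] k; rewrite !mxE add0r.
Qed.

Lemma pXY_mu n (w : blk n) : pXY P X Y (xrow w) (yrow w) =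
  \sum_a \sum_b mu stS base_law w a b.
Proof.
rewrite (pXY_rows 0) (Pr_split P (fin_meas_pair (fin_meas_S 0) (fin_meas_S (0 + (2 ^ n)%N%:Z))) (fin_meas_rows 0 _ _)).
rewrite pair_bigA/=; apply: eq_bigr => -[a b] _ /=; rewrite mu_block_pr; congr Pr.
apply/seteqP; split => t /=.
  move=> [[ha hb] [hx hy]]; split=> // k kN.
  have := congr1 (fun r : 'rV_(2 ^ n) => r 0 (Ordinal kN)) hx; rewrite !mxE /= => ->.
  have := congr1 (fun r : 'rV_(2 ^ n) => r 0 (Ordinal kN)) hy; rewrite !mxE /= => ->.
  by case: (letters w k).
move=> [h [ha hb]]; split; first by rewrite ha hb.
by congr (_, _); apply/rowP => k; rewrite !mxE -h.
Qed.

Lemma pXY_ge0 N (x : 'rV_N) (y : 'rV_N) : 0 <= pXY P X Y x y.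
Proof. exact: Pr_ge0. Qed.

Lemma pXY_mass N : \sum_(w : 'rV_N * 'rV_N) pXY P X Y w.1 w.2 = 1.
Proof.
rewrite -(PrT P) (Pr_split P (fin_meas_rows 0 N) measurableT).
apply: eq_bigr => -[x y] _; rewrite (pXY_rows 0); congr Pr.
by apply/seteqP; split => t //= -[].
Qed.

Lemma law_pXY N j (F : finType) (g : 'rV['F_2]_N * 'rV[Yt]_N -> F) v :
  law (fun w => pXY P X Y w.1 w.2) g v = Pr P [set t | g (rows j N t) = v].
Proof.
rewrite (Pr_fun P (fun w => g w = v) (fin_meas_rows j N)) /law.
apply: eq_big => [w|[x y] _]; last exact: pXY_rows.
by apply/eqP/asboolP.
Qed.

Lemma condEnt_pXY_ent N : condEnt (@pXY _ _ _ P _ X Y N) * ln 2 =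
  ent (fun w : 'rV_N * 'rV_N => pXY P X Y w.1 w.2) id - ent (fun w : 'rV_N * 'rV_N => pXY P X Y w.1 w.2) snd.
Proof.
rewrite (condEnt_ent (m := fun w : 'rV_N * 'rV_N => pXY P X Y w.1 w.2) _ (f := fst) (g := snd)).
- by congr (_ - _); apply: ent_kernel => -[x y] [x' y'].
- by move=> w; exact: pXY_ge0.
- move=> x y; rewrite (law_pXY 0) (pXY_rows 0); congr Pr.
Qed.

Lemma condEnt_pXY_ge0 N : 0 <= condEnt (@pXY _ _ _ P _ X Y N).
Proof.
rewrite -(pmulr_lge0 _ (@ln2_gt0 R)) condEnt_pXY_ent subr_ge0.
have := @ent_le_pair _ _ (fun w : 'rV_N * 'rV_N => pXY P X Y w.1 w.2) (fun w => pXY_ge0 w.1 w.2) _ _ fst snd.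
by rewrite (@ent_kernel _ _ _ _ _ (fun w => (w.1, w.2)) id) => // -[x y] [x' y'].
Qed.

Lemma condEnt_pXY_subadd N M : condEnt (@pXY _ _ _ P _ X Y (N + M)) <=
  condEnt (@pXY _ _ _ P _ X Y N) + condEnt (@pXY _ _ _ P _ X Y M).
Proof.
rewrite -(ler_pM2r (@ln2_gt0 R)) mulrDl condEnt_pXY_ent.
pose m (w : 'rV['F_2]_(N + M) * 'rV[Yt]_(N + M)) := pXY P X Y w.1 w.2.
have m0 w : 0 <= m w by exact: pXY_ge0.
rewrite -/m.
rewrite (condEnt_ent m0 (f := fun w => lsubmx w.1) (g := fun w => lsubmx w.2)) => [|x y]; last first.
  rewrite (law_pXY 0) (pXY_rows 0); congr Pr; apply/seteqP; split => t /=.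
    by move=> [<- <-]; congr (_, _); apply/rowP => k; rewrite !mxE.
  by move=> [<- <-]; congr (_, _); apply/rowP => k; rewrite !mxE.
rewrite (condEnt_ent m0 (f := fun w => rsubmx w.1) (g := fun w => rsubmx w.2)) => [|x y]; last first.
  rewrite (law_pXY 0) (pXY_rows N%:Z); congr Pr.
  have e (k : 'I_M) : 0 + (N + k).+1%:Z = N%:Z + k.+1%:Z by rewrite add0r -PoszD addnS.
  apply/seteqP; split => t /=.
    by move=> [<- <-]; congr (_, _); apply/rowP => k; rewrite !mxE /= e.
  by move=> [<- <-]; congr (_, _); apply/rowP => k; rewrite !mxE /= e.
set a := fun w : 'rV['F_2]_(N + M) * 'rV[Yt]_(N + M) => lsubmx w.1.
set b := fun w : 'rV['F_2]_(N + M) * 'rV[Yt]_(N + M) => rsubmx w.1.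
set c := fun w : 'rV['F_2]_(N + M) * 'rV[Yt]_(N + M) => lsubmx w.2.
set e := fun w : 'rV['F_2]_(N + M) * 'rV[Yt]_(N + M) => rsubmx w.2.
have subK (Q : eqType) (x x' : 'rV[Q]_(N + M)) :
    (x == x') = (lsubmx x == lsubmx x') && (rsubmx x == rsubmx x').
  apply/eqP/andP => [->|[/eqP h1 /eqP h2]]; first by rewrite !eqxx.
  by rewrite -[x]hsubmxK -[x']hsubmxK h1 h2.
have m1 : \sum_w m w = 1 by exact: pXY_mass.
(* [I1] separates the two input halves given all outputs; [I2] and [I3] then remove from each
   conditioning the outputs of the other half. *)
have I1 := ent_submod m0 m1 a b (fun w => (c w, e w)).
have I2 := ent_submod m0 m1 a e c.
have I3 := ent_submod m0 m1 b c e.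
rewrite (@ent_kernel _ _ m _ _ (id) (fun w => (a w, b w, (c w, e w)))); last first.
  by move=> [x y] [x' y']; rewrite !xpair_eqE !subK.
rewrite (@ent_kernel _ _ m _ _ (snd) (fun w => (c w, e w))); last first.
  by move=> [x y] [x' y']; rewrite !xpair_eqE subK.
move: I1 I2 I3; rewrite (@ent_kernel _ _ m _ _ (fun w => (e w, c w)) (fun w => (c w, e w))); last first.
  by move=> w w'; rewrite !xpair_eqE andbC.
rewrite (@ent_kernel _ _ m _ _ (fun w => (a w, e w, c w)) (fun w => (a w, (c w, e w)))); last first.
  by move=> w w'; rewrite !xpair_eqE -andbA [(e w == _) && _]andbC.
rewrite (@ent_kernel _ _ m _ _ (fun w => (b w, c w, e w)) (fun w => (b w, (c w, e w)))); last first.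
  by move=> w w'; rewrite !xpair_eqE -andbA.
lra.
Qed.

End BlockLaws.

(** * Fast convergence of sequences *)

Section FastSequences.
Context {R : realType}.

Definition hits (B : nat -> bool) (a n : nat) : nat := \sum_(a <= k < n) B k.

Lemma hits_cat B a b n : (a <= b <= n)%N -> hits B a n = (hits B a b + hits B b n)%N.
Proof. by move=> /andP[ab bn]; rewrite /hits (big_cat_nat (n := b)). Qed.

Lemma hits_le B a n : (hits B a n <= n - a)%N.
Proof.
rewrite /hits -[leqRHS]muln1 -sum_nat_const_nat; apply: leq_sum => k _.
by case: (B k).
Qed.

Lemma hits_recr B a s : hits B a (a + s.+1) = (hits B a (a + s) + B (a + s))%N.
Proof. by rewrite /hits addnS big_nat_recr ?leq_addr. Qed.

Local Notation p2 x := ((2 : R) `^ x).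

Lemma p2_gt0 (x : R) : 0 < p2 x.
Proof. by rewrite powR_gt0. Qed.

Lemma p2D (x y : R) : p2 (x + y) = p2 x * p2 y.
Proof. by rewrite powRD// pnatr_eq0 implybT. Qed.

Lemma p2_le (x y : R) : x <= y -> p2 x <= p2 y.
Proof. by move=> xy; apply: ler_powR => //; rewrite ler1n. Qed.

Lemma p2_lt (x y : R) : x < y -> p2 x < p2 y.
Proof.
by move=> xy; rewrite /powR pnatr_eq0/= ltr_expR ltr_pM2r// ln_gt0// ltr1n.
Qed.

Lemma p2_nat n : p2 n%:R = 2 ^+ n.
Proof. by rewrite powR_mulrn. Qed.

Section Iterate.
Context (K : nat) (A : nat -> R) (B : nat -> bool).
Context (A_ge0 : forall k, 0 <= A k)
  (A_hit : forall k, B k -> A k.+1 <= p2 K%:R * A k ^+ 2)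
  (A_miss : forall k, A k.+1 <= p2 K%:R * A k).

(** At a hit one of the two factors [A k] is bounded by [2 ^ (- L0)]; every step, hit or miss, costs
    at most [2 ^ K]. *)
Lemma iterate_small m L0 t : (forall k, (m <= k)%N -> A k <= p2 (- L0)) -> 0 <= L0 ->
  A (m + t)%N <= p2 (- ((hits B m (m + t))%:R * L0 - t%:R * K%:R)).
Proof.
move=> hA L00; elim: t => [|t IH].
  rewrite addn0 /hits big_geq// !mul0r subr0 oppr0 powRr0.
  by apply: le_trans (hA m (leqnn m)) _; rewrite -[leRHS](powRr0 2) p2_le// oppr_le0.
rewrite hits_recr addnS; case h : (B (m + t)%N) => /=.
  apply: le_trans (A_hit h) _.
  apply: (@le_trans _ _ (p2 K%:R * (p2 (- L0) * p2 (- ((hits B m (m + t))%:R * L0 - t%:R * K%:R))))).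
    by rewrite ler_pM2l ?p2_gt0// expr2 ler_pM// hA// leq_addr.
  by rewrite -!p2D p2_le// natrD -[t.+1%:R]natr1; lra.
apply: le_trans (A_miss _) _.
apply: (@le_trans _ _ (p2 K%:R * p2 (- ((hits B m (m + t))%:R * L0 - t%:R * K%:R)))).
  by rewrite ler_pM2l ?p2_gt0.
by rewrite -!p2D p2_le// addn0 -[t.+1%:R]natr1; lra.
Qed.

(** Each hit doubles the exponent. It doubles the accumulated losses as well, which is why [s * K]
    stands inside the product with the power of 2. *)
Lemma iterate_square a L s : A a <= p2 (- L) ->
  A (a + s)%N <= p2 (- (2 ^+ (hits B a (a + s)) * (L - s%:R * K%:R))).
Proof.
move=> hA; elim: s => [|s IH].
  by rewrite addn0 /hits big_geq// expr0 mul1r mul0r subr0.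
rewrite hits_recr addnS; set r := hits _ _ _ in IH *.
have r1 : 1 <= 2 ^+ r :> R by rewrite exprn_ege1// ler1n.
have K0 : 0 <= K%:R :> R by [].
have rK : K%:R <= 2 ^+ r * K%:R :> R by rewrite ler_peMl.
case h : (B (a + s)%N) => /=.
  apply: le_trans (A_hit h) _.
  apply: (@le_trans _ _ (p2 K%:R * (p2 (- (2 ^+ r * (L - s%:R * K%:R))) * p2 (- (2 ^+ r * (L - s%:R * K%:R)))))).
    by rewrite ler_pM2l ?p2_gt0// expr2 ler_pM.
  by rewrite -!p2D p2_le// addn1 exprS -[s.+1%:R]natr1; lra.
apply: le_trans (A_miss _) _.
apply: (@le_trans _ _ (p2 K%:R * p2 (- (2 ^+ r * (L - s%:R * K%:R))))).
  by rewrite ler_pM2l ?p2_gt0.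
by rewrite -!p2D p2_le// addn0 -[s.+1%:R]natr1; lra.
Qed.

End Iterate.

(** Arithmetic for [fast_sequence]: [r] hits gaining [L] each against a loss of [K] per step. The
    choice of [L] makes [n1 * L / 4] at least [2 * (n - q) * (K + 1)], which leaves room for the
    first [m] steps. *)
Lemma linear_growth (r L K q m n n1 a b : R) : 0 <= K -> 0 <= n -> 0 <= L ->
  L = 8 * q * (K + 1) -> 2 * q * (K + 1) + m * L + 2 <= n -> n <= q * (n1 + 1) ->
  n1 / 4 - m <= r -> a + b <= n -> 2 <= r * L - a * K - b * K.
Proof.
move=> K0 n0 L0 LE hn qn hr hab.
have : 0 <= n * K by rewrite mulr_ge0.
have : (n1 / 4 - m) * L <= r * L by rewrite ler_wpM2r.
have : (a + b) * K <= n * K by rewrite ler_wpM2r.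
have : n * (K + 1) <= q * (n1 + 1) * (K + 1) by rewrite ler_wpM2r// addr_ge0.
have : n1 * L = 8 * (q * (n1 + 1) * (K + 1)) - 8 * (q * (K + 1)) by rewrite LE; ring.
lra.
Qed.

(* While the sequence stays below [2^-L0], hits and misses together make
   [- log2 A] grow linearly up to time [n %/ q], with a slope as large as wanted
   for [L0] large; from then on each hit doubles it, up to an error linear in [n]. *)
Lemma fast_sequence (K : nat) (beta : R) : beta < 1 / 2 ->
  exists eps : R, exists q : nat, [/\ 0 < eps, (4 <= q)%N & forall m, exists n0, forall n, (n0 <= n)%N ->
  forall (A : nat -> R) (B : nat -> bool),
    (forall k, 0 <= A k) -> (forall k, B k -> A k.+1 <= p2 K%:R * A k ^+ 2) ->
    (forall k, A k.+1 <= p2 K%:R * A k) ->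
    (forall k, (m <= k)%N -> A k <= eps) ->
    (1 / 2 - q%:R^-1) * (n %/ q)%:R <= (hits B 0 (n %/ q))%:R :> R ->
    (1 / 2 - q%:R^-1) * n%:R <= (hits B 0 n)%:R :> R ->
    A n < p2 (- p2 (n%:R * beta))].
Proof.
move=> hb; have d0 : 0 < (1 / 2 - beta) / 2 by lra.
(* Frequency [1 / q] is lost twice, in the fluctuation of the hits and in the first [n / q] steps,
   so [2 / q <= 1 / 2 - beta] is needed; [q >= 4] keeps the hit rate of the first stage at least
   [1 / 4]. *)
pose q := (Num.truncn ((1 / 2 - beta) / 2)^-1).+4.
have q0 : 0 < q%:R :> R by rewrite ltr0n.
have q4 : 4 <= q%:R :> R by rewrite ler_nat.
have qd : q%:R^-1 <= (1 / 2 - beta) / 2.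
  rewrite invf_ple ?posrE//; apply: ltW; apply: lt_le_trans (truncnS_gt _) _.
  by rewrite ler_nat /q; do 3!apply: leqW.
have q4' : q%:R^-1 <= 4^-1 :> R by rewrite lef_pV2 ?posrE.
pose L0 : nat := (8 * q * K.+1)%N.
exists (p2 (- L0%:R)), q; split; [exact: p2_gt0|by []|].
move=> m; exists (2 * q * K.+1 + m * L0 + 2)%N => n hn A B A0 Ah Am hA h1 h2.
set n1 := (n %/ q)%N in h1 *.
have n1m : (m <= n1)%N.
  rewrite /n1 leq_divRL//; apply: (@leq_trans (m * L0)%N); last apply: leq_trans hn.
    by rewrite leq_mul2l /L0 mulnAC leq_pmull ?orbT// muln_gt0.
  by rewrite addnAC leq_addl.
have n1n : (n1 <= n)%N by exact: leq_div.
have S1 := iterate_small A0 Ah Am (n1 - m) hA (ler0n _ _).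
rewrite subnKC// in S1.
have S2 := iterate_square A0 Ah Am (n - n1) S1.
rewrite subnKC// in S2.
apply: le_lt_trans S2 _.
have qn : n%:R <= q%:R * (n1%:R + 1) :> R.
  rewrite natr1 -natrM ler_nat ltnW// mulnC /n1.
  by rewrite -ltn_divLR//.
have n1q : q%:R * n1%:R <= n%:R :> R by rewrite -natrM ler_nat mulnC leq_trunc_div.
have R1 : n1%:R / 4 - m%:R <= (hits B m n1)%:R :> R.
  have : (hits B 0 n1)%:R = (hits B 0 m)%:R + (hits B m n1)%:R :> R.
    by rewrite -natrD -hits_cat.
  have : (hits B 0 m)%:R <= m%:R :> R by rewrite ler_nat -[leqRHS]subn0 hits_le.
  have : n1%:R / 4 <= (1 / 2 - q%:R^-1) * n1%:R :> R.
    by rewrite mulrC ler_wpM2r//; lra.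
  lra.
have R2 : n%:R * beta <= (hits B n1 n)%:R.
  have : (hits B 0 n)%:R = (hits B 0 n1)%:R + (hits B n1 n)%:R :> R.
    by rewrite -natrD -hits_cat.
  have : (hits B 0 n1)%:R <= n1%:R :> R by rewrite ler_nat -[leqRHS]subn0 hits_le.
  have : n1%:R <= q%:R^-1 * n%:R :> R by rewrite ler_pdivlMl.
  have : n%:R * beta <= n%:R * (1 / 2 - q%:R^-1 - q%:R^-1) by rewrite ler_wpM2l//; lra.
  lra.
have hn' : 2 * q%:R * (K%:R + 1) + m%:R * L0%:R + 2 <= n%:R :> R.
  by rewrite natr1 -!natrM -!natrD ler_nat.
have LE : L0%:R = 8 * q%:R * (K%:R + 1) :> R by rewrite natr1 -!natrM.
have E : 2 <= (hits B m n1)%:R * L0%:R - (n1 - m)%:R * K%:R - (n - n1)%:R * K%:R :> R.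
  apply: (linear_growth (q := q%:R) (m := m%:R) (n := n%:R) (n1 := n1%:R)) => //.
  by rewrite -natrD ler_nat -[leqRHS](subnKC n1n) leq_add2r leq_subr.
apply: p2_lt; rewrite ltrN2; apply: (@le_lt_trans _ _ (2 ^+ hits B n1 n)).
  by rewrite -p2_nat p2_le.
by rewrite -[ltLHS]mulr1 ltr_pM2l ?exprn_gt0//; lra.
Qed.

(** The limit is the infimum of the quotients: divide [n] by an [M] whose quotient is almost
    minimal. [C] bounds the value at any remainder. *)
Lemma fekete (u : nat -> R) : (forall n, 0 <= u n) ->
  (forall n m, u (n + m)%N <= u n + u m) -> cvgn (fun n => u n / n%:R).
Proof.
move=> u0 uD.
pose E := [set x | exists2 n, (0 < n)%N & x = u n / n%:R].
have hE : has_inf E.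
  split; first by exists (u 1%N / 1%:R), 1%N.
  by exists 0 => x [n _ ->]; rewrite divr_ge0.
apply/cvg_ex; exists (inf E); apply/cvgrPdist_lt => e e0.
have [_ [M M0 ->] hM] : exists2 x, E x & x < inf E + e / 2.
  by apply: inf_adherent => //; rewrite divr_gt0.
pose C := \sum_(r < M) u r.
have uM q r : u (q * M + r)%N <= q%:R * u M + u r.
  elim: q => [|q IH]; first by rewrite mul0n mul0r add0n add0r.
  rewrite mulSn -addnA -[q.+1%:R]natr1 mulrDl mul1r addrAC addrC.
  by apply: le_trans (uD _ _) _; rewrite lerD2l.
near=> n.
have n0 : (0 < n)%N by near: n; exact: nbhs_infty_gt.
have n0' : 0 < n%:R :> R by rewrite ltr0n.
have nC : 2 * C / e < n%:R by near: n; exact: nbhs_infty_gtr.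
have l : inf E <= u n / n%:R by apply: ge_inf => //; [exact: hE.2|exists n].
rewrite ler0_norm ?subr_le0// opprB ltrBlDr.
have hr : u (n %% M)%N <= C.
  rewrite /C (bigD1 (Ordinal (ltn_pmod n M0)))//= lerDl sumr_ge0//.
have h : u n <= (n %/ M)%:R * u M + C.
  by rewrite {1}(divn_eq n M); apply: le_trans (uM _ _) _; rewrite lerD2l.
rewrite ltr_pdivrMr//; apply: le_lt_trans h _.
have M0' : 0 < M%:R :> R by rewrite ltr0n.
have uM' : u M <= (inf E + e / 2) * M%:R by rewrite -ler_pdivrMr// ltW.
have : (n %/ M)%:R * u M <= (inf E + e / 2) * n%:R.
  apply: (@le_trans _ _ ((n %/ M)%:R * ((inf E + e / 2) * M%:R))); first by rewrite ler_wpM2l.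
  rewrite mulrCA ler_wpM2l//; last by rewrite -natrM ler_nat leq_trunc_div.
  by apply: le_trans (ltW hM); rewrite divr_ge0.
have : C < n%:R * e / 2.
  by move: nC; rewrite ltr_pdivrMr//; lra.
lra.
Unshelve. all: by end_near.
Qed.

End FastSequences.

(** * Uniform random paths *)

Section CoinTree.
Context {R : realType}.

Definition avg (n : nat) (F : nat -> R) : R := (\sum_(0 <= i < 2 ^ n) F i) / 2 ^+ n.

Lemma sum_children (V : nmodType) (F : nat -> V) n :
  \sum_(0 <= i < n.*2) F i = \sum_(0 <= i < n) (F i.*2 + F i.*2.+1).
Proof.
elim: n => [|n IH]; first by rewrite !big_geq.
by rewrite doubleS !big_nat_recr//= IH addrA.
Qed.

Lemma avgS n F : avg n.+1 F = avg n (fun i => (F i.*2 + F i.*2.+1) / 2).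
Proof.
rewrite /avg expnS mul2n sum_children -mulr_suml exprS invfM; ring.
Qed.

Lemma le_avg n F G : (forall i, (i < 2 ^ n)%N -> F i <= G i) -> avg n F <= avg n G.
Proof.
move=> FG; rewrite /avg ler_pM2r ?invr_gt0 ?exprn_gt0// big_nat [leRHS]big_nat.
by apply: ler_sum => i /andP[_ iN]; exact: FG.
Qed.

Lemma avgD n F G : avg n (fun i => F i + G i) = avg n F + avg n G.
Proof. by rewrite /avg big_split mulrDl. Qed.

Lemma avgZ n c F : avg n (fun i => c * F i) = c * avg n F.
Proof. by rewrite /avg -mulr_sumr mulrA. Qed.

Lemma avg_cst n c : avg n (fun=> c) = c.
Proof.
by rewrite /avg sumr_const_nat subn0 -[c *+ _]mulr_natr natrX mulfK.
Qed.

Lemma avg_ge0 n F : (forall i, (i < 2 ^ n)%N -> 0 <= F i) -> 0 <= avg n F.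
Proof. by move=> F0; rewrite -(avg_cst n 0); exact: le_avg. Qed.

Fixpoint branch_hits (b : bool) (n i : nat) : nat :=
  if n is n'.+1 then (branch_hits b n' i./2 + (odd i == b))%N else 0%N.

Definition imbalance b n i : R := (branch_hits b n i)%:R *+ 2 - n%:R.

(** Variance of a walk with [n] independent steps of size 1: over the two children the cross terms
    cancel. *)
Lemma avg_imbalance b n : avg n (fun i => imbalance b n i ^+ 2) = n%:R.
Proof.
elim: n => [|n IH].
  by rewrite /avg expn0 big_nat1 expr0 divr1 /imbalance /= mul0rn subr0 expr0n.
rewrite avgS -[n.+1%:R]natr1 -IH -[X in _ = _ + X](avg_cst n) -avgD; congr avg.
apply/funext => i; rewrite /imbalance /= uphalf_double doubleK odd_double /=.
by clear IH; case: b; rewrite /= ?addn0 ?addn1 -!natr1 !mulrnDl !mulr2n; field.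
Qed.

Context {d : measure_display} {T : measurableType d} (P : probability T R)
  (B : nat -> T -> bool) (hB : iid_bernoulli_half P B).

Definition path_index (n : nat) (w : T) : nat := rand_index B n w.

Lemma path_indexS n w : path_index n.+1 w = ((path_index n w).*2 + B n.+1 w)%N.
Proof.
rewrite /path_index /= big_ord_recr/= subnn muln1 -mul2n big_distrr/=; congr (_ + _)%N.
apply: eq_bigr => j _; rewrite mulnCA -expnS; congr (_ * 2 ^ _)%N.
by rewrite subSS subnSK.
Qed.

Lemma odd_path_index n w : odd (path_index n.+1 w) = B n.+1 w.
Proof. by rewrite path_indexS oddD odd_double; case: (B _ _). Qed.

Lemma half_path_index n w : (path_index n.+1 w)./2 = path_index n w.
Proof. by rewrite path_indexS addnC half_bit_double. Qed.

Lemma branch_hits_path b n w :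
  branch_hits b n (path_index n w) = hits (fun k => B k.+1 w == b) 0 n.
Proof.
elim: n => [|n IH]; first by rewrite /hits big_geq.
by rewrite /= half_path_index odd_path_index IH /hits big_nat_recr.
Qed.

Let bits n w : {ffun 'I_n -> bool} := [ffun k : 'I_n => B k.+1 w].

Let fin_meas_bits n : fin_meas (bits n).
Proof. by apply: fin_meas_ffun => k; case: hB => h _; exact: h. Qed.

Let seq_bits n (b : {ffun 'I_n -> bool}) (k : nat) : bool :=
  if k is k'.+1 then (if insub k' is Some o then b o else false) else false.

Let seq_bitsE n (b : {ffun 'I_n -> bool}) (k : 'I_n) : seq_bits b k.+1 = b k.
Proof. by rewrite /seq_bits valK. Qed.

Let bits_index n (b : {ffun 'I_n -> bool}) : 'I_(2 ^ n) := Ordinal (bidx_lt n (seq_bits b)).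

Let index_inj (f g : nat -> bool) n :
  (\sum_(j < n) f j.+1 * 2 ^ (n - j.+1))%N = (\sum_(j < n) g j.+1 * 2 ^ (n - j.+1))%N ->
  forall k, (k < n)%N -> f k.+1 = g k.+1.
Proof.
have S (h : nat -> bool) m : (\sum_(j < m.+1) h j.+1 * 2 ^ (m.+1 - j.+1))%N =
    (\sum_(j < m) h j.+1 * 2 ^ (m - j.+1)).*2 + h m.+1 :> nat.
  rewrite big_ord_recr/= subnn muln1 -mul2n big_distrr/=; congr (_ + _)%N.
  apply: eq_bigr => j _; rewrite mulnCA -expnS; congr (_ * 2 ^ _)%N.
  by rewrite subSS subnSK.
elim: n => [//|n IH]; rewrite !S => e.
have o : f n.+1 = g n.+1.
  by have := congr1 odd e; rewrite !oddD !odd_double; case: (f _); case: (g _).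
rewrite o in e; move/addIn: e => /double_inj /IH h k; rewrite ltnS leq_eqVlt => /orP[/eqP -> //|].
exact: h.
Qed.

Let bits_index_bij n : bijective (@bits_index n).
Proof.
apply: inj_card_bij; last by rewrite card_ffun card_bool !card_ord.
move=> b b' /(congr1 val)/index_inj h; apply/ffunP => k.
by rewrite -!seq_bitsE; exact: h.
Qed.

Let rand_index_bits n w : rand_index B n w = bits_index (bits n w).
Proof.
apply: val_inj; apply: eq_bigr => j _; congr (_ * _)%N.
by rewrite seq_bitsE ffunE.
Qed.

Lemma measurable_path n (Phi : nat -> Prop) : measurable [set w | Phi (path_index n w)].
Proof.
rewrite (_ : mkset _ = [set w | (fun b => Phi (bits_index b)) (bits n w)]).
  exact: (fin_meas_pred (fun b => Phi (bits_index b)) (@fin_meas_bits n)).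
by apply/seteqP; split => w /=; rewrite /path_index rand_index_bits.
Qed.

(** Binary expansion is a bijection between coin strings and indices, so the random index is
    uniform. *)
Lemma Pr_path n (p : pred nat) :
  Pr P [set w | p (path_index n w)] = avg n (fun i => (p i)%:R).
Proof.
rewrite (_ : mkset _ = [set w | (fun b => p (bits_index b)) (bits n w)]); last first.
  by apply/seteqP; split => w /=; rewrite /path_index rand_index_bits.
rewrite (Pr_fun P (fun b => p (bits_index b)) (@fin_meas_bits n)).
rewrite /avg big_mkord mulr_suml.
have [g gK Kg] := bits_index_bij n.
rewrite (reindex (@bits_index n))/=; last by exists g => ? _.
rewrite big_mkcond/=; apply: eq_bigr => b _.
case: asboolP => h; last by rewrite (negbTE (introN idP h)) mul0r.
rewrite h mul1r; case: hB => _ hb; rewrite -exprVn -div1r -(hb n b); congr Pr.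
apply/seteqP; split => w /=; first by move=> <- k; rewrite ffunE.
by move=> e; apply/ffunP => k; rewrite ffunE e.
Qed.

Lemma Pr_path_card n (p : pred nat) :
  Pr P [set w | p (path_index n w)] = #|[set i : 'I_(2 ^ n) | p i]%SET|%:R / (2 ^ n)%:R.
Proof.
rewrite Pr_path /avg natrX; congr (_ / _); rewrite big_mkord -sum1dep_card.
by rewrite natr_sum [RHS]big_mkcond/=; apply: eq_bigr => i _; case: (p i).
Qed.

Lemma Pr_path_markov n (p : pred nat) F c : 0 < c ->
  (forall i, (i < 2 ^ n)%N -> 0 <= F i) ->
  (forall i, (i < 2 ^ n)%N -> p i -> c <= F i) ->
  Pr P [set w | p (path_index n w)] <= avg n F / c.
Proof.
move=> c0 F0 pF; rewrite Pr_path ler_pdivlMr// mulrC -avgZ; apply: le_avg => i iN.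
by case: (boolP (p i)) => pi; rewrite ?mulr1 ?mulr0; [exact: pF|exact: F0].
Qed.

(** Chebyshev's inequality: a deficit of [g * n] hits makes the imbalance at least [2 * g * n] in
    absolute value. *)
Lemma few_hits b n (g : R) : (0 < n)%N -> 0 < g ->
  Pr P [set w | (hits (fun k => B k.+1 w == b) 0 n)%:R < (1 / 2 - g) * n%:R]
    <= (4 * g ^+ 2 * n%:R)^-1.
Proof.
move=> n0 g0; have n0' : 0 < n%:R :> R by rewrite ltr0n.
rewrite (_ : mkset _ = [set w | (fun i => (branch_hits b n i)%:R < (1 / 2 - g) * n%:R) (path_index n w)]).
  have c0 : 0 < 4 * g ^+ 2 * n%:R ^+ 2 by rewrite !mulr_gt0 ?exprn_gt0.
  apply: le_trans (@Pr_path_markov n (fun i => (branch_hits b n i)%:R < (1 / 2 - g) * n%:R)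
    (fun i => imbalance b n i ^+ 2) _ c0 _ _) _.
  - by move=> i _; exact: sqr_ge0.
  - move=> i _ h; set c : R := (branch_hits b n i)%:R in h *.
    have -> : imbalance b n i ^+ 2 = (n%:R - c *+ 2) ^+ 2 by rewrite /imbalance -/c; ring.
    have -> : 4 * g ^+ 2 * n%:R ^+ 2 = (2 * g * n%:R) ^+ 2 by ring.
    have p0 : 0 <= 2 * g * n%:R by rewrite !mulr_ge0// ltW.
    have l : 2 * g * n%:R <= n%:R - c *+ 2 by move: (c) h => c' h; lra.
    by rewrite lerXn2r ?nnegrE//; exact: le_trans l.
  - rewrite avg_imbalance le_eqVlt; apply/orP; left; apply/eqP.
    by field; rewrite !gt_eqF.
by apply/seteqP; split => w /=; rewrite branch_hits_path.
Qed.

End CoinTree.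

(** * From almost sure convergence to rates in probability *)

Section AlmostSure.
Context {R : realType} {d : measure_display} {T : measurableType d} (P : probability T R).

Lemma borel_cantelli_ae (E : nat -> set T) (C : R) : (forall n, measurable (E n)) ->
  (forall N, \sum_(0 <= n < N) Pr P (E n) <= C) ->
  {ae P, forall w, exists m, forall n, (m <= n)%N -> ~ E n w}.
Proof.
move=> mE hC; exists (lim_sup_set E); split.
- by apply: bigcap_measurable => // k _; exact: bigcup_measurable.
- apply: lim_sup_set_cvg0 => //; apply: (@le_lt_trans _ _ C%:E); last exact: ltry.
  apply: lime_le; first exact: is_cvg_nneseries.
  apply: nearW => N; rewrite (eq_bigr (fun n => (Pr P (E n))%:E)) => [|n _]; last exact: PrE.
  by rewrite sumEFin lee_fin.
- move=> w /= /forallNP h m _; have /existsNP[n /not_implyP[mn /contrapT En]] := h m.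
  by exists n.
Qed.

(** Continuity from below; it turns an almost sure but path-dependent starting time into a fixed
    [m], at the cost of [eta]. *)
Lemma Pr_exhaust (A : set T) (F : nat -> set T) : measurable A ->
  (forall n, measurable (F n)) -> (forall n, F n `<=` F n.+1) ->
  {ae P, forall w, A w -> exists m, F m w} ->
  forall eta, 0 < eta -> exists m, Pr P A - eta <= Pr P (F m).
Proof.
move=> mA mF ndF [N [mN N0 hN]] eta eta0.
have mU : measurable (\bigcup_n F n) by exact: bigcupT_measurable.
have ndF' : nondecreasing_seq F.
  apply/nondecreasing_seqP => n; apply/subsetPset; exact: ndF.
have /fine_cvgP[_ cv] : P \o F @ \oo --> (Pr P (\bigcup_n F n))%:E.
  by rewrite -PrE//; exact: nondecreasing_cvg_mu.
have le : Pr P A <= Pr P (\bigcup_n F n).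
  apply: (@le_trans _ _ (Pr P (\bigcup_n F n `|` N))).
    apply: le_Pr => //; first exact: measurableU.
    move=> w Aw; have [h|h] := pselect (exists m, F m w).
      by left; case: h => m ?; exists m.
    by right; apply: hN => /= /(_ Aw).
  apply: le_trans (PrU_le P mU mN) _.
  by rewrite [X in _ + X]/Pr [P N]N0 addr0.
have /cvgrPdist_lt/(_ _ eta0)[m _ /(_ m (leqnn m))] := cv.
rewrite /= -/(Pr P (F m)) ltr_norml => /andP[_ h].
by exists m; lra.
Qed.

Context (B : nat -> T -> bool) (hB : iid_bernoulli_half P B).
Local Notation path_index := (path_index B).

Lemma measurable_all_path (Phi : nat -> nat -> Prop) :
  measurable [set w | forall k, Phi k (path_index k w)].
Proof.
rewrite (_ : mkset _ = \bigcap_k [set w | Phi k (path_index k w)]).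
  by apply: bigcapT_measurable => k; exact: (measurable_path hB).
by apply/seteqP; split => w /= h k; [move=> _; exact: h|exact: (h k I)].
Qed.

Lemma measurable_hits b n (Phi : nat -> Prop) :
  measurable [set w | Phi (hits (fun k => B k.+1 w == b) 0 n)].
Proof.
rewrite (_ : mkset _ = [set w | (fun i => Phi (branch_hits b n i)) (path_index n w)]).
  exact: (measurable_path hB n (fun i => Phi (branch_hits b n i))).
by apply/seteqP; split => w /=; rewrite branch_hits_path.
Qed.

(** [fast_sequence] applies on every path that stays below [eps] from time [m] on and has enough
    hits at times [n %/ q] and [n]; each of the three requirements costs [eta / 3]. *)
Lemma fast_in_probability (A : nat -> nat -> R) (b : bool) (K : nat) (theta : R) :
  (forall n i, 0 <= A n i) ->
  (forall n i, A n.+1 (i.*2 + b)%N <= 2 `^ K%:R * A n i ^+ 2) ->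
  (forall n i (c : bool), A n.+1 (i.*2 + c)%N <= 2 `^ K%:R * A n i) ->
  (forall eps eta : R, 0 < eps -> 0 < eta -> exists m, theta - eta <=
     Pr P [set w | forall k, (m <= k)%N -> A k (path_index k w) <= eps]) ->
  forall beta eta : R, beta < 1 / 2 -> 0 < eta -> exists n0, forall n, (n0 <= n)%N ->
    theta - eta <= Pr P [set w | A n (path_index n w) < 2 `^ (- 2 `^ (n%:R * beta))].
Proof.
move=> A0 Ah Am hth beta eta hbeta eta0.
have [eps [q [eps0 q4 hfast]]] := fast_sequence K hbeta.
have q0 : 0 < q%:R :> R by rewrite ltr0n; lia.
have eta3 : 0 < eta / 3 by rewrite divr_gt0.
have [m hm] := hth _ _ eps0 eta3.
have [n0 hn0] := hfast m.
(* For [n >= M] the Chebyshev bound [q ^ 2 / (4 * n)] is at most [eta / 3]. *)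
pose M := (Num.truncn (q%:R ^+ 2 * 3 / (4 * eta))).+1.
have bad n : (M <= n)%N -> Pr P [set w | (hits (fun k => B k.+1 w == b) 0 n)%:R < (1 / 2 - q%:R^-1) * n%:R :> R] <= eta / 3.
  move=> Mn; have n0' : (0 < n)%N by apply: leq_trans Mn.
  have qi : 0 < q%:R^-1 :> R by rewrite invr_gt0.
  apply: le_trans (few_hits hB b n0' qi) _.
  have n0'' : 0 < n%:R :> R by rewrite ltr0n.
  have hM : q%:R ^+ 2 * 3 / (4 * eta) <= n%:R.
    by apply: ltW; apply: lt_le_trans (truncnS_gt _) _; rewrite ler_nat.
  have -> : (4 * q%:R^-1 ^+ 2 * n%:R)^-1 = q%:R ^+ 2 / (4 * n%:R) :> R.
    by field; rewrite !gt_eqF.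
  rewrite ler_pdivrMr ?mulr_gt0//.
  by move: hM; rewrite ler_pdivrMr ?mulr_gt0//; lra.
exists (maxn n0 (q * M)) => n; rewrite geq_max => /andP[nn0 nq].
have Mn1 : (M <= n %/ q)%N by rewrite leq_divRL ?(ltn_trans _ q4)// mulnC.
have Mn : (M <= n)%N by apply: leq_trans Mn1 _; exact: leq_div.
pose G := [set w | forall k, (m <= k)%N -> A k (path_index k w) <= eps].
pose bad_at k := [set w | (hits (fun k => B k.+1 w == b) 0 k)%:R < (1 / 2 - q%:R^-1) * k%:R :> R].
pose good := [set w | A n (path_index n w) < 2 `^ (- 2 `^ (n%:R * beta))].
have mgood : measurable good by exact: (measurable_path hB n (fun i => A n i < _)).
have mG : measurable G by exact: (measurable_all_path (fun k i => (m <= k)%N -> A k i <= eps)).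
have mbad k : measurable (bad_at k).
  exact: (measurable_hits b k (fun h => h%:R < (1 / 2 - q%:R^-1) * k%:R :> R)).
have cover : G `<=` good `|` (bad_at (n %/ q)%N `|` bad_at n).
  move=> w Gw; have [h1|h1] := ltP (hits (fun k => B k.+1 w == b) 0 (n %/ q))%:R ((1 / 2 - q%:R^-1) * (n %/ q)%:R : R).
    by right; left.
  have [h2|h2] := ltP (hits (fun k => B k.+1 w == b) 0 n)%:R ((1 / 2 - q%:R^-1) * n%:R : R).
    by right; right.
  left; apply: (hn0 n nn0 (fun k => A k (path_index k w)) (fun k => B k.+1 w == b)) => //.
    by move=> k /eqP e; rewrite path_indexS e; exact: Ah.
  by move=> k; rewrite path_indexS; exact: Am.
have := le_Pr P mG (measurableU _ _ mgood (measurableU _ _ (mbad _) (mbad _))) cover.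
have := PrU_le P mgood (measurableU _ _ (mbad (n %/ q)%N) (mbad n)).
have := PrU_le P (mbad (n %/ q)%N) (mbad n).
have := bad _ Mn1; have := bad _ Mn; rewrite -/(bad_at _) -/(bad_at n) -/good.
move: hm; rewrite -/G; lra.
Qed.

(* For [beta < 0] the threshold on the right tends to 0, but only exponentially
   fast, whereas the left-hand side decays doubly exponentially. *)
Lemma threshold_small (beta : R) : exists n0, forall n, (n0 <= n)%N ->
  2 `^ (- 2 `^ (n%:R * (1 / 4))) <= 1 - 2 `^ (- 2 `^ (n%:R * beta)) :> R.
Proof.
pose b := (Num.truncn `|beta|).+1.
have hb : - beta <= b%:R.
  apply: ltW; apply: le_lt_trans (truncnS_gt `|beta|).
  by have := ler_norm (- beta); rewrite normrN.
(* With [j = n %/ 8] at least [8 * b + 2], [2 + n * b <= (j + 1) ^ 2 <= 2 ^ (2 * j)], and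
   [2 * j <= n / 4]. *)
exists (8 * (8 * b + 2))%N => n hn.
pose j := (n %/ 8)%N.
have j8 : (8 * b + 2 <= j)%N by rewrite /j leq_divRL// mulnC.
have nj : (n <= 8 * j.+1)%N by rewrite /j; have := ltn_ceil n (isT : (0 < 8)%N); lia.
have jn : (8 * j <= n)%N by rewrite mulnC leq_trunc_div.
have L : 2 + n%:R * b%:R <= 2 `^ (n%:R * (1 / 4)) :> R.
  apply: (@le_trans _ _ (2 `^ (2 * j%:R))); last first.
    apply: p2_le; have : 8 * j%:R <= n%:R :> R by rewrite -natrM ler_nat.
    lra.
  rewrite -[2 * j%:R]natrM p2_nat -[2 ^+ _]natrX -natrM -natrD ler_nat mul2n -addnn expnD.
  have h : (j.+1 <= 2 ^ j)%N by exact: ltn_expl.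
  apply: leq_trans (leq_mul h h).
  apply: (@leq_trans (2 + 8 * j.+1 * b)); first by rewrite leq_add2l leq_mul2r nj orbT.
  nia.
set x : R := 2 `^ (n%:R * beta); have x0 : 0 < x by exact: p2_gt0.
pose y := x * ln 2.
have l2 : 1 / 2 <= ln 2 :> R.
  have := @ln_ge1BV R 2 (ltr0n _ 2); lra.
have y0 : 0 < y by rewrite mulr_gt0// ln2_gt0.
have e1 : 2 `^ (- x) <= (1 + y)^-1 :> R.
  rewrite powRN lef_pV2 ?posrE ?p2_gt0//; last lra.
  by rewrite /powR pnatr_eq0/= expR_ge1Dx.
apply: (@le_trans _ _ (1 - (1 + y)^-1)); last by lra.
(* It remains to bound [1 + 1 / y]: since [ln 2 >= 1 / 2], it is at most [1 + 2 / x], hence at most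
   [4 * 2 ^ (n * b)]. *)
have -> : 1 - (1 + y)^-1 = (1 + y^-1)^-1.
  by field; rewrite !gt_eqF//; have := invr_gt0 y; lra.
rewrite powRN lef_pV2 ?posrE ?p2_gt0//; last by rewrite addr_gt0// invr_gt0.
apply: le_trans (p2_le L).
rewrite p2D (powR_mulrn 2 (ltW _))//.
have xi : x^-1 <= 2 `^ (n%:R * b%:R).
  rewrite /x -powRN; apply: p2_le; rewrite -mulrN; exact: ler_wpM2l.
have g1 : 1 <= 2 `^ (n%:R * b%:R) :> R by rewrite -[leLHS](powRr0 2) p2_le// mulr_ge0.
have yi : y^-1 <= 2 * x^-1.
  rewrite /y invfM mulrC ler_pM2r ?invr_gt0// invf_ple ?posrE ?ln2_gt0//; lra.
lra.
Qed.

End AlmostSure.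

(** * Polarization *)

Section Polarization.
Context {R : realType} {d : measure_display} {T : measurableType d} (P : probability T R).
Context (B : nat -> T -> bool) (hB : iid_bernoulli_half P B).
Local Notation path_index := (path_index B).

(** [K], [M] and [G] stand for total variation, its variant with the middle state, and entropy, all
    observed with boundary states; [Z] and [H] are the Bhattacharyya parameter and the entropy
    without them. *)
Context (K M Z H G : nat -> nat -> R) (psi C : R) (psi1 : 1 <= psi) (C0 : 0 <= C).
Context (K_ge0 : forall n i, 0 <= K n i) (K_le1 : forall n i, K n i <= 1).
Context (Z_ge0 : forall n i, 0 <= Z n i) (Z_le1 : forall n i, Z n i <= 1).
Context (H_ge0 : forall n i, 0 <= H n i) (H_le1 : forall n i, H n i <= 1).
Context (K_minus : forall n i, K n.+1 i.*2 <= M n i)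
  (K_plus : forall n i, K n.+1 i.*2.+1 <= 2 * K n i - M n i)
  (M_le : forall n i, M n i <= K n i) (M_sqr : forall n i, M n i <= psi * K n i ^+ 2)
  (gap : forall e : R, 0 < e -> exists2 delta : R, 0 < delta & exists n0, forall n, (n0 <= n)%N ->
     forall i, e <= K n i -> K n i <= 1 - e -> delta <= K n i - M n i).
Context (Z_minus : forall n i, Z n.+1 i.*2 <= 2 * psi * Z n i)
  (Z_plus : forall n i, Z n.+1 i.*2.+1 <= psi * Z n i ^+ 2)
  (Z_ge : forall n i, 1 - K n i <= Z n i).
Context (H_le_Z : forall n i, H n i * ln 2 <= 2 * Z n i)
  (Z_le_H : forall n i (t : R), 0 < t -> Z n i <= t + H n i * ln 2 / (2 * t))
  (G_le_H : forall n i, (i < 2 ^ n)%N -> G n i <= H n i)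
  (G_ge : forall n i, 1 - K n i / ln 2 <= G n i)
  (G_le : forall n i (t : R), 0 < t -> G n i * ln 2 <= 2 * ((1 - K n i) / (2 * t) + t))
  (avg_HG : forall n, avg n (fun i => H n i - G n i) <= C / 2 ^+ n).

Let M_ge0 n i : 0 <= M n i.
Proof. exact: le_trans (K_ge0 _ _) (K_minus n i). Qed.

Let potential n : R := avg n (fun i => 4 * K n i - K n i ^+ 2).

(** The potential increases on [[0, 2]], so upper bounds on the children suffice even when
    [2 * K - M] exceeds 1. At the values [M] and [2 * K - M], symmetric about [K], its mean drops by
    exactly [(K - M) ^ 2]. *)
Lemma potential_decr n :
  avg n (fun i => (K n i - M n i) ^+ 2) <= potential n - potential n.+1.
Proof.
rewrite lerBrDr /potential avgS -avgD; apply: le_avg => i _.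
have mono (x y : R) : 0 <= x -> x <= y -> y <= 2 -> 4 * x - x ^+ 2 <= 4 * y - y ^+ 2.
  move=> x0 xy y2; rewrite -subr_ge0.
  have -> : 4 * y - y ^+ 2 - (4 * x - x ^+ 2) = (y - x) * (4 - x - y) by ring.
  by apply: mulr_ge0; lra.
have := M_ge0 n i; have := M_le n i; have := K_le1 n i => k1 mk m0.
have := mono _ _ (K_ge0 n.+1 i.*2) (K_minus n i).
have := mono _ _ (K_ge0 n.+1 i.*2.+1) (K_plus n i).
move=> /(_ ltac:(lra)) h1 /(_ ltac:(lra)) h2.
have : (4 * M n i - M n i ^+ 2 + (4 * (2 * K n i - M n i) - (2 * K n i - M n i) ^+ 2)) / 2 =
  4 * K n i - K n i ^+ 2 - (K n i - M n i) ^+ 2 by field.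
lra.
Qed.

Lemma sum_ltn_le (n0 N : nat) : \sum_(0 <= n < N) (n < n0)%:R <= n0%:R :> R.
Proof.
suff : \sum_(0 <= n < N) (n < n0)%:R <= (minn N n0)%:R :> R.
  by move/le_trans; apply; rewrite ler_nat geq_minr.
elim: N => [|N IH]; first by rewrite big_geq.
rewrite big_nat_recr//= -[X in _ <= X]/(_%:R).
apply: le_trans (lerD IH (lexx _)) _; rewrite -natrD ler_nat.
by case: ltnP => h; lia.
Qed.

Let middle (e : R) (n i : nat) : bool := (e < K n i) && (K n i < 1 - e).

(** From [n0] on, an index in the middle has [(K - M) ^ 2 >= delta ^ 2], and the total drop of the
    potential is at most 4; each earlier term is at most 1. *)
Lemma sum_Pr_middle (e : R) : 0 < e -> exists C', forall N,
  \sum_(0 <= n < N) Pr P [set w | middle e n (path_index n w)] <= C'.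
Proof.
move=> e0; have [delta delta0 [n0 hn0]] := gap e0.
exists (n0%:R + 4 / delta ^+ 2) => N.
have d2 : 0 < delta ^+ 2 by rewrite exprn_gt0.
have pot0 n : 0 <= potential n <= 4.
  apply/andP; split.
    apply: avg_ge0 => i _; have := K_ge0 n i; have := K_le1 n i => k1 k0.
    have : K n i ^+ 2 <= K n i by rewrite expr2 ler_piMl.
    lra.
  rewrite -[leRHS](avg_cst n); apply: le_avg => i _.
  by have := K_le1 n i; have := sqr_ge0 (K n i); lra.
have step n : Pr P [set w | middle e n (path_index n w)] <=
    (n < n0)%:R + (potential n - potential n.+1) / delta ^+ 2.
  have q0 : 0 <= (potential n - potential n.+1) / delta ^+ 2.
    apply: divr_ge0 (ltW d2); apply: le_trans (potential_decr n).
    by apply: avg_ge0 => i _; exact: sqr_ge0.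
  case: ltnP => h.
    have := Pr_le1 P (measurable_path hB n (fun i => middle e n i)).
    by rewrite /=; lra.
  rewrite add0r; apply: le_trans (Pr_path_markov hB (p := middle e n)
     (F := fun i => (K n i - M n i) ^+ 2) d2 _ _) _.
  - by move=> i _; exact: sqr_ge0.
  - move=> i _ /andP[/ltW h1 /ltW h2]; have h3 := hn0 n h i h1 h2.
    by rewrite lerXn2r ?nnegrE// ?ltW//; exact: lt_le_trans h3.
  - by rewrite ler_pM2r ?invr_gt0//; exact: potential_decr.
apply: le_trans (ler_sum_nat (fun n _ => step n)) _.
rewrite big_split/= lerD ?sum_ltn_le// -mulr_suml ler_pM2r ?invr_gt0//.
rewrite (eq_bigr (fun n => - potential n.+1 - - potential n)) => [|n _]; last by rewrite opprK addrC.
rewrite (telescope_sumr (fun n => - potential n))//.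
by have := pot0 N; have := pot0 0%N; lra.
Qed.

Let far (e : R) (n i : nat) : bool := e < H n i - G n i.

Lemma sum_Pr_far (e : R) : 0 < e -> forall N,
  \sum_(0 <= n < N) Pr P [set w | far e n (path_index n w)] <= 2 * C / e.
Proof.
move=> e0 N.
have step n : Pr P [set w | far e n (path_index n w)] <= C / e * (2 ^+ n)^-1.
  apply: le_trans (Pr_path_markov hB (p := far e n) (F := fun i => H n i - G n i) e0 _ _) _.
  - by move=> i iN; rewrite subr_ge0 G_le_H.
  - by move=> i _ /ltW.
  - by rewrite [leRHS]mulrAC ler_pM2r ?invr_gt0.
apply: le_trans (ler_sum_nat (fun n _ => step n)) _.
rewrite -mulr_sumr.
have -> : \sum_(0 <= n < N) (2 ^+ n)^-1 = 2 - 2 / 2 ^+ N :> R.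
  elim: N => [|N IH]; first by rewrite big_geq// expr0 divr1 subrr.
  by rewrite big_nat_recr//= IH exprS; field; rewrite expf_neq0.
have : 0 <= C / e * (2 / 2 ^+ N) by rewrite mulr_ge0// divr_ge0// ltW.
lra.
Qed.

Lemma dichotomy (k : nat -> R) : (forall n, k n.+1 <= 2 * k n) ->
  (forall j : nat, exists m, forall n, (m <= n)%N -> ~ (j.+1%:R^-1 < k n < 1 - j.+1%:R^-1)) ->
  (forall e : R, 0 < e -> \forall n \near \oo, k n <= e) \/
  (forall e : R, 0 < e -> \forall n \near \oo, 1 - e <= k n).
Proof.
move=> k2 hk.
(* The thresholds are [1 / 5] and [4 / 5]: from below [1 / 5] one doubling reaches at most [2 / 5],
   so the middle interval cannot be jumped over. *)
have [m hm] := hk 4%N.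
have small e : 0 < e -> exists j : nat, j.+1%:R^-1 < e :> R.
  move=> e0; exists (Num.truncn e^-1); rewrite invf_plt ?posrE//; exact: truncnS_gt.
have [[n0 [mn0 kn0]]|hlarge] := pselect (exists n, (m <= n)%N /\ k n <= 5^-1).
  left=> e e0; have [j hj] := small _ e0; have [m' hm'] := hk j.
  have stay n : (n0 <= n)%N -> k n <= 5^-1.
    elim: n => [|n IH]; first by rewrite leqn0 => /eqP n00; rewrite n00 in kn0.
    rewrite leq_eqVlt => /orP[/eqP n0n|]; first by rewrite n0n in kn0.
    rewrite ltnS => h.
    rewrite leNgt; apply/negP => h'; apply: (hm n.+1); first lia.
    by have := k2 n; have := IH h; move: h' => /=; lra.
  exists (maxn n0 m') => // n /=; rewrite geq_max => /andP[h1 h2].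
  rewrite leNgt; apply/negP => h; apply: (hm' n h2); have := stay n h1.
  have j0 : (j.+1%:R^-1 : R) <= 1 / 2 \/ j = 0%N.
    case: (j) => [|j']; [by right|by left; rewrite div1r lef_pV2 ?posrE// ler_nat].
  case: j0 => [j0|j0]; last by move: hj; rewrite j0 invr1; lra.
  move=> kn; rewrite (lt_trans hj h) (le_lt_trans kn)//.
  by move: j0; set x := _^-1 => j0; lra.
right=> e e0; have [j hj] := small _ e0; have [m' hm'] := hk j.
have big n : (m <= n)%N -> 4 / 5 <= k n.
  move=> mn; rewrite leNgt; apply/negP => h; apply: (hm n mn).
  have : ~ (k n <= 5^-1) by move=> h'; apply: hlarge; exists n.
  by move/negP; rewrite -ltNge; lra.
exists (maxn m m') => // n /=; rewrite geq_max => /andP[h1 h2].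
rewrite leNgt; apply/negP => h; apply: (hm' n h2); have := big n h1.
by move: hj; move: (j.+1%:R^-1 : R) => x hj kn; apply/andP; split; lra.
Qed.

(** A measurable event that almost surely agrees with convergence of [Z] to 1. *)
Definition good_set : set T := [set w | exists m, forall n, (m <= n)%N -> 1 / 2 <= Z n (path_index n w)].

Lemma measurable_good_set : measurable good_set.
Proof.
rewrite (_ : good_set = \bigcup_m [set w | forall n, (m <= n)%N -> 1 / 2 <= Z n (path_index n w)]).
  apply: bigcupT_measurable => m.
  exact: (measurable_all_path hB (fun n i => (m <= n)%N -> 1 / 2 <= Z n i)).
by apply/seteqP; split => w [m]; [exists m|move=> _ ?; exists m].
Qed.

(** Where [K] tends to 1, the entropy [G] with states tends to 0; [H - G] does so almost surely by
    [sum_Pr_far], so [H] and with it [Z] vanish in the limit. *)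
Lemma ae_polarization : {ae P, forall w,
  (good_set w /\ (forall e : R, 0 < e -> \forall n \near \oo, K n (path_index n w) <= e) /\
    (forall e : R, 0 < e -> \forall n \near \oo, 1 - e <= Z n (path_index n w))) \/
  (~ good_set w /\ forall e : R, 0 < e -> \forall n \near \oo, Z n (path_index n w) <= e)}.
Proof.
have h1 : {ae P, forall w, forall j : nat, exists m, forall n, (m <= n)%N ->
    ~ (j.+1%:R^-1 < K n (path_index n w) < 1 - j.+1%:R^-1)}.
  apply: ae_foralln => j; have [|C' hC'] := @sum_Pr_middle j.+1%:R^-1; first by rewrite invr_gt0.
  apply: borel_cantelli_ae hC' => n.
  exact: (measurable_path hB n (fun i => middle j.+1%:R^-1 n i)).
have h2 : {ae P, forall w, forall j : nat, exists m, forall n, (m <= n)%N ->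
    ~ (far j.+1%:R^-1 n (path_index n w))}.
  apply: ae_foralln => j.
  apply: (borel_cantelli_ae _ (@sum_Pr_far j.+1%:R^-1 _)); last by rewrite invr_gt0.
  by move=> n; exact: (measurable_path hB n (fun i => far j.+1%:R^-1 n i)).
apply: filterS2 h1 h2 => w h1 h2.
have Kd n : K n.+1 (path_index n.+1 w) <= 2 * K n (path_index n w).
  rewrite path_indexS; set i := path_index n w; have := M_ge0 n i; have := M_le n i.
  have := K_ge0 n i; case: (B _ _); rewrite ?addn1 ?addn0; first by have := K_plus n i; lra.
  by have := K_minus n i; lra.
have [hK|hK] := dichotomy Kd h1.
  left; have hZ e : 0 < e -> \forall n \near \oo, 1 - e <= Z n (path_index n w).
    move=> e0; near=> n; apply: le_trans (Z_ge _ _); rewrite lerB//.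
    by near: n; exact: hK.
  split=> //; have [m _ hm] := hZ (1 / 2) ltac:(lra).
  by exists m => n mn; have /= := hm n mn; lra.
right; have hZ e : 0 < e -> \forall n \near \oo, Z n (path_index n w) <= e.
  move=> e0.
  (* Uses [Z_le_H] at [t = e / 2] and [G_le] at [t = s]; the constants are such
     that [H * ln 2 <= (1 / 8 + 3 / 16) * e ^+ 2 <= e ^+ 2 / 2]. *)
  pose s := e ^+ 2 / 16.
  have s0 : 0 < s by rewrite divr_gt0// exprn_gt0.
  have f0 : 0 < e ^+ 2 / (8 * ln 2) by rewrite divr_gt0 ?exprn_gt0 ?mulr_gt0 ?ln2_gt0.
  have [j hj] : exists j : nat, j.+1%:R^-1 < e ^+ 2 / (8 * ln 2).
    exists (Num.truncn (e ^+ 2 / (8 * ln 2))^-1); rewrite invf_plt ?posrE//; exact: truncnS_gt.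
  have [m hm] := h2 j.
  have ss : 0 < s ^+ 2 by rewrite exprn_gt0.
  near=> n.
  have n1 : 1 - s ^+ 2 <= K n (path_index n w) by near: n; exact: hK.
  have n2 : H n (path_index n w) - G n (path_index n w) <= j.+1%:R^-1.
    rewrite leNgt; apply/negP; apply: hm; near: n; exact: nbhs_infty_ge.
  have e2 : 0 < e / 2 by rewrite divr_gt0.
  apply: le_trans (Z_le_H _ _ e2) _.
  suff : H n (path_index n w) * ln 2 / (2 * (e / 2)) <= e / 2 by lra.
  rewrite mulrC ler_pdivrMl ?mulr_gt0//.
  have g1 := G_le n (path_index n w) s0.
  have g2 : (1 - K n (path_index n w)) / (2 * s) <= s / 2.
    by rewrite ler_pdivrMr ?mulr_gt0//; rewrite expr2 in n1; lra.
  have g3 : (H n (path_index n w) - G n (path_index n w)) * ln 2 <= e ^+ 2 / 8.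
    have : H n (path_index n w) - G n (path_index n w) <= e ^+ 2 / (8 * ln 2) by exact: le_trans n2 (ltW hj).
    rewrite -(ler_pM2r (@ln2_gt0 R)); move/le_trans; apply.
    by rewrite le_eqVlt; apply/orP; left; apply/eqP; field; rewrite gt_eqF// ln2_gt0.
  have -> : 2 * (e / 2) * (e / 2) = e ^+ 2 / 2 by field.
  have : s = e ^+ 2 / 16 by [].
  have : 0 <= e ^+ 2 by exact: sqr_ge0.
  move: g1 g2 g3; rewrite mulrBl; set E := e ^+ 2; lra.
split=> // -[m hm]; have [m' _ hm'] := hZ (1 / 4) ltac:(lra).
have := hm (maxn m m') (leq_maxl _ _); have /= := hm' (maxn m m') (leq_maxr _ _); lra.
Unshelve. all: by end_near.
Qed.

Let theta := Pr P good_set.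

Lemma eventually_K_small (e eta : R) : 0 < e -> 0 < eta -> exists m,
  theta - eta <= Pr P [set w | forall k, (m <= k)%N -> K k (path_index k w) <= e].
Proof.
move=> e0; apply: (Pr_exhaust (F := fun m => [set w | forall k, (m <= k)%N -> K k (path_index k w) <= e])).
- exact: measurable_good_set.
- by move=> m; exact: (measurable_all_path hB (fun n i => (m <= n)%N -> K n i <= e)).
- by move=> m w /= h k mk; apply: h; exact: ltnW.
apply: filterS ae_polarization => w [[_ [h _]] _|[ng _] /ng//].
by have [m _ hm] := h _ e0; exists m.
Qed.

Lemma eventually_Z_small (e eta : R) : 0 < e -> 0 < eta -> exists m,
  (1 - theta) - eta <= Pr P [set w | forall k, (m <= k)%N -> Z k (path_index k w) <= e].
Proof.
move=> e0; rewrite /theta -PrC; last exact: measurable_good_set.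
apply: (Pr_exhaust (F := fun m => [set w | forall k, (m <= k)%N -> Z k (path_index k w) <= e])).
- apply: measurableC; exact: measurable_good_set.
- by move=> m; exact: (measurable_all_path hB (fun n i => (m <= n)%N -> Z n i <= e)).
- by move=> m w /= h k mk; apply: h; exact: ltnW.
apply: filterS ae_polarization => w [[h _] /(_ h)//|[_ h] _].
by have [m _ hm] := h _ e0; exists m.
Qed.

Let p2_ge_2psi : 2 * psi <= 2 `^ (Num.truncn (2 * psi)).+1%:R.
Proof.
apply: ltW; apply: lt_le_trans (truncnS_gt _) _.
by rewrite p2_nat -natrX ler_nat ltnW// ltn_expl.
Qed.

Let p2_ge_psi : psi <= 2 `^ (Num.truncn (2 * psi)).+1%:R.
Proof. by apply: le_trans p2_ge_2psi; move: psi1; lra. Qed.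

Lemma fast_K (beta eta : R) : beta < 1 / 2 -> 0 < eta -> exists n0, forall n, (n0 <= n)%N ->
  theta - eta <= Pr P [set w | K n (path_index n w) < 2 `^ (- 2 `^ (n%:R * beta))].
Proof.
have p0 := p2_ge_2psi.
(* [K] squares on minus steps, hence [false]. The exponent uses [m <= 2 ^ m] to dominate [2 * psi]
   by a power of 2. *)
apply: (@fast_in_probability _ _ _ P B hB K false (Num.truncn (2 * psi)).+1 theta) => //.
- move=> n i; rewrite addn0; apply: le_trans (K_minus n i) _; apply: le_trans (M_sqr n i) _.
  by rewrite ler_wpM2r ?sqr_ge0 ?p2_ge_psi.
- move=> n i c; apply: (@le_trans _ _ (2 * psi * K n i)); last by rewrite ler_wpM2r.
  have : K n i <= psi * K n i by rewrite ler_peMl.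
  have := K_ge0 n i; have := M_ge0 n i; have := M_le n i.
  case: c; rewrite ?addn1 ?addn0; first by have := K_plus n i; lra.
  by have := K_minus n i; lra.
- exact: eventually_K_small.
Qed.

Lemma fast_Z (beta eta : R) : beta < 1 / 2 -> 0 < eta -> exists n0, forall n, (n0 <= n)%N ->
  (1 - theta) - eta <= Pr P [set w | Z n (path_index n w) < 2 `^ (- 2 `^ (n%:R * beta))].
Proof.
have p0 := p2_ge_2psi.
apply: (@fast_in_probability _ _ _ P B hB Z true (Num.truncn (2 * psi)).+1 (1 - theta)) => //.
- move=> n i; rewrite addn1; apply: le_trans (Z_plus n i) _.
  by rewrite ler_wpM2r ?sqr_ge0 ?p2_ge_psi.
- move=> n i c; apply: (@le_trans _ _ (2 * psi * Z n i)); last by rewrite ler_wpM2r.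
  case: c; rewrite ?addn1 ?addn0; last exact: Z_minus.
  apply: le_trans (Z_plus n i) _; rewrite expr2 mulrA ler_wpM2r//.
  apply: (@le_trans _ _ psi); first by rewrite ler_piMr// (le_trans ler01 psi1).
  by rewrite mulr_natl mulr2n lerDl (le_trans ler01 psi1).
- exact: eventually_Z_small.
Qed.

(** The lower bound comes from [fast_K] through [1 - K <= Z]. For the upper bound, paths on which
    [Z] is fast with exponent [1 / 4] lie below the threshold by [threshold_small]. *)
Lemma cvg_Pr_Z_large (beta : R) : beta < 1 / 2 ->
  (fun n => Pr P [set w | 1 - 2 `^ (- 2 `^ (n%:R * beta)) < Z n (path_index n w)]) @ \oo --> theta.
Proof.
move=> hb; apply/cvgrPdist_le => eta eta0.
have [n1 h1] := fast_K hb eta0.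
have [n2 h2] := @fast_Z (1 / 4) _ ltac:(lra) eta0.
have [n3 h3] := @threshold_small R beta.
exists (maxn n1 (maxn n2 n3)) => // n /=; rewrite !geq_max => /and3P[/h1 g1 /h2 g2 /h3 g3].
have mZ : measurable [set w | 1 - 2 `^ (- 2 `^ (n%:R * beta)) < Z n (path_index n w)].
  exact: (measurable_path hB n (fun i => _ < Z n i)).
have lower : theta - eta <= Pr P [set w | 1 - 2 `^ (- 2 `^ (n%:R * beta)) < Z n (path_index n w)].
  apply: le_trans g1 _; apply: le_Pr => //.
    exact: (measurable_path hB n (fun i => K n i < _)).
  by move=> w /= h; apply: lt_le_trans (Z_ge _ _); lra.
have upper : (1 - theta) - eta <= 1 - Pr P [set w | 1 - 2 `^ (- 2 `^ (n%:R * beta)) < Z n (path_index n w)].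
  apply: le_trans g2 _; rewrite -PrC//; apply: le_Pr.
  - exact: (measurable_path hB n (fun i => Z n i < _)).
  - exact: measurableC.
  - move=> w /= h; apply/negP; rewrite -leNgt; apply: le_trans (ltW h) g3.
by rewrite ler_distlC lower/=; move: upper; set x := Pr P _; lra.
Qed.

(** Where [K <= e * ln 2], [H] is at least [1 - e]; where [Z <= e * ln 2 / 2], it is at most [e].
    These cases have limiting masses [theta] and [1 - theta]. *)
Lemma cvg_avg_H : (fun n => avg n (H n)) @ \oo --> theta.
Proof.
apply/cvgrPdist_le => eta eta0.
have l2 := @ln2_gt0 R.
pose e := eta / 2.
have e0 : 0 < e by rewrite divr_gt0.
have th0 : 0 <= theta by exact: Pr_ge0.
have [m1 h1] := @eventually_K_small (e * ln 2) e ltac:(by rewrite mulr_gt0) e0.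
have [m2 h2] := @eventually_Z_small (e * ln 2 / 2) e ltac:(by rewrite divr_gt0 ?mulr_gt0) e0.
exists (maxn m1 m2) => // n /=; rewrite geq_max => /andP[mn1 mn2].
have lower : theta - e - e <= avg n (H n).
  have : theta - e <= Pr P [set w | (fun i => K n i <= e * ln 2) (path_index n w)].
    apply: le_trans h1 _; apply: le_Pr.
    - exact: (measurable_all_path hB (fun n i => (m1 <= n)%N -> K n i <= e * ln 2)).
    - exact: (measurable_path hB n (fun i => K n i <= _)).
    - by move=> w; apply.
  rewrite (Pr_path hB n (fun i => K n i <= e * ln 2)) => /(lerD) /(_ (lexx (- e))) /le_trans; apply.
  rewrite -[X in _ + X](avg_cst n) -avgD; apply: le_avg => i iN.
  have := H_ge0 n i; case: (leP (K n i) (e * ln 2)) => h /= H0; last lra.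
  apply: le_trans (G_le_H iN); apply: le_trans (G_ge n i).
  by rewrite lerB// ler_pdivrMr.
have upper : avg n (H n) <= e + (theta + e).
  have : (1 - theta) - e <= Pr P [set w | (fun i => Z n i <= e * ln 2 / 2) (path_index n w)].
    apply: le_trans h2 _; apply: le_Pr.
    - exact: (measurable_all_path hB (fun n i => (m2 <= n)%N -> Z n i <= e * ln 2 / 2)).
    - exact: (measurable_path hB n (fun i => Z n i <= _)).
    - by move=> w; apply.
  rewrite (Pr_path hB n (fun i => Z n i <= e * ln 2 / 2)) => h.
  suff : avg n (H n) <= (1 + e) + (-1) * avg n (fun i => (Z n i <= e * ln 2 / 2)%R%:R) by lra.
  rewrite -[X in X + _](avg_cst n) -avgZ -avgD; apply: le_avg => i iN.
  have := H_le1 n i; case: (leP (Z n i) (e * ln 2 / 2)) => h' /= H1; last lra.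
  suff : H n i <= e by lra.
  by rewrite -(ler_pM2r l2); apply: le_trans (H_le_Z n i) _; lra.
have -> : eta = e + e by rewrite /e; lra.
by rewrite ler_distlC; apply/andP; split; [move: lower|move: upper]; lra.
Qed.

Lemma Z_polarizes : polarizes_to P (fun n w => Z n (path_index n w)) (\1_good_set : T -> R).
Proof.
split.
- exact/measurable_indic/measurable_good_set.
- by move=> w; rewrite indicE; case: (_ \in _); [right|left].
apply: filterS ae_polarization => w [[gw [_ h]]|[ngw h]]; apply/cvgrPdist_le => e e0.
  rewrite indicE mem_set//; near=> n.
  have n1 : 1 - e <= Z n (path_index n w) by near: n; exact: h.
  by have := Z_le1 n (path_index n w); rewrite ler_norml /=; lra.
rewrite indicE memNset//; near=> n.
have n1 : Z n (path_index n w) <= e by near: n; exact: h.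
by have := Z_ge0 n (path_index n w); rewrite ler_norml /=; lra.
Unshelve. all: by end_near.
Qed.

Lemma Pr_indic_good : Pr P [set w | (\1_good_set w : R) = 1] = theta.
Proof.
congr Pr; apply/seteqP; split => w /=; rewrite indicE.
  by case: (boolP (w \in good_set)) => [/set_mem//|_ /eqP]; rewrite eq_sym oner_eq0.
by move=> gw; rewrite mem_set.
Qed.

End Polarization.

Theorem theorem3 (R : realType) (d : measure_display) (T : measurableType d)
  (P : probability T R) (Yt St : finType)
  (X : int -> T -> 'F_2) (Y : int -> T -> Yt) (S : int -> T -> St)
  (hFAIM : FAIM P X Y S)
  (d' : measure_display) (T' : measurableType d') (P' : probability T' R)
  (B : nat -> T' -> bool) (hB : iid_bernoulli_half P' B) :
  polarizes_fast_to_1 P' (Zproc P X Y S B) /\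
  forall beta : R, beta < 1 / 2 ->
    (fun n : nat =>
       #|[set i : 'I_(2 ^ n) |
          1 - 2 `^ (- ((2 ^ n)%:R `^ beta)) < Zi P X Y i]%SET|%:R / (2 ^ n)%:R)
      @ \oo --> Hbar P X Y.
Proof.
pose st := stS P S; pose mu0 := base_law P X Y S.
have st_gt0 b : 0 < st b by exact: (stS_gt0 hFAIM).
have st1 : \sum_b st b = 1 by exact: (sum_stS hFAIM).
have mu0_ok : jlaw_ok st (fun u y => mu0 (u, y)) by exact: (base_law_ok hFAIM).
have pXYE n (w : blk n) : pXY P X Y (xrow w) (yrow w) = \sum_a \sum_b mu st mu0 w a b.
  exact: (pXY_mu hFAIM).
pose K := Khat st mu0; pose M n i := tv_mid st (jl st mu0 n i).
pose Z := Zpar st mu0; pose H := Hpar st mu0; pose G := Hhat st mu0.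
have ws0 n i := with_states_ge0 st_gt0 mu0_ok n i.
have ws1 n i := with_states_jl_mass st_gt0 mu0_ok st1 n i.
have ns0 n i := no_states_ge0 (jl_ok st_gt0 mu0_ok n i).
have ns1 n i := no_states_jl_mass st_gt0 mu0_ok st1 n i.
have [c c0 hc] := fin_lower_bound st_gt0.
pose psi := 1 + c^-1.
have psi1 : 1 <= psi by rewrite lerDl invr_ge0 ltW.
have psi0 : 0 <= psi by exact: le_trans psi1.
have hpsi b : (st b)^-1 <= psi.
  by apply: (@le_trans _ _ c^-1); rewrite ?lerDr// lef_pV2 ?posrE.
have St0 := card_St_gt0 st1.
pose C := ln #|{: St * St}|%:R / ln 2 : R.
have C0 : 0 <= C.
  rewrite divr_ge0 ?(ltW (@ln2_gt0 R))// ln_ge0// ler1n card_prod.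
  by rewrite muln_gt0 St0.
have K_ge0 n i : 0 <= K n i by exact: tv_ge0.
have K_le1 n i : K n i <= 1 by exact: tv_le1.
have Z_ge0 n i : 0 <= Z n i by exact: Bhat_ge0.
have Z_le1 n i : Z n i <= 1 by exact: Bhat_le1.
have H_ge0 n i : 0 <= H n i by exact: condEnt_ge0.
have H_le1 n i : H n i <= 1 by exact: condEnt_le1.
have K_minus n i : K n.+1 i.*2 <= M n i by exact: Khat_double.
have K_plus n i : K n.+1 i.*2.+1 <= 2 * K n i - M n i by exact: Khat_doubleS.
have M_le n i : M n i <= K n i by exact: (tv_mid_le st_gt0 (jl_ok st_gt0 mu0_ok n i)).
have M_sqr n i : M n i <= psi * K n i ^+ 2.
  exact: (tv_mid_le_sqr st_gt0 (jl st mu0 n i) hpsi).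
have gap (e : R) : 0 < e -> exists2 delta : R, 0 < delta & exists n0, forall n, (n0 <= n)%N ->
    forall i, e <= K n i -> K n i <= 1 - e -> delta <= K n i - M n i.
  move=> e0; have [b b0 [n0 hn0]] := state_pair_lower_bound hFAIM.
  exists (e / (#|St| ^ 2)%:R * (b / 2)).
    by rewrite mulr_gt0 ?divr_gt0// ltr0n expn_gt0 St0.
  exists n0 => n nn0 i h1 h2.
  apply: (tv_gap_ge st_gt0 (jl_ok st_gt0 mu0_ok n i)) => // a a'.
  by rewrite state_mass_jl; exact: hn0.
have Z_minus n i : Z n.+1 i.*2 <= 2 * psi * Z n i by exact: Zpar_double.
have Z_plus n i : Z n.+1 i.*2.+1 <= psi * Z n i ^+ 2 by exact: Zpar_doubleS.
have Z_ge n i : 1 - K n i <= Z n i by exact: Zpar_ge.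
have H_le_Z n i : H n i * ln 2 <= 2 * Z n i by exact: condEnt_le_Bhat.
have Z_le_H n i (t : R) : 0 < t -> Z n i <= t + H n i * ln 2 / (2 * t).
  exact: Bhat_le_condEnt.
have G_le_H n i : (i < 2 ^ n)%N -> G n i <= H n i by exact: Hhat_le.
have G_ge n i : 1 - K n i / ln 2 <= G n i by exact: condEnt_ge_tv.
have G_le n i (t : R) : 0 < t -> G n i * ln 2 <= 2 * ((1 - K n i) / (2 * t) + t).
  move=> t0; apply: le_trans (condEnt_le_Bhat (ws0 n i)) _.
  by rewrite ler_pM2l//; exact: Bhat_le_tv.
have avg_HG n : avg n (fun i => H n i - G n i) <= C / 2 ^+ n.
  rewrite /avg ler_pM2r ?invr_gt0 ?exprn_gt0// /C ler_pdivlMr ?ln2_gt0// mulr_suml.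
  exact: sum_Hpar_Hhat.
have ZE n w : Zproc P X Y S B n w = Z n (path_index B n w).
  by rewrite /Zproc (Zi_Zpar (pXYE n)).
have avgH n : avg n (H n) = condEnt (@pXY _ _ _ P _ X Y (2 ^ n)) / (2 ^ n)%:R.
  by rewrite (condEnt_pXY st_gt0 mu0_ok (pXYE n)) natrX.
(* The averages of [H] are the subsequence [N = 2 ^ n] of the normalized block entropies, which
   converge by subadditivity; uniqueness of limits identifies the two values. *)
have HbarE : Hbar P X Y = Pr P' (good_set B Z).
  have cv : cvgn (fun N => condEnt (@pXY _ _ _ P _ X Y N) / N%:R).
    apply: fekete; first by move=> N; exact: (condEnt_pXY_ge0 hFAIM).
    by move=> N N'; exact: (condEnt_pXY_subadd hFAIM).
  have sub : (fun n => avg n (H n)) @ \oo --> Hbar P X Y.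
    rewrite (_ : (fun n => avg n (H n)) = (fun N => condEnt (@pXY _ _ _ P _ X Y N) / N%:R) \o (fun n => (2 ^ n)%N)).
      apply: cvg_comp cv => A [N _ NA]; exists N => // n /= Nn.
      by apply: NA; apply: leq_trans Nn _; rewrite ltnW// ltn_expl.
    by apply/funext => n /=; rewrite avgH.
  apply: (cvg_unique _ sub) => //.
  exact: (cvg_avg_H hB (M := M) (G := G) (psi := psi) (C := C)).
have fast beta : beta < 1 / 2 -> (fun n => Pr P' [set w |
    1 - 2 `^ (- 2 `^ (n%:R * beta)) < Z n (path_index B n w)]) @ \oo --> Pr P' (good_set B Z).
  exact: (cvg_Pr_Z_large hB (K := K) (M := M) (H := H) (G := G) (psi := psi) (C := C)).
split.
  exists (\1_(good_set B Z)); split.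
    rewrite (_ : Zproc P X Y S B = fun n w => Z n (path_index B n w)).
      exact: (Z_polarizes hB (K := K) (M := M) (H := H) (G := G) (psi := psi) (C := C)).
    by apply/funext => n; apply/funext => w; exact: ZE.
  (* Any exponent strictly between 0 and [1 / 2] would serve. *)
  exists (1 / 4); first lra.
  rewrite Pr_indic_good.
  rewrite (_ : (fun n => _) = fun n => Pr P' [set w |
    1 - 2 `^ (- 2 `^ (n%:R * (1 / 4))) < Z n (path_index B n w)]); first by apply: fast; lra.
  apply/funext => n; congr Pr; apply/seteqP; split => w /=; by rewrite ZE.
move=> beta hbeta; rewrite HbarE.
rewrite (_ : (fun n => _) = fun n => Pr P' [set w |
  1 - 2 `^ (- 2 `^ (n%:R * beta)) < Z n (path_index B n w)]); first exact: fast.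
apply/funext => n; rewrite (Pr_path_card hB n (fun i => 1 - 2 `^ (- 2 `^ (n%:R * beta)) < Z n i)).
congr (_%:R / _); apply: eq_card => i; rewrite !inE (Zi_Zpar (pXYE n)).
by rewrite natrX -(powR_mulrn n (ler0n R 2)) -powRrM.
Qed.
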